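(* Let $m, n$ be positive integers with $m \le n$, let $U$ be an open subset of $\mathbf{R}^n$, let $P \subset \mathbf{RV}_m(U)$ be appropriate, let $V \in P$, and suppose $\|\delta V\|$ is a Radon measure. Then there exists a decomposition of $V$ with respect to $P$.
   Context: $\mathbf{G}(n,m)$ is the Grassmannian of $m$-dimensional linear subspaces of $\mathbf{R}^n$. For a locally compact Hausdorff space $X$, $\mathscr{K}(X)$ is the space of continuous real-valued functions on $X$ with compact support; for a Radon measure $\mu$ and an integrable $f$, $\mu(f) = \int f \, d\mu$. Countable sets may be finite or empty. An $m$-dimensional varifold in $U$, $V \in \mathbf{V}_m(U)$, is a Radon measure on $U \times \mathbf{G}(n,m)$; its weight $\|V\|$ is the push-forward of $V$ to $U$, $\|V\|(A) = V(A \times \mathbf{G}(n,m))$. $V$ is rectifiable, $V \in \mathbf{RV}_m(U)$, if there are countably many positive real numbers $c_i$ and $\mathscr{H}^m$ measurable, countably $(\mathscr{H}^m,m)$ rectifiable sets $E_i\subset U$ such that $V(f) = \sum_i c_i \int_{E_i} f(x, \mathrm{Tan}^m(\mathscr{H}^m \llcorner E_i, x)) \, d\mathscr{H}^m x$ for $f \in \mathscr{K}(U\times \mathbf{G}(n,m))$, where $\mathrm{Tan}^m$ denotes the approximate tangent plane. The $m$-dimensional density is $\mathbf{\Theta}^m(\|V\|,x) = \lim_{r\to 0+} \boldsymbol{\alpha}(m)^{-1} r^{-m}\|V\|(\mathbf{B}(x,r))$, with $\boldsymbol{\alpha}(m)$ the volume of the unit ball of $\mathbf{R}^m$ and $\mathbf{B}(x,r)$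 the closed ball. The first variation of $V$ is the distribution $\delta V(g) = \int \mathrm{trace}(S_\natural \circ Dg(x)) \, dV(x,S)$ for smooth compactly supported $g : U \to \mathbf{R}^n$, with $S_\natural$ the orthogonal projection onto $S$. $\|\delta V\|$ is the largest Borel regular measure over $U$ with $\|\delta V\|(G) = \sup\{\delta V(g) : g \in C_c^\infty(U,\mathbf{R}^n), \operatorname{spt} g \subset G, |g| \le 1\}$ for every open $G \subset U$. For varifolds, $W \le V$ means $W(f) \le V(f)$ for all nonnegative $f \in \mathscr{K}(U\times\mathbf{G}(n,m))$; then $V-W$ is the varifold $f \mapsto V(f)-W(f)$. A condition ''$V - W \in P\setminus\{0\}$'' means that the difference is a varifold which is nonzero and belongs to $P$. Strong topology. $\mathbf{V}_m(U)$ is regarded as a subset of $\mathscr{K}(X)^*$, $X = U\times \mathbf{G}(n,m)$, the space of Daniell integrals (real-valued linear functionals that are differences of two positive ones) on $\mathscr{K}(X)$. The strong topology on $\mathscr{K}(X)^*$ is the topology of uniform convergence on bounded subsets of $\mathscr{K}(X)$ (where $\mathscr{K}(X)$ has its usual inductive limit topology); equivalently, if $K_1, K_2, \dots$ are compact with $K_i \subset \operatorname{Int} K_{i+1}$ and $X = \bigcup_i K_i$, it is generated by the seminorms $\mu \mapsto \sup\{\mu(f) : f \in \mathscr{K}(X), \operatorname{spt} f \subset K_i, |f| \le 1\}$. Definitions. (1) $P \subset \mathbf{RV}_m(U)$ is appropriate if and only if: (a) $V+W\in P$ whenever $V, W\in P$; (b) for every $V \in P$, $\mathbf{\Theta}^m(\|V\|,x)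 \ge 1$ for $\|V\|$ almost all $x$; (c) $P$ is closed with respect to the strong topology. For the following, let $P$ be appropriate, $V\in P$, and $\|\delta V\|$ a Radon measure. (2) $V$ is indecomposable with respect to $P$ if and only if there exists no $W \in P\setminus\{0\}$ such that $V-W \in P\setminus\{0\}$ and $\|\delta V\| = \|\delta W\| + \|\delta(V-W)\|$. (3) $W \in P$ is a component of $V$ with respect to $P$ if and only if $W \ne 0$, $W \le V$, $\|\delta V\| = \|\delta W\| + \|\delta(V-W)\|$, and $W$ is indecomposable with respect to $P$. (4) A countable subfamily $H$ of $P$ together with a map $\xi : H \to \{1,2,3,\dots\}$ is a decomposition of $V$ with respect to $P$ if and only if: each member of $H$ is a component of $V$ with respect to $P$; $\sum_{W\in H} \xi(W) W(k) = V(k)$ for every $k \in \mathscr{K}(U\times\mathbf{G}(n,m))$; and $\sum_{W\in H} \xi(W)\|\delta W\|(f) = \|\delta V\|(f)$ for every $f\in\mathscr{K}(U)$. *)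

(* Defs.v *)
From HB Require Import structures.
From mathcomp Require Import all_boot all_order all_algebra.
From mathcomp Require Import all_classical all_reals all_analysis.

Set Implicit Arguments.
Unset Strict Implicit.
Unset Printing Implicit Defensive.

Import Order.TTheory GRing.Theory Num.Theory.
Import numFieldNormedType.Exports.

Local Open Scope classical_set_scope.
Local Open Scope ring_scope.

(* The library's norm on 'rV[R]_n is the sup norm.  It is used only where just
   the topology, boundedness or Lipschitz continuity matters; lengths, balls
   and diameters are Euclidean. *)
Section euclidean.
Context {R : realType} {n : nat}.

Definition enorm (v : 'rV[R]_n) : R := Num.sqrt (\sum_(i < n) v 0 i ^+ 2).

Definition ecball (x : 'rV[R]_n) (r : R) : set 'rV[R]_n :=
  [set y | enorm (y - x) <= r].

Definition ediam (S : set 'rV[R]_n) : \bar R :=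
  ereal_sup [set (enorm (p.1 - p.2))%:E | p in S `*` S].

Definition box (a b : 'rV[R]_n) : set 'rV[R]_n :=
  [set x | forall i, a 0 i <= x 0 i <= b 0 i].

Definition box_volume (p : 'rV[R]_n * 'rV[R]_n) : R :=
  \prod_(i < n) (p.2 0 i - p.1 0 i).

Definition lebesgue_outer (A : set 'rV[R]_n) : \bar R :=
  ereal_inf [set (\sum_(k <oo) (box_volume (c k))%:E)%E | c in
    [set c : nat -> 'rV[R]_n * 'rV[R]_n |
      (forall k i, (c k).1 0 i <= (c k).2 0 i) /\
      A `<=` \bigcup_k box (c k).1 (c k).2]].

End euclidean.

(* The volume of the unit ball of R^m, for 0 < m. *)
Definition alpha (R : realType) (m : nat) : R :=
  fine (lebesgue_outer (ecball (0 : 'rV[R]_m) 1)).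

Section hausdorff_measure.
Context {R : realType} {n : nat}.
Variable m : nat.
Implicit Types (A S : set 'rV[R]_n).
Local Open Scope ereal_scope.

Definition hausdorff_size S : \bar R :=
  if S == set0 then 0 else (alpha R m * 2 ^- m)%:E * ediam S ^+ m.

Definition hausdorff_cover (d : R) A : set (nat -> set 'rV[R]_n) :=
  [set F | (forall k, ediam (F k) <= d%:E) /\ A `<=` \bigcup_k F k].

Definition hausdorff_pre (d : R) A : \bar R :=
  ereal_inf [set \sum_(k <oo) hausdorff_size (F k) | F in hausdorff_cover d A].

Definition hausdorff A : \bar R :=
  ereal_sup [set hausdorff_pre d A | d in [set d : R | (0 < d)%R]].

Lemma lebesgue_outer_ge0 (k : nat) (A : set 'rV[R]_k) : 0 <= lebesgue_outer A.
Proof.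
apply: le_ereal_inf_tmp => _ [c [cle _] <-]; apply: nneseries_ge0 => i _ _.
by rewrite lee_fin; apply: prodr_ge0 => j _; rewrite subr_ge0.
Qed.

Lemma alpha_ge0 : (0 <= alpha R m)%R.
Proof. exact/fine_ge0/lebesgue_outer_ge0. Qed.

Lemma ediam_ge0 S : S !=set0 -> 0 <= ediam S.
Proof.
move=> [x Sx]; apply: le_ereal_sup_tmp; exists ((enorm (x - x))%:E).
  by exists (x, x).
by rewrite lee_fin sqrtr_ge0.
Qed.

Lemma hausdorff_size_ge0 S : 0 <= hausdorff_size S.
Proof.
rewrite /hausdorff_size; case: eqP => // /eqP/set0P S0.
apply: mule_ge0; last exact/expe_ge0/ediam_ge0.
by rewrite lee_fin mulr_ge0 ?alpha_ge0// invr_ge0 exprn_ge0.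
Qed.

Lemma hausdorff_pre_ge0 d A : 0 <= hausdorff_pre d A.
Proof.
apply: le_ereal_inf_tmp => _ [F _ <-]; apply: nneseries_ge0 => k _ _.
exact: hausdorff_size_ge0.
Qed.

Lemma hausdorff_pre0 d : hausdorff_pre d set0 = 0.
Proof.
apply/eqP; rewrite eq_le hausdorff_pre_ge0 andbT.
apply: ereal_inf_lbound; exists (fun=> set0); last first.
  by rewrite eseries0// => k _ _; rewrite /hausdorff_size eqxx.
split => // k; rewrite /ediam (_ : [set _ | _ in _] = set0) ?ereal_sup0 ?leNye//.
by rewrite set0X image_set0.
Qed.

Lemma le_hausdorff_pre d A B :
  A `<=` B -> hausdorff_pre d A <= hausdorff_pre d B.
Proof.
move=> AB; apply: ereal_inf_le_tmp => _ [F [dF BF] <-]; exists F => //.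
by split => //; exact: subset_trans AB BF.
Qed.

Lemma hausdorff_pre_sigma_subadditive d : sigma_subadditive (hausdorff_pre d).
Proof.
move=> A; have [[i ioo]|] := pselect (exists i, hausdorff_pre d (A i) = +oo).
  rewrite (eseries_pinfty _ _ ioo) ?leey// => k _.
  by rewrite -ltNye (lt_le_trans _ (hausdorff_pre_ge0 _ _)).
rewrite -forallNE => Aoo.
suff add2e (e : {posnum R}) : hausdorff_pre d (\bigcup_k A k) <=
    \sum_(i <oo) hausdorff_pre d (A i) + e%:num%:E.
  by apply/lee_addgt0Pr => _/posnumP[].
rewrite (le_trans _ (epsilon_trick _ _ _))//; last first.
  by move=> k; exact: hausdorff_pre_ge0.
pose Q k (B : nat -> set 'rV[R]_n) := hausdorff_cover d (A k) B /\
  \sum_(j <oo) hausdorff_size (B j) <=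
  hausdorff_pre d (A k) + (e%:num / (2 ^ k.+1)%:R)%:E.
have [G QG] : {G : nat -> nat -> set 'rV[R]_n & forall k, Q k (G k)}.
  apply: (@choice _ _ Q) => k; rewrite /Q.
  have Afin : hausdorff_pre d (A k) \is a fin_num.
    by rewrite ge0_fin_numE ?hausdorff_pre_ge0// ltey; apply/eqP/Aoo.
  have en1 : (0 < e%:num / (2 ^ k.+1)%:R)%R by [].
  have [x [B cB Bx] xS] := lb_ereal_inf_adherent en1 Afin.
  by exists B; split => //; rewrite Bx; exact/ltW.
have G_ge0 x : 0 <= (hausdorff_size \o uncurry G) x.
  exact: hausdorff_size_ge0.
apply: (@le_trans _ _ (\esum_(i in setT) (hausdorff_size \o uncurry G) i)).
  apply: ereal_inf_lbound => /=.
  have /card_esym/ppcard_eqP[f] := card_nat2.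
  exists (uncurry G \o f).
    split => [i|].
      by rewrite /=; case: (f i) => a b; exact: (QG a).1.1.
    move=> t [i _] /((QG i).1.2) -[j _ Gij].
    by exists (f^-1%FUN (i, j)) => //=; rewrite invK ?inE.
  rewrite -(esum_pred_image (hausdorff_size \o uncurry G) _ xpredT)
    ?[fun=> _]set_true//.
  by rewrite image_eq.
rewrite (_ : esum _ _ = \sum_(i <oo) \sum_(j <oo) hausdorff_size (G i j));
    last first.
  pose J : nat -> set (nat * nat) := fun i => [set (i, j) | j in setT].
  rewrite (_ : setT = \bigcup_k J k); last first.
    by rewrite predeqE => -[a b]; split => // _; exists a => //; exists b.
  rewrite esum_bigcupT /=; last 2 first.
    - apply/trivIsetP => i j _ _ ij.
      rewrite predeqE => -[k l] /=; split => //= -[] [_] _ [<-{k} _].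
      by move=> [l' _] [] /esym/eqP; rewrite (negbTE ij).
    - by move=> /= [k l]; exact: hausdorff_size_ge0.
  rewrite -(image_id [set: nat]) -fun_true esum_pred_image//; last first.
    by move=> k _; apply: esum_ge0 => ? _; exact: G_ge0.
  apply: eq_eseriesr => /= j _.
  rewrite -(esum_pred_image (hausdorff_size \o uncurry G) (pair j) predT);
    [|by move=> *; exact: G_ge0|by move=> ? ? _ _; exact: (@can_inj _ _ _ snd)].
  by congr esum; rewrite predeqE => -[a b]; split; move=> [i _ <-]; exists i.
apply: lee_lim.
- apply: is_cvg_nneseries => k *.
  by apply: nneseries_ge0 => l *; exact: (G_ge0 (k, l)).
- apply: is_cvg_nneseries => k *; apply: adde_ge0 => //.
  exact: hausdorff_pre_ge0.
- by near=> k; apply: lee_sum => i _; exact: (QG i).2.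
Unshelve. all: by end_near. Qed.

Lemma hausdorff0 : hausdorff set0 = 0.
Proof.
rewrite /hausdorff (_ : [set _ | _ in _] = [set 0]) ?ereal_sup1//.
apply/seteqP; split => [_ [d _ <-]|_ ->] /=; first by rewrite hausdorff_pre0.
by exists 1%R; rewrite /= ?ltr01// hausdorff_pre0.
Qed.

Lemma hausdorff_ge0 A : 0 <= hausdorff A.
Proof.
apply: le_ereal_sup_tmp; exists (hausdorff_pre 1 A); last exact: hausdorff_pre_ge0.
by exists 1%R => //=; exact: ltr01.
Qed.

Lemma le_hausdorff : {homo hausdorff : A B / A `<=` B >-> A <= B}.
Proof.
move=> A B AB; apply: ge_ereal_sup => _ [d d0 <-].
apply: le_ereal_sup_tmp; exists (hausdorff_pre d B); first by exists d.
exact: le_hausdorff_pre.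
Qed.

Lemma hausdorff_sigma_subadditive : sigma_subadditive hausdorff.
Proof.
move=> A; apply: ge_ereal_sup => _ [d d0 <-].
apply: le_trans (@hausdorff_pre_sigma_subadditive d A) _.
apply: lee_nneseries => [k _ _|k _]; first exact: hausdorff_pre_ge0.
by apply: le_ereal_sup_tmp; exists (hausdorff_pre d (A k)); first by exists d.
Qed.

HB.instance Definition _ := isOuterMeasure.Build R 'rV[R]_n hausdorff
  hausdorff0 hausdorff_ge0 le_hausdorff hausdorff_sigma_subadditive.

End hausdorff_measure.

Section rectifiable_sets.
Context {R : realType} {n : nat}.
Variable m : nat.
Implicit Types (mu : set 'rV[R]_n -> \bar R) (A E S : set 'rV[R]_n).

(* The m-dimensional density of mu at x exists and equals l. *)
Definition has_density mu (x : 'rV[R]_n) (l : \bar R) : Prop :=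
  (fun r : R => (((alpha R m)^-1 * r ^- m)%:E * mu (ecball x r))%E) @ 0^'+ --> l.

(* A family indexed by nat may contain empty sets, so that finite families are
   covered. *)
Definition countably_rectifiable E : Prop :=
  exists (A : nat -> set 'rV[R]_m) (phi : nat -> 'rV[R]_m -> 'rV[R]_n),
    (forall i, bounded_set (A i) /\ [lipschitz phi i x | x in A i]) /\
    hausdorff m (E `\` \bigcup_i (phi i @` A i)) = 0%E.

(* Federer, Geometric Measure Theory, 3.1.21. *)
Definition tangent_cone S (a : 'rV[R]_n) : set 'rV[R]_n :=
  [set v | forall e : R, 0 < e -> exists x (r : R),
     [/\ S x, 0 < r, enorm (x - a) < e & enorm (r *: (x - a) - v) < e]].

(* Federer, Geometric Measure Theory, 3.2.16. *)
Definition approx_tangent mu (a : 'rV[R]_n) : set 'rV[R]_n :=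
  [set v | forall S, has_density (fun A => mu (A `\` S)) a 0%E ->
     tangent_cone S a v].

Definition is_tangent_plane E (x : 'rV[R]_n) (S : {vspace 'rV[R]_n}) : Prop :=
  \dim S = m /\
  [set v | v \in S] = approx_tangent (fun A => hausdorff m (A `&` E)) x.

(* Tan^m(H^m restricted to E, x); the junk value 0 is not in G(n,m) for 0 < m. *)
Definition tangent_plane E (x : 'rV[R]_n) : {vspace 'rV[R]_n} :=
  xget 0%VS (is_tangent_plane E x).

End rectifiable_sets.

Section grassmannian.
Context {R : realType} {n : nat}.

(* The orthogonal projection onto S, acting on row vectors from the right: the
   projection onto the row space of a basis matrix B along its orthogonal
   complement, which is the row kernel of B^T. *)
Definition orth_proj (S : {vspace 'rV[R]_n}) : 'M[R]_n :=
  let B : 'M[R]_(\dim S, n) := \matrix_(i < \dim S) (vbasis S)`_i in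
  proj_mx <<B>>%MS (kermx B^T).

(* The disjoint union of all G(n,m), 0 <= m <= n, with the topology for which
   S |-> orth_proj S is an embedding; each G(n,m) is open and closed in it. *)
Definition subspaces : Type := initial_topology orth_proj.

HB.instance Definition _ :=
  Topological.copy subspaces (initial_topology orth_proj).
HB.instance Definition _ := isPointed.Build subspaces (0%VS : {vspace 'rV[R]_n}).

Definition grassmann (m : nat) : set subspaces :=
  [set S | \dim (S : {vspace 'rV[R]_n}) = m].

End grassmannian.
Arguments subspaces : clear implicits.

(* Measure theory over an open subset O of a space T.  A measure over O is a
   measure on the Borel sigma-algebra of T vanishing outside O.  Its values on
   arbitrary sets, which the library leaves unconstrained, are those of the
   associated Borel regular outer measure, so that equality of measures is
   Leibniz equality. *)
Notation borel T := (g_sigma_algebraType (@open T)).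

Section radon.
Context {R : realType} {T : ptopologicalType}.
Variable O : set T.
Implicit Types (mu : {measure set (borel T) -> \bar R}) (A B G K : set T).
Local Open Scope ereal_scope.

Definition borel_regular mu : Prop := forall A,
  mu A = ereal_inf [set mu B | B in
    [set B : set (borel T) | measurable B /\ A `&` O `<=` B]].

Definition radon mu : Prop :=
  [/\ forall K, compact K -> K `<=` O -> mu K < +oo,
      forall G, open G -> G `<=` O ->
        mu G = ereal_sup [set mu K | K in [set K | compact K /\ K `<=` G]] &
      forall A,
        mu A = ereal_inf [set mu G | G in [set G | open G /\ A `&` O `<=` G]]].

Definition spt {V : zmodType} (f : T -> V) : set T :=
  closure [set x | f x != 0%R].

(* The space K(O), each function being extended by 0 to T. *)
Definition Kspace : set (T -> R) :=
  [set f | [/\ continuous f, compact (spt f) & spt f `<=` O]].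

Definition linear_functional (L : Kspace -> R) : Prop :=
  forall (a : R) (f g h : Kspace),
    (forall x, set_val h x = a * set_val f x + set_val g x)%R ->
    (L h = a * L f + L g)%R.

Definition positive_functional (L : Kspace -> R) : Prop :=
  forall f : Kspace, (forall x, 0 <= set_val f x)%R -> (0 <= L f)%R.

Definition daniell (L : Kspace -> R) : Prop :=
  exists L1 L2 : Kspace -> R,
    [/\ linear_functional L1 /\ positive_functional L1,
        linear_functional L2 /\ positive_functional L2 &
        forall f, L f = (L1 f - L2 f)%R].

Definition Kbounded : set (set Kspace) :=
  [set [set f : Kspace | spt (set_val f) `<=` K /\
                         forall x, (`|set_val f x| <= 1)%R]
    | K in [set K | compact K /\ K `<=` O]].

(* For D a set of Daniell integrals: D is closed in K(O)^* with respect to the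
   strong topology. *)
Definition strong_closed (D : set (Kspace -> R)) : Prop :=
  closed (D : set (subspace (daniell : set {family Kbounded, Kspace -> R}))).

End radon.

Lemma radon_mzero (R : realType) (T : ptopologicalType) (O : set T) :
  radon O (@mzero _ (borel T) R).
Proof.
split => [K _ _|G _ _|A]; first by rewrite /mzero ltry.
- rewrite (_ : [set _ | _ in _] = [set 0%E]) ?ereal_sup1//.
  apply/seteqP; split => [_ [K _ <-]//|_ ->]; exists set0 => //.
  by split => //; exact: compact0.
- rewrite (_ : [set _ | _ in _] = [set 0%E]) ?ereal_inf1//.
  apply/seteqP; split => [_ [K _ <-]//|_ ->]; exists setT => //.
  by split => //; exact: openT.
Qed.

(* Unordered summation: the finite partial sums over H converge to l. *)
Definition sums_to {R : realType} {I : choiceType} (H : set I) (f : I -> R)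
    (l : R) : Prop :=
  forall e : R, 0 < e -> exists2 F0 : set I, finite_set F0 /\ F0 `<=` H &
    forall F : set I, finite_set F -> F0 `<=` F -> F `<=` H ->
      `|\sum_(i \in F) f i - l| < e.

Definition iter_derive {R : realType} {n k : nat} (s : seq 'rV[R]_n)
    (g : 'rV[R]_n -> 'rV[R]_k) : 'rV[R]_n -> 'rV[R]_k :=
  foldr (fun v h => 'D_v h) g s.

Definition smooth {R : realType} {n k : nat} (g : 'rV[R]_n -> 'rV[R]_k) : Prop :=
  forall (s : seq 'rV[R]_n) x, differentiable (iter_derive s g) x.

HB.saturate prod.

Section varifolds.
Context {R : realType} {n : nat}.
Variables (m : nat) (U : set 'rV[R]_n).

Local Notation bundle := ('rV[R]_n * subspaces R n)%type.

Definition UG : set bundle := U `*` grassmann m.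

Record varifold := Varifold {
  vmeasure :> {measure set (borel bundle) -> \bar R} ;
  vradon : radon UG vmeasure }.

HB.instance Definition _ := gen_eqMixin varifold.
HB.instance Definition _ := gen_choiceMixin varifold.

Definition vzero : varifold := Varifold (radon_mzero R UG).

Definition vfun (V : varifold) (f : bundle -> R) : R := Rintegral V UG f.

Definition vdual (V : varifold) : Kspace (R := R) UG -> R :=
  fun f => vfun V (set_val f).

Definition weight (V : varifold) (A : set 'rV[R]_n) : \bar R := V (A `*` setT).

(* The index set nat covers finite families, as E i may be empty. *)
Definition rectifiable (V : varifold) : Prop :=
  exists (c : nat -> R) (E : nat -> set 'rV[R]_n),
    (forall i, [/\ 0 < c i, E i `<=` U, (hausdorff m).-caratheodory (E i),
       countably_rectifiable m (E i) &
       hausdorff m [set x | E i x /\ ~ exists S, is_tangent_plane m (E i) x S]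
         = 0%E]) /\
    forall f, Kspace UG f ->
      (fun N => \sum_(i < N) (c i)%:E *
         \int[(hausdorff m : set (caratheodory_type (hausdorff m)) -> \bar R)]_(x in E i)
           (f (x, tangent_plane m (E i) x))%:E)%E @ \oo --> (vfun V f)%:E.

Definition first_variation (V : varifold) (g : 'rV[R]_n -> 'rV[R]_n) : R :=
  vfun V (fun z => \tr ('J g z.1 *m orth_proj z.2)).

Definition test_field (G : set 'rV[R]_n) : set ('rV[R]_n -> 'rV[R]_n) :=
  [set g | [/\ smooth g, compact (spt g), spt g `<=` G &
               forall x, enorm (g x) <= 1]].

Definition extends_variation (V : varifold)
    (mu : {measure set (borel 'rV[R]_n) -> \bar R}) : Prop :=
  borel_regular U mu /\
  forall G, open G -> G `<=` U ->
    mu G = ereal_sup [set (first_variation V g)%:E | g in test_field G].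

Definition largest_variation (V : varifold)
    (mu : {measure set (borel 'rV[R]_n) -> \bar R}) : Prop :=
  extends_variation V mu /\
  forall nu : {measure set (borel 'rV[R]_n) -> \bar R},
    extends_variation V nu -> forall A, (nu A <= mu A)%E.

(* ||delta V||; for open U the largest measure exists, so that mzero is not
   used. *)
Definition delta_norm (V : varifold) : {measure set (borel 'rV[R]_n) -> \bar R} :=
  if pselect (exists mu, largest_variation V mu) is left h then sval (cid h)
  else mzero.

(* V + W and V - W are determined by their values on K(U x G(n,m)). *)
Definition vsum (V W Z : varifold) : Prop :=
  forall k, Kspace UG k -> vfun Z k = vfun V k + vfun W k.

Definition vdiff (V W Z : varifold) : Prop :=
  forall k, Kspace UG k -> vfun Z k = vfun V k - vfun W k.

Definition vle (W V : varifold) : Prop :=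
  forall k, Kspace UG k -> (forall z, 0 <= k z) -> vfun W k <= vfun V k.

Definition appropriate (P : set varifold) : Prop :=
  [/\ P `<=` rectifiable,
      forall V W Z, P V -> P W -> vsum V W Z -> P Z,
      forall V, P V -> weight V
        [set x | ~ exists2 t, has_density m (weight V) x t & (1 <= t)%E] = 0%E &
      strong_closed (vdual @` P)].

Definition splits_variation (V W Z : varifold) : Prop :=
  forall A, delta_norm V A = (delta_norm W A + delta_norm Z A)%E.

Definition indecomposable (P : set varifold) (V : varifold) : Prop :=
  ~ exists W Z, [/\ (P `\ vzero) W, vdiff V W Z, (P `\ vzero) Z &
                    splits_variation V W Z].

Definition component (P : set varifold) (V W : varifold) : Prop :=
  [/\ P W, W <> vzero, vle W V,
      exists2 Z, vdiff V W Z & splits_variation V W Z &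
      indecomposable P W].

Definition decomposition (P : set varifold) (V : varifold)
    (H : set varifold) (xi : varifold -> nat) : Prop :=
  [/\ countable H /\ H `<=` P,
      forall W, H W -> (0 < xi W)%N,
      forall W, H W -> component P V W,
      forall k, Kspace UG k ->
        sums_to H (fun W => (xi W)%:R * vfun W k) (vfun V k) &
      forall f, Kspace U f ->
        sums_to H (fun W => (xi W)%:R * Rintegral (delta_norm W) U f)
          (Rintegral (delta_norm V) U f)].

End varifolds.

(* Main.v *)
Require Import Defs.
From HB Require Import structures.
From mathcomp Require Import all_boot all_order all_algebra.
From mathcomp Require Import all_classical all_reals all_analysis.
From mathcomp Require Import measurable_realfun ring lra.

Set Implicit Arguments.
Unset Strict Implicit.
Unset Printing Implicit Defensive.

Import Order.TTheory GRing.Theory Num.Theory.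
Import numFieldNormedType.Exports.

Local Open Scope classical_set_scope.
Local Open Scope ring_scope.

(* Call a piece of V a member W of P, or 0, such that V - W is also in P, or 0,
   and ||delta V|| = ||delta W|| + ||delta (V - W)||.  Let A_i be the set of
   points x with ||delta V|| B(x,t) <= (i+1) t^m for all t <= 1/(i+1).  Testing
   the first variation with truncations of |y-x|^-m (y-x) yields an approximate
   monotonicity of mass ratios.  As pieces have density at least 1 and smaller
   variation than V, it shows that a piece charging A_i has mass at least some
   d_i > 0 on a fixed compact neighbourhood of A_i; and together with a Vitali
   covering it shows that the A_i cover ||V|| almost all of U.  Decreasing
   chains of pieces converge strongly, and lower semicontinuity of the variation
   makes their limits pieces again.  Splitting V repeatedly, at the i-th step
   until no further splitting has both parts charging A_i, gives an
   indecomposable piece in the limit.  Removing such pieces greedily exhausts V,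
   since each removal of a piece charging A_i costs mass d_i; for the same reason
   each piece is removed only finitely often. *)

(** * Smooth functions *)

(** The usual form of local monotonicity bounds the variation of a ball by its mass. Such a bound is
    not inherited by a piece, whose mass may be far smaller than that of [V]. A bound [L * t ^+ m]
    on the variation of balls is inherited, because the variation of a piece is at most that of [V],
    and it turns the errors at dyadic scales into a geometric series. As [delta_norm V] is only
    Radon, the resulting lower mass bound is uniform on each good set but not on all of them
    together, and a nonzero piece may charge only good sets of large index. So one minimization does
    not produce an indecomposable piece: a splitting of the limit has parts charging sets of some
    indices [a] and [c], and it is excluded by the stage that dealt with an index at least [a + c].
    The family [P] need not contain 0 although complements and limits of pieces may be 0, hence the
    family [Q]. The same varifold may be removed at several stages; their number is the multiplicity
    [xi]. The sums converge unconditionally since they are dominated by integrals of absolute values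
    whose remainders tend to 0. *)

Section iterated_differentiability.
Context {R : realType} {V : normedModType R}.
Implicit Types (f g : V -> R) (k : nat) (v x : V).

(** All iterated directional derivatives of order at most [k] are differentiable. The recursion
    peels off the derivative taken first, so that product, quotient and chain rules follow by
    induction on [k]; for all [k] at once this is [smooth], see [smoothP]. *)
Fixpoint Ck {W : normedModType R} (k : nat) (f : V -> W) : Prop :=
  (forall x, differentiable f x) /\
  (if k is k'.+1 then forall v, Ck k' ('D_v f) else True).

Lemma Ck_diff {W : normedModType R} k (f : V -> W) x :
  Ck k f -> differentiable f x.
Proof. by case: k => [|k] []. Qed.

Lemma Ck_S {W : normedModType R} k (f : V -> W) : Ck k.+1 f -> Ck k f.
Proof.
elim: k f => [|k IH] f [fd fv]; first by split.
by split => // v; apply: IH; exact: fv.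
Qed.

Lemma Ck_foldr {W : normedModType R} (s : seq V) k (f : V -> W) :
  Ck (size s + k) f -> Ck k (foldr (fun v h => 'D_v h) f s).
Proof.
elim: s k => [//|v s IH] k; move=> cf.
have [_] : Ck k.+1 (foldr (fun v h => 'D_v h) f s) by apply: IH; rewrite -addSnnS.
exact.
Qed.

Lemma Ck_cst k (c : R) : Ck k (cst c : V -> R).
Proof.
elim: k c => [|k IH] c; split => // v.
by rewrite (_ : 'D_v _ = cst 0)//; apply/funext => x; rewrite derive_cst.
Qed.

Lemma CkD k f g : Ck k f -> Ck k g -> Ck k (fun x => f x + g x).
Proof.
elim: k f g => [|k IH] f g [df f'] [dg g'].
  by split => // x; exact: differentiableD.
split => [x|v]; first exact: differentiableD.
rewrite (_ : 'D_v _ = (fun x => 'D_v f x + 'D_v g x)).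
  exact: (IH _ _ (f' v) (g' v)).
by apply/funext => x; rewrite deriveD//; exact: diff_derivable.
Qed.

Lemma CkM k f g : Ck k f -> Ck k g -> Ck k (fun x => f x * g x).
Proof.
elim: k f g => [|k IH] f g cf cg; have [df f'] := cf; have [dg g'] := cg.
  by split => // x; exact: differentiableM.
split => [x|v]; first exact: differentiableM.
rewrite (_ : 'D_v _ = (fun x => f x * 'D_v g x + g x * 'D_v f x)).
  by apply: CkD; [apply: IH (Ck_S cf) (g' v)|apply: IH (Ck_S cg) (f' v)].
by apply/funext => x; rewrite deriveM//; exact: diff_derivable.
Qed.

Lemma CkN k f : Ck k f -> Ck k (fun x => - f x).
Proof.
move=> cf; rewrite (_ : (fun _ => _) = (fun x => cst (-1) x * f x)).
  by apply: CkM => //; exact: Ck_cst.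
by apply/funext => x; rewrite mulN1r.
Qed.

Lemma CkB k f g : Ck k f -> Ck k g -> Ck k (fun x => f x - g x).
Proof. by move=> cf cg; apply: CkD => //; exact: CkN. Qed.

Lemma Ck_sum k (I : Type) (r : seq I) (F : I -> V -> R) :
  (forall i, Ck k (F i)) -> Ck k (fun x => \sum_(i <- r) F i x).
Proof.
move=> cF; elim: r => [|i r IH].
  by under eq_fun do rewrite big_nil; exact: Ck_cst.
by under eq_fun do rewrite big_cons; exact: CkD.
Qed.

Lemma CkV k f : (forall x, f x != 0) -> Ck k f -> Ck k (fun x => (f x)^-1).
Proof.
move=> f0; elim: k => [|k IH] cf; have [df f'] := cf.
  by split => // x; exact: differentiableV.
split => [x|v]; first exact: differentiableV.
rewrite (_ : 'D_v _ = (fun x => - ((f x)^-1 * (f x)^-1) * 'D_v f x)).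
  have cV := IH (Ck_S cf).
  exact: (CkM (CkN (CkM cV cV)) (f' v)).
apply/funext => x; rewrite deriveV//; last exact: diff_derivable.
by rewrite expr2 invfM.
Qed.

(** A whole sequence of successive derivatives is carried so that the induction can pass from
    [phi j] to [phi j.+1]. The domain [D] admits functions such as negative real powers, which are
    smooth on a half-line only. *)
Lemma Ck_comp k (phi : nat -> R -> R) (D : set R) f j :
  (forall i t, D t -> is_derive t 1 (phi i) (phi i.+1 t)) ->
  (forall x, D (f x)) -> Ck k f -> Ck k (fun x => phi j (f x)).
Proof.
move=> dphi Df; elim: k j => [|k IH] j cf; have [df f'] := cf.
  split => // x; apply: (@differentiable_comp _ _ _ _ f (phi j)) => //.
  by apply/derivable1_diffP; have [] := dphi j _ (Df x).
have dphif x : differentiable (phi j) (f x).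
  by apply/derivable1_diffP; have [] := dphi j _ (Df x).
split => [x|v].
  exact: (@differentiable_comp _ _ _ _ f (phi j)).
rewrite (_ : 'D_v _ = (fun x => 'D_v f x * phi j.+1 (f x))).
  exact: (CkM (f' v) (IH j.+1 (Ck_S cf))).
apply/funext => x; rewrite deriveE; last first.
  exact: (@differentiable_comp _ _ _ _ f (phi j)).
rewrite (@diff_comp _ _ _ _ f (phi j))//=.
have [_ <-] := dphi j _ (Df x).
rewrite -derive1E.
have dj : derivable (phi j) (f x) 1 by have [] := dphi j _ (Df x).
have /= e := (congr1 (fun h : R -> R => h ('d f x v)) (deriv1E dj)).
by rewrite e /= deriveE.
Qed.

End iterated_differentiability.

Section real_Ck.
Context {R : realType}.

Lemma Ck_derive1n (f : R -> R) i : (forall k, Ck k f) ->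
  forall k, Ck k f^`(i)%classic.
Proof.
move=> cf; elim: i => [|i IH] k; first exact: cf.
have -> : f^`(i.+1)%classic = 'D_1 (f^`(i)%classic) :> (R -> R).
  by apply/funext => x; rewrite derive1nS derive1E.
by have [_] := IH k.+1; exact.
Qed.

Lemma is_derive_derive1n (f : R -> R) : (forall k, Ck k f) ->
  forall (i : nat) (t : R), is_derive t 1 (f^`(i)%classic) (f^`(i.+1)%classic t).
Proof.
move=> cf i t; rewrite derive1nS derive1E; apply: derivableP.
by apply/diff_derivable/(@Ck_diff _ _ _ 0)/Ck_derive1n.
Qed.

Lemma Ck_of_family (phi : nat -> R -> R) :
  (forall (i : nat) (t : R), is_derive t 1 (phi i) (phi i.+1 t)) ->
  forall k i, Ck k (phi i).
Proof.
move=> dphi k i; apply: (@Ck_comp _ _ k phi setT id) => //.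
elim: k => [|k IH]; split => // v.
rewrite (_ : 'D_v _ = cst v); first exact: Ck_cst.
by apply/funext => x; rewrite derive_id.
Qed.

Lemma Ck_comp1 (V : normedModType R) (phi : R -> R) (f : V -> R) k :
  (forall k, Ck k phi) -> Ck k f -> Ck k (phi \o f).
Proof.
move=> cphi cf.
have gen (fam : nat -> R -> R) : fam 0%N = phi ->
    (forall (i : nat) (t : R), is_derive t 1 (fam i) (fam i.+1 t)) -> Ck k (phi \o f).
  move=> <- dfam; apply: (@Ck_comp _ _ k fam setT f 0%N) => // i t _; exact: dfam.
exact: (gen _ (derive1n0 phi) (is_derive_derive1n cphi)).
Qed.

End real_Ck.

Section smooth_fields.
Context {R : realType} {n l : nat}.
Implicit Type g : 'rV[R]_n -> 'rV[R]_l.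

Lemma smoothP g : smooth g <-> forall k, Ck k g.
Proof.
split=> [sg k|cg s x]; last first.
  apply: (@Ck_diff _ _ _ 0); apply: Ck_foldr; exact: cg.
elim: k g sg => [|k IH] g sg.
  by split => // x; exact: (sg [::] x).
split=> [x|v]; first exact: (sg [::] x).
(* [iter_derive] applies the head of the list last, so the derivative taken first belongs to the
   last vector. *)
apply: IH => s x; have := sg (rcons s v) x.
by rewrite /iter_derive foldr_rcons.
Qed.

Lemma differentiable_rV (V : normedModType R) (g : V -> 'rV[R]_l) x :
  (forall i, differentiable (fun y => g y 0 i) x) -> differentiable g x.
Proof.
move=> dg; rewrite (_ : g = \sum_(i < l) (fun y => g y 0 i *: delta_mx 0 i)).
  by apply: differentiable_sum => i; exact: differentiableZl.
by apply/funext => y; rewrite fct_sumE; exact: row_sum_delta.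
Qed.

Lemma Ck_rV (V : normedModType R) k (g : V -> 'rV[R]_l) :
  Ck k g <-> forall i, Ck k (fun x => g x 0 i).
Proof.
have derE (h : V -> 'rV[R]_l) v : (forall x, differentiable h x) ->
    forall i, (fun x => 'D_v h x 0 i) = 'D_v (fun x => h x 0 i).
  move=> dh i; apply/funext => x; rewrite derive_mx ?mxE//.
  exact: diff_derivable.
elim: k g => [|k IH] g; split.
- move=> [dg _] i; split => // x.
  apply: (@differentiable_comp _ _ _ _ g (fun M => M 0 i)) => //.
  exact: differentiable_coord.
- by move=> cg; split => // x; apply: differentiable_rV => i; case: (cg i).
- move=> [dg g'] i; split => [x|v].
    apply: (@differentiable_comp _ _ _ _ g (fun M => M 0 i)) => //.
    exact: differentiable_coord.
  by rewrite -derE//; move/IH: (g' v); exact.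
- move=> cg; have dg x : differentiable g x.
    by apply: differentiable_rV => i; case: (cg i).
  split => // v; apply/IH => i; rewrite derE//.
  by have [_] := cg i; exact.
Qed.

Lemma smooth_coordP g : smooth g <-> forall k i, Ck k (fun x => g x 0 i).
Proof.
split=> [/smoothP cg k i|cg]; first exact: (Ck_rV _ _).1.
by apply/smoothP => k; apply/Ck_rV => i.
Qed.

Lemma differentiable_coord_shift i (x y : 'rV[R]_n) :
  differentiable (fun y : 'rV[R]_n => (y - x) 0 i) y.
Proof.
apply: (@differentiable_comp _ _ _ _ (fun y => y - x) (fun M => M 0 i)).
  by apply: (@differentiableB _ _ _ id (cst x)) => //; exact: differentiable_cst.
exact: differentiable_coord.
Qed.

Lemma derive_coord_shift i (v x y : 'rV[R]_n) :
  'D_v (fun y : 'rV[R]_n => (y - x) 0 i) y = v 0 i.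
Proof.
have /derive_mx e : derivable (fun y : 'rV[R]_n => y - x) y v.
  apply: diff_derivable.
  by apply: (@differentiableB _ _ _ id (cst x)) => //; exact: differentiable_cst.
have := congr1 (fun M : 'rV_n => M 0 i) e; rewrite mxE => <- /=.
have -> : (fun y => y - x) = id - cst x by [].
rewrite deriveB; [|exact: derivable_id|exact: derivable_cst].
by rewrite derive_id derive_cst subr0.
Qed.

Lemma Ck_coord k i (x : 'rV[R]_n) : Ck k (fun y : 'rV[R]_n => (y - x) 0 i).
Proof.
have dc := @differentiable_coord_shift i x.
case: k => [|k]; split => // v.
rewrite (_ : 'D_v _ = cst (v 0 i)); first exact: Ck_cst.
by apply/funext => y; exact: derive_coord_shift.
Qed.

End smooth_fields.

(** * A smooth cutoff function *)

Section bump.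
Context {R : realType}.
Implicit Types (p : {poly R}) (t w : R) (k : nat).

(** With [w = 1/t] this makes [flat p] quadratically small at 0, so that its derivative there is 0.
    The bound comes from one term of the exponential series, of degree two more than the number of
    coefficients. *)
Lemma horner_expR_bound p :
  exists C : R, 0 <= C /\ forall w, 1 <= w -> `|p.[w]| * expR (- w) * w ^+ 2 <= C.
Proof.
pose N := size p; pose S := \sum_(i < N) `|p`_i|.
exists (S * (N.+2)`!%:R); split.
  by rewrite mulr_ge0// sumr_ge0.
move=> w w1.
have w0 : 0 <= w by rewrite (le_trans _ w1).
have pS : `|p.[w]| <= S * w ^+ N.
  rewrite horner_coef (le_trans (ler_norm_sum _ _ _))// mulr_suml.
  apply: ler_sum => i _; rewrite normrM ler_wpM2l// normrX ger0_norm//.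
  by rewrite ler_weXn2l// ltnW.
have ew : w ^+ N.+2 <= (N.+2)`!%:R * expR w.
  rewrite mulrC -ler_pdivrMr ?ltr0n ?fact_gt0//.
  by rewrite (le_trans _ (expR_ge1Dxn N.+1 w0))// lerDr.
rewrite expRN -mulrA mulrCA ler_pdivrMl ?expR_gt0//.
apply: (le_trans (ler_wpM2r (sqr_ge0 w) pS)).
rewrite -mulrA -exprD addn2 [leRHS]mulrCA ler_wpM2l ?sumr_ge0//.
by rewrite [leRHS]mulrC.
Qed.

(* The family is stable under derivation (see [flat_derive]), hence smooth. *)
Definition flat p t : R := if 0 < t then p.[t^-1] * expR (- t^-1) else 0.

Lemma flat_derive0 p : is_derive (0 : R) 1 (flat p) 0.
Proof.
have [C [C0 pC]] := horner_expR_bound p.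
have bd t : `|t| <= 1 -> `|flat p t| <= C * t ^+ 2.
  rewrite /flat; case: ifPn => [t0 t1|_ _]; last by rewrite normr0 mulr_ge0 ?sqr_ge0.
  have {}t1 : 1 <= t^-1 by rewrite invf_ge1// -(gtr0_norm t0).
  have := pC _ t1; rewrite exprVn.
  by rewrite -ler_pdivrMr ?exprn_gt0// normrM (ger0_norm (expR_ge0 _)).
have f0 : flat p 0 = 0 by rewrite /flat ltxx.
have lim : h^-1 *: ((flat p \o shift 0) (h *: 1) - flat p 0) @[h --> 0^'] --> (0 : R).
  apply/cvgrPdist_le => e e0; near=> h.
  rewrite /= sub0r normrN f0 subr0 addr0 normrZ [h *: 1]mulr1 normfV.
  have h0 : h != 0 by near: h; exact: nbhs_dnbhs_neq.
  have h1 : `|h| <= 1 by near: h; exact: dnbhs0_le.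
  have he : `|h| <= e / (C + 1).
    by near: h; apply: dnbhs0_le; rewrite divr_gt0// ltr_wpDl.
  rewrite ler_pdivrMl ?normr_gt0// (le_trans (bd _ h1))//.
  rewrite -(real_normK (num_real h)) expr2 mulrCA ler_wpM2l//.
  rewrite (le_trans (ler_wpM2l C0 he))// mulrCA ler_piMr ?(ltW e0)//.
  by rewrite ler_pdivrMr ?ltr_wpDl// mul1r lerDl.
by apply: DeriveDef; [apply/cvg_ex; exists 0|apply: cvg_lim].
Unshelve. all: by end_near. Qed.

Lemma flat_derive p t : is_derive t 1 (flat p) (flat ('X^2 * (p - p^`())) t).
Proof.
have [t0|t0|t0] := ltgtP 0 t.
- have near_t : \forall s \near t, p.[s^-1] * expR (- s^-1) = flat p s.
    near=> s; rewrite /flat ifT//; near: s; exact: lt_nbhsr.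
  have tn0 : t != 0 by rewrite gt_eqF.
  rewrite /flat t0.
  have -> : ('X^2 * (p - p^`())).[t^-1] * expR (- t^-1) =
     p.[t^-1] * (t ^- 2 * expR (- t^-1)) + expR (- t^-1) * (- t ^- 2 * p^`().[t^-1]).
    rewrite hornerM hornerXn hornerD hornerN exprVn; ring.
  apply: (near_eq_is_derive near_t).
  have dV : is_derive t 1 (fun s : R => s^-1) (- t ^- 2).
    apply: DeriveDef; first exact: (@derivableV _ _ id _ _ tn0 (@derivable_id _ _ _ _)).
    by rewrite (@deriveV _ _ id _ _ tn0 (@derivable_id _ _ _ _)) derive_id [_ *: _]mulr1.
  have dp : is_derive t 1 (fun s : R => p.[s^-1]) (- t ^- 2 * p^`().[t^-1]).
    apply: DeriveDef.
      apply/derivable1_diffP; apply: differentiable_comp.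
        by apply/derivable1_diffP; have [] := dV.
      by apply/derivable1_diffP; exact: derivable_horner.
    rewrite -derive1E derive1_comp; last 2 first.
      by have [] := dV.
      exact: derivable_horner.
    by rewrite -derivE derive1E mulrC; have [_ ->] := dV.
  have dE : is_derive t 1 (fun s : R => expR (- s^-1)) (t ^- 2 * expR (- t^-1)).
    have dN : is_derive t 1 (fun s : R => - s^-1) (t ^- 2).
      by have := is_deriveN dV; rewrite opprK.
    apply: DeriveDef.
      apply/derivable1_diffP; apply: (@differentiable_comp _ _ _ _ (fun s : R => - s^-1)).
        by apply/derivable1_diffP; have [] := dN.
      by apply/derivable1_diffP; exact: derivable_expR.
    rewrite -derive1E (@derive1_comp _ (fun s : R => - s^-1)); last 2 first.
      by have [] := dN.
      exact: derivable_expR.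
    have [_ e1] := dN; have [_ e2] := is_derive_expR (- t^-1).
    by rewrite !derive1E e1 e2 mulrC.
  exact: is_deriveM.
- rewrite [flat (_ * _) _]/flat ltNge (ltW t0)/=.
  have near_t : \forall s \near t, cst 0 s = flat p s.
    near=> s; rewrite /flat ltNge ifF//; apply/negbF/ltW; near: s; exact: lt_nbhsl.
  apply: (near_eq_is_derive near_t).
- rewrite -t0 [flat _ 0]/flat ltxx; exact: flat_derive0.
Unshelve. all: by end_near. Qed.

Lemma flat_Ck p k : Ck k (flat p).
Proof.
pose P i := iter i (fun q => 'X^2 * (q - q^`())) p.
exact: (@Ck_of_family _ (fun i => flat (P i)) (fun i t => flat_derive (P i) t) k 0%N).
Qed.

Lemma flat1_gt0 t : 0 < t -> 0 < flat 1 t.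
Proof. by move=> t0; rewrite /flat t0 hornerC mul1r expR_gt0. Qed.

Lemma flat1_ge0 t : 0 <= flat 1 t.
Proof. by rewrite /flat; case: ifP => // _; rewrite hornerC mul1r expR_ge0. Qed.

Lemma flat1_le0 t : t <= 0 -> flat 1 t = 0.
Proof. by rewrite leNgt /flat => /negbTE ->. Qed.

(** A smooth step, 1 up to 1/4 and 0 from 1/2 on. Its argument will be a squared ratio
    [|y - x|^2 / rho^2], which is smooth in [y]; in terms of the distance the step lies between
    [rho / 2] and [rho / sqrt 2]. *)
Definition cutoff t : R :=
  flat 1 (2^-1 - t) / (flat 1 (2^-1 - t) + flat 1 (t - 4^-1)).

Let denom_gt0 t : 0 < flat 1 (2^-1 - t) + flat 1 (t - 4^-1).
Proof.
have [t1|t1] := ltP t 2^-1.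
  by rewrite ltr_pwDl ?flat1_ge0// flat1_gt0// subr_gt0.
by rewrite ltr_wpDl ?flat1_ge0// flat1_gt0//; lra.
Qed.

Lemma cutoff_Ck k : Ck k cutoff.
Proof.
have cid : Ck k (id : R -> R).
  case: k => [|k]; split => // v.
  rewrite (_ : 'D_v _ = cst v); first exact: Ck_cst.
  by apply/funext => x; rewrite derive_id.
have c1 : Ck k (fun t : R => flat 1 (2^-1 - t)).
  exact: (@Ck_comp1 _ _ (flat 1) _ k (flat_Ck 1) (CkB (Ck_cst k _) cid)).
have c2 : Ck k (fun t : R => flat 1 (t - 4^-1)).
  exact: (@Ck_comp1 _ _ (flat 1) _ k (flat_Ck 1) (CkB cid (Ck_cst k _))).
apply: (CkM c1); apply: CkV; last exact: (CkD c1 c2).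
by move=> x; rewrite gt_eqF.
Qed.

Lemma cutoff_ge0 t : 0 <= cutoff t.
Proof. by rewrite divr_ge0 ?flat1_ge0// ltW. Qed.

Lemma cutoff_le1 t : cutoff t <= 1.
Proof. by rewrite ler_pdivrMr// mul1r lerDl flat1_ge0. Qed.

Lemma cutoff1 t : t <= 4^-1 -> cutoff t = 1.
Proof.
move=> t4; rewrite /cutoff [flat 1 (t - _)]flat1_le0 ?subr_le0// addr0 divff//.
by rewrite gt_eqF// flat1_gt0//; lra.
Qed.

Lemma cutoff0 t : 2^-1 <= t -> cutoff t = 0.
Proof. by move=> t2; rewrite /cutoff [flat 1 (2^-1 - t)]flat1_le0 ?subr_le0// mul0r. Qed.

Lemma cutoff_derive t : is_derive t 1 cutoff (cutoff^`()%classic t).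
Proof.
rewrite derive1E; apply: derivableP; apply: diff_derivable.
exact: (@Ck_diff _ _ _ 0 _ _ (cutoff_Ck 0)).
Qed.

(** The derivative is continuous on [0,1] and vanishes beyond 1. This is the constant [C] of the
    monotonicity estimate. *)
Lemma cutoff_derive_bound : exists2 C : R, 0 < C &
  forall t, 0 <= t -> `|cutoff^`()%classic t| <= C.
Proof.
have [_ /(_ 1) [dc _]] := cutoff_Ck 1.
have cc : continuous (fun t => `|cutoff^`()%classic t|).
  move=> t; apply: cvg_norm.
  rewrite (_ : cutoff^`()%classic = 'D_1 cutoff); last by apply/funext=> s; rewrite derive1E.
  exact: differentiable_continuous (dc t).
have [c _ cmax] := @EVT_max R _ 0 1 ler01 (continuous_subspaceT cc).
exists (`|cutoff^`()%classic c| + 1); first by rewrite ltr_wpDl.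
move=> t t0; have [t1|t1] := leP t 1.
  by rewrite (le_trans (cmax t _)) ?lerDl// in_itv/= t0.
rewrite derive1E (@near_eq_derive _ _ _ _ (cst 0)).
  by rewrite derive_cst normr0 addr_ge0.
near=> s; rewrite cutoff0//; apply: ltW; apply: (@lt_trans _ _ 1); first lra.
by near: s; exact: lt_nbhsr.
Unshelve. all: by end_near. Qed.

End bump.

(** * Euclidean balls and orthogonal projections *)

Section euclidean_norm.
Context {R : realType} {n : nat}.
Implicit Types (u v w x y : 'rV[R]_n) (r : R).

Definition dotp u v : R := \sum_(i < n) u 0 i * v 0 i.

Lemma dotpE u v : (u *m v^T) 0 0 = dotp u v.
Proof. by rewrite mxE; apply: eq_bigr => i _; rewrite mxE. Qed.

Lemma dotpC u v : dotp u v = dotp v u.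
Proof. by apply: eq_bigr => i _; rewrite mulrC. Qed.

Lemma dotpDl u v w : dotp (u + v) w = dotp u w + dotp v w.
Proof. by rewrite -big_split; apply: eq_bigr => i _; rewrite mxE mulrDl. Qed.

Lemma dotpZl a u v : dotp (a *: u) v = a * dotp u v.
Proof. by rewrite mulr_sumr; apply: eq_bigr => i _; rewrite mxE mulrA. Qed.

Lemma dotp_ge0 u : 0 <= dotp u u.
Proof. by apply: sumr_ge0 => i _; rewrite -expr2 sqr_ge0. Qed.

Lemma dotp_eq0 u : (dotp u u == 0) = (u == 0).
Proof.
apply/idP/eqP => [|->]; last by rewrite /dotp big1// => i _; rewrite mxE mul0r.
rewrite psumr_eq0 => [/allP u0|i _]; last by rewrite -expr2 sqr_ge0.
apply/rowP => i; rewrite mxE; apply/eqP.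
by have := u0 i (mem_index_enum i); rewrite mulf_eq0 orbb.
Qed.

Lemma enorm_sqr u : enorm u ^+ 2 = dotp u u.
Proof.
rewrite /enorm; under eq_bigr do rewrite expr2.
by rewrite sqr_sqrtr ?dotp_ge0.
Qed.

Lemma enorm_ge0 u : 0 <= enorm u.
Proof. exact: sqrtr_ge0. Qed.

Lemma enorm_le u r : 0 <= r -> (enorm u <= r) = (dotp u u <= r ^+ 2).
Proof. by move=> r0; rewrite -enorm_sqr ler_sqr ?nnegrE ?enorm_ge0. Qed.

Lemma enorm_lt u r : 0 <= r -> (enorm u < r) = (dotp u u < r ^+ 2).
Proof. by move=> r0; rewrite -enorm_sqr ltr_sqr ?nnegrE ?enorm_ge0. Qed.

Lemma enorm0 : enorm (0 : 'rV[R]_n) = 0.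
Proof. by apply/eqP; rewrite -sqrf_eq0 enorm_sqr dotp_eq0. Qed.

Lemma enormN u : enorm (- u) = enorm u.
Proof. by rewrite /enorm; under eq_bigr do rewrite mxE sqrrN. Qed.

Lemma enormC x y : enorm (x - y) = enorm (y - x).
Proof. by rewrite -opprB enormN. Qed.

Lemma enormZ a u : enorm (a *: u) = `|a| * enorm u.
Proof.
apply/eqP; rewrite -(@eqrXn2 _ 2) ?mulr_ge0 ?enorm_ge0// exprMn !enorm_sqr.
by rewrite dotpZl dotpC dotpZl mulrA -expr2 real_normK ?num_real.
Qed.

(** Cauchy-Schwarz, by expanding the square of [enorm v *: u - enorm u *: v]. *)
Lemma dotp_le u v : dotp u v <= enorm u * enorm v.
Proof.
have [->|u0] := eqVneq u 0.
  by rewrite enorm0 mul0r /dotp big1// => i _; rewrite mxE mul0r.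
have [->|v0] := eqVneq v 0.
  by rewrite enorm0 mulr0 /dotp big1// => i _; rewrite mxE mulr0.
have gt0 w : w != 0 -> 0 < enorm w.
  by move=> w0; rewrite lt_def enorm_ge0 andbT -sqrf_eq0 enorm_sqr dotp_eq0.
have := dotp_ge0 (enorm v *: u + - enorm u *: v).
rewrite dotpDl 2!(dotpC _ (_ + _)) !dotpDl !dotpZl.
rewrite !(dotpC _ (_ *: _)) !dotpZl -!enorm_sqr (dotpC v u).
have := gt0 _ u0; have := gt0 _ v0.
move: (enorm u) (enorm v) (dotp u v) => a b d b0 a0 H.
have : 0 <= (a * b) * (a * b - d) by nra.
by rewrite pmulr_rge0 ?mulr_gt0// subr_ge0.
Qed.

Lemma enormD u v : enorm (u + v) <= enorm u + enorm v.
Proof.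
rewrite enorm_le ?addr_ge0 ?enorm_ge0// dotpDl !(dotpC _ (u + v)) !dotpDl.
rewrite -!enorm_sqr (dotpC v u).
by have := dotp_le u v; nra.
Qed.

Lemma enorm_dist x y z : enorm (x - z) <= enorm (x - y) + enorm (y - z).
Proof. by rewrite (le_trans _ (enormD _ _))// addrA subrK. Qed.

Lemma coord_le_enorm u i : `|u 0 i| <= enorm u.
Proof.
rewrite -ler_sqr ?nnegrE ?enorm_ge0// real_normK ?num_real// enorm_sqr /dotp.
rewrite (bigD1 i)//= -expr2 lerDl sumr_ge0// => j _.
by rewrite -expr2 sqr_ge0.
Qed.

Lemma norm_le_enorm u : `|u| <= enorm u.
Proof.
rewrite [leLHS]/Num.Def.normr/= mx_normrE.
apply: bigmax_le => [|[i j] _]; first exact: enorm_ge0.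
by rewrite ord1 coord_le_enorm.
Qed.

Lemma enorm_le_norm u : enorm u <= n%:R * `|u|.
Proof.
have cn i : `|u 0 i| <= `|u|.
  rewrite [leRHS]/Num.Def.normr/= mx_normrE.
  exact: (le_bigmax _ (fun ij : 'I_1 * 'I_n => `|u ij.1 ij.2|) (0, i)).
rewrite enorm_le ?mulr_ge0// /dotp.
have [n0|n0] := posnP n.
  by rewrite big1 ?sqr_ge0// => -[i ilt]; exfalso; rewrite n0 in ilt.
apply: (@le_trans _ _ (\sum_(i < n) `|u| ^+ 2)).
  apply: ler_sum => i _; rewrite -expr2 -(real_normK (num_real _)).
  by rewrite ler_sqr ?nnegrE.
rewrite sumr_const card_ord exprMn -[leLHS]mulr_natl ler_wpM2r ?sqr_ge0//.
by rewrite expr2 ler_peMr// ler1n.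
Qed.

Lemma enorm_continuous : continuous (@enorm R n).
Proof.
move=> u; apply/(@cvgrPdist_le _ _ _ (nbhs u)) => /= e e0; near=> v.
have dist x y : enorm x - enorm y <= enorm (x - y).
  by rewrite lerBlDr (le_trans _ (enormD _ _))// subrK.
have : `|enorm u - enorm v| <= enorm (u - v).
  by rewrite ler_norml dist andbT lerNl opprB enormC dist.
move/le_trans; apply; apply: (le_trans (enorm_le_norm _)).
have c : 0 < n%:R + 1 :> R by rewrite ltr_wpDl.
apply: (@le_trans _ _ ((n%:R + 1) * `|u - v|)).
  by rewrite ler_wpM2r// lerDl.
rewrite -ler_pdivlMl// mulrC; near: v.
apply/(@nbhs_ballP R); exists (e / (n%:R + 1)); first exact: divr_gt0.
by move=> w; rewrite mx_norm_ball /ball_ /= => /ltW.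
Unshelve. all: by end_near. Qed.

Definition eball x r : set 'rV[R]_n := [set y | enorm (y - x) < r].

Let shift_enorm_continuous x : continuous (fun y => enorm (y - x)).
Proof.
move=> y; apply: (@continuous_comp _ _ _ (fun y => y - x) enorm).
  by apply: (@continuousB _ _ _ id (cst x) y) => //; exact: cst_continuous.
exact: enorm_continuous.
Qed.

Lemma eball_open x r : open (eball x r).
Proof.
rewrite (_ : eball x r = (fun y => enorm (y - x)) @^-1` [set s | s < r])//.
by apply: open_comp => [y _|]; [exact: shift_enorm_continuous|exact: open_lt].
Qed.

Lemma ecball_closed x r : closed (ecball x r).
Proof.
rewrite (_ : ecball x r = (fun y => enorm (y - x)) @^-1` [set s | s <= r])//.
by apply: closed_comp => [y _|]; [exact: shift_enorm_continuous|exact: closed_le].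
Qed.

Lemma ecball_compact x r : compact (ecball x r).
Proof.
apply: bounded_closed_compact; last exact: ecball_closed.
exists (r + `|x|); split; first exact: num_real.
move=> M rM y xy; apply: (le_trans _ (ltW rM)).
rewrite -(subrK x y) (le_trans (ler_normD _ _))// lerD2r.
exact: le_trans (norm_le_enorm _) xy.
Qed.

Lemma nbhs_eball x A : nbhs x A <-> exists2 r, 0 < r & eball x r `<=` A.
Proof.
split.
  move=> /nbhs_ballP[r /= r0 rA]; exists r => // y xy; apply: rA.
  rewrite mx_norm_ball /ball_/= (le_lt_trans (norm_le_enorm _))//.
  by rewrite enormC.
move=> [r r0 rA]; apply: filterS rA _; apply: open_nbhs_nbhs.
by split; [exact: eball_open|rewrite /eball/= subrr enorm0].
Qed.

End euclidean_norm.

Section orthogonal_projections.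
Context {R : realType} {n : nat}.
Implicit Types (S : {vspace 'rV[R]_n}) (M : 'M[R]_n).

Definition vbasis_mx S : 'M[R]_(\dim S, n) := \matrix_(i < \dim S) (vbasis S)`_i.

Lemma vbasis_mx_mul S (w : 'rV_(\dim S)) :
  w *m vbasis_mx S = \sum_(i < \dim S) w 0 i *: (vbasis S)`_i.
Proof.
by rewrite mulmx_sum_row; apply: eq_bigr => i _; rewrite rowK.
Qed.

Lemma vbasis_mx_free S : row_free (vbasis_mx S).
Proof.
apply: inj_row_free => w; rewrite vbasis_mx_mul => w0.
have /freeP fr := basis_free (vbasisP S).
by apply/rowP => i; rewrite mxE; apply: fr.
Qed.

Lemma mem_vbasis_mx S (u : 'rV_n) : (u \in S) = (u <= vbasis_mx S)%MS.
Proof.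
apply/idP/submxP => [uS|[w ->]].
  exists (\row_i coord (vbasis S) i u); rewrite vbasis_mx_mul.
  rewrite {1}(coord_vbasis uS); apply: eq_bigr => i _; by rewrite mxE.
rewrite vbasis_mx_mul; apply: rpred_sum => i _; apply: rpredZ.
by apply: vbasis_mem; rewrite mem_nth// size_tuple.
Qed.

Lemma gram_eq0 p (w : 'rV[R]_p) (B : 'M[R]_(p, n)) : w *m B *m B^T = 0 -> w *m B = 0.
Proof.
move=> wBB; apply/eqP; rewrite -dotp_eq0 -dotpE trmx_mul mulmxA wBB.
by rewrite mul0mx mxE.
Qed.

Section projection_onto.
Variable S : {vspace 'rV[R]_n}.
Let B := vbasis_mx S.

Lemma orth_projE : orth_proj S = proj_mx <<B>>%MS (kermx B^T).
Proof. by []. Qed.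

Let dx : (<<B>> :&: kermx B^T = 0)%MS.
Proof.
apply/eqP; rewrite -submx0; apply/rV_subP => u.
rewrite sub_capmx genmxE submx0 => /andP[/submxP[w ->] /sub_kermxP wBB].
exact/eqP/gram_eq0.
Qed.

Let full : (1%:M <= <<B>> + kermx B^T)%MS.
Proof.
rewrite sub1mx /row_full (mxdirectP _); last exact/mxdirect_addsP.
by rewrite /= genmxE mxrank_ker mxrank_tr subnKC// rank_leq_col.
Qed.

Lemma orth_proj_sub : (orth_proj S <= B)%MS.
Proof. by rewrite -[orth_proj S]mul1mx orth_projE (submx_trans (proj_mx_sub _ _ _))// genmxE. Qed.

Lemma orth_proj_idem : orth_proj S *m orth_proj S = orth_proj S.
Proof. exact: proj_mx_proj. Qed.

Lemma mul_orth_proj p (W : 'M[R]_(p, n)) : (W <= B)%MS -> W *m orth_proj S = W.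
Proof. by move=> WB; rewrite orth_projE proj_mx_id// genmxE. Qed.

(** With [P] the projection, the rows of [1 - P] are orthogonal to those of [B], and the rows of [P]
    are combinations of rows of [B]. Hence [P^T = P *m P^T], whose right side is symmetric. *)
Lemma orth_proj_sym : (orth_proj S)^T = orth_proj S.
Proof.
have /submxP[D PD] := orth_proj_sub.
have : (1%:M - orth_proj S) *m (orth_proj S)^T = 0.
  rewrite PD trmx_mul mulmxA -PD (_ : _ *m B^T = 0) ?mul0mx//.
  apply/sub_kermxP; rewrite -[orth_proj S]mul1mx.
  exact: proj_mx_compl_sub.
rewrite mulmxBl mul1mx => /eqP; rewrite subr_eq0 => /eqP e.
by have := congr1 trmx e; rewrite trmxK trmx_mul trmxK -e => /esym.
Qed.

Lemma orth_proj_rank : \rank (orth_proj S) = \dim S.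
Proof.
have <- : \rank B = \dim S by apply/eqP; exact: vbasis_mx_free.
apply/eqP; rewrite eqn_leq mxrankS ?orth_proj_sub//=.
by rewrite -{1}(mul_orth_proj (submx_refl B)) mxrankM_maxr.
Qed.

End projection_onto.

(** In a full-rank factorization [M = C *m D] idempotence forces [D *m C = 1], and the trace is
    cyclic. *)
Lemma trace_idempotent M : M *m M = M -> \tr M = (\rank M)%:R.
Proof.
move=> idM; have := idM; rewrite -{1 2 3}(mulmx_base M) => e.
have {e} : row_base M *m col_base M = (1%:M)%R.
  have /row_fullP[L LC] := col_base_full M.
  have /row_freeP[Q RQ] := row_base_free M.
  move: (col_base M) (row_base M) e LC RQ => C D e LC DQ.
  have := congr1 (fun X => L *m X *m Q) e.
  by rewrite /= !mulmxA LC mul1mx -!mulmxA DQ mulmx1.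
move=> e; rewrite -{1}(mulmx_base M) mxtrace_mulC e.
by rewrite mxtrace1.
Qed.

Lemma orth_proj_trace S : \tr (orth_proj S) = (\dim S)%:R.
Proof. by rewrite trace_idempotent ?orth_proj_rank// orth_proj_idem. Qed.

Lemma orth_proj_dotp S (u : 'rV_n) :
  (u *m orth_proj S *m u^T) 0 0 = dotp (u *m orth_proj S) (u *m orth_proj S).
Proof.
have := orth_proj_sym S; have := orth_proj_idem S.
move: (orth_proj S) => M idM symM.
by rewrite -dotpE trmx_mul symM mulmxA -(mulmxA u M M) idM.
Qed.

Lemma orth_proj_dotp_ge0 S (u : 'rV_n) : 0 <= (u *m orth_proj S *m u^T) 0 0.
Proof. by rewrite orth_proj_dotp dotp_ge0. Qed.

Lemma orth_proj_dotp_le S (u : 'rV_n) :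
  (u *m orth_proj S *m u^T) 0 0 <= dotp u u.
Proof.
rewrite orth_proj_dotp; set p := u *m _.
have up : dotp u p = dotp p p by rewrite -orth_proj_dotp dotpC -dotpE.
have := dotp_ge0 (u - p); rewrite -scaleN1r dotpDl !(dotpC _ (u + _)) !dotpDl.
by rewrite !dotpZl !(dotpC _ (_ *: _)) !dotpZl (dotpC p u) up; lra.
Qed.

Lemma orth_proj_entry S i j : `|orth_proj S i j| <= 1.
Proof.
pose u : 'rV[R]_n := delta_mx 0 i.
have uP : u *m orth_proj S = row i (orth_proj S) by rewrite -rowE.
have := orth_proj_dotp_le S u; rewrite orth_proj_dotp uP.
have -> : dotp u u = 1.
  rewrite /dotp (bigD1 i)//= big1 => [|k ki]; rewrite !mxE ?eqxx//= ?mulr1 ?addr0//.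
  by rewrite (negbTE ki) mul0r.
move=> le1; apply: (@le_trans _ _ (enorm (row i (orth_proj S)))); last first.
  by rewrite enorm_le// expr1n.
by have := coord_le_enorm (row i (orth_proj S)) j; rewrite mxE.
Qed.

(** Let [S] be the row space of [M] and [P] its projection. Then [P *m M = P] and [M *m P = M];
    transposing the first identity gives [P = M *m P = M]. *)
Lemma orth_proj_surj M : M^T = M -> M *m M = M -> exists S, orth_proj S = M.
Proof.
move=> symM idM; pose S := <<[seq row i M | i <- enum 'I_n]>>%VS.
exists S; set P := orth_proj S.
have rowS i : row i M \in S by apply: memv_span; apply: map_f; rewrite mem_enum.
have MB : (M <= vbasis_mx S)%MS.
  by apply/row_subP => i; rewrite -mem_vbasis_mx.
have BM : (vbasis_mx S <= M)%MS.
  apply/row_subP => i; rewrite rowK.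
  have : (vbasis S)`_i \in S by apply: vbasis_mem; rewrite mem_nth// size_tuple.
  move=> /coord_span ->; apply: summx_sub => k _; apply: scalemx_sub.
  suff : ([seq row j M | j <- enum 'I_n]`_k <= M)%MS by [].
  have /mapP[j _ ->] : [seq row j M | j <- enum 'I_n]`_k \in [seq row j M | j <- enum 'I_n].
    rewrite mem_nth// size_map size_enum_ord.
    by rewrite (leq_trans (ltn_ord k))// ?size_map ?size_enum_ord ?card_ord.
  exact: row_sub.
have PM : P *m M = P.
  have /submxP[D PD] := submx_trans (orth_proj_sub S) BM.
  by rewrite /P PD -mulmxA idM.
have MP : M *m P = M by exact: mul_orth_proj.
by rewrite -PM -[LHS]trmxK trmx_mul symM orth_proj_sym MP symM.
Qed.

End orthogonal_projections.

(** * Compactness of the Grassmannian *)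

Section subspaces_topology.
Context {R : realType} {n : nat}.
Local Notation bundle := ('rV[R]_n * subspaces R n)%type.

Lemma orth_proj_continuous : continuous (orth_proj : subspaces R n -> 'M[R]_n).
Proof. exact: initial_continuous. Qed.

Lemma mx_entry_continuous p q (i : 'I_p) (j : 'I_q) :
  continuous (fun M : 'M[R]_(p, q) => M i j).
Proof. exact: coord_continuous. Qed.

Lemma sum_continuous (T : topologicalType) (I : Type) (r : seq I) (F : I -> T -> R) :
  (forall i, continuous (F i)) -> continuous (fun x => \sum_(i <- r) F i x).
Proof.
move=> cF; elim: r => [|i r IH].
  by under eq_fun do rewrite big_nil; exact: cst_continuous.
under eq_fun do rewrite big_cons.
by move=> x; apply: cvgD; [exact: cF|exact: IH].
Qed.

Lemma mx_trace_continuous p : continuous (fun M : 'M[R]_p => \tr M).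
Proof. by apply: sum_continuous => i; exact: mx_entry_continuous. Qed.

Lemma mx_mul_continuous p i j : continuous (fun M : 'M[R]_p => (M *m M) i j).
Proof.
under eq_fun do rewrite mxE.
apply: sum_continuous => k M.
by apply: (@continuousM _ _ (fun M : 'M[R]_p => M i k) (fun M : 'M[R]_p => M k j));
  exact: mx_entry_continuous.
Qed.

Lemma unit_mx_ball_compact :
  compact [set M : 'M[R]_n | forall i j, `|M i j| <= 1].
Proof.
have vc : continuous (fun v : 'rV[R]_(n * n) => vec_mx v : 'M[R]_n).
  move=> v; apply/(@cvgrPdist_le _ _ _ (nbhs v)) => e e0; near=> w.
  apply: (@le_trans _ _ `|v - w|).
    rewrite -linearB/= [leLHS]/Num.Def.normr/= mx_normrE.
    apply: bigmax_le => [//|[i j] _] /=; rewrite mxE.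
    rewrite [leRHS]/Num.Def.normr/= mx_normrE.
    exact: (le_bigmax _ (fun k : 'I_1 * 'I_(n * n) => `|(v - w) k.1 k.2|) (0, mxvec_index i j)).
  near: w; apply/(@nbhs_ballP R); exists e; first exact: e0.
  by move=> w; rewrite mx_norm_ball /ball_ /= => /ltW.
pose box : set 'rV[R]_(n * n) := [set v | forall i, `|v 0 i| <= 1].
have cb : compact box.
  have /= := @rV_compact R (n * n) (fun=> [set x : R | -1 <= x <= 1]).
  rewrite (_ : [set v | _] = box); last first.
    by apply/seteqP; split => v vb i; [rewrite ler_norml|rewrite -ler_norml]; exact: vb.
  apply => _; rewrite (_ : [set x : R | _] = `[-1, 1]%classic); first exact: segment_compact.
  by apply/seteqP; split => x /=; rewrite in_itv.
rewrite (_ : [set M | _] = (fun v => vec_mx v : 'M[R]_n) @` box).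
  by apply: continuous_compact => //; exact: continuous_subspaceT.
apply/seteqP; split => [M M1|_ [v vb <-] i j]; last by rewrite mxE; exact: vb.
exists (mxvec M); last by rewrite mxvecK.
by move=> k; case/mxvec_indexP: k => i j; rewrite mxvecE; exact: M1.
Unshelve. all: by end_near. Qed.

(** The image is described by polynomial equations, hence closed; entries of projections being
    bounded by 1, it is compact. *)
Lemma orth_proj_image : range (orth_proj : subspaces R n -> 'M[R]_n) =
  [set M : 'M[R]_n | M^T = M /\ M *m M = M].
Proof.
apply/seteqP; split => [_ [S _ <-]|M [symM idM]].
  by split; [exact: orth_proj_sym|exact: orth_proj_idem].
by have [S SM] := orth_proj_surj symM idM; exists S.
Qed.

Lemma orth_proj_range_compact : compact (range (orth_proj : subspaces R n -> 'M[R]_n)).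
Proof.
apply: (subclosed_compact _ unit_mx_ball_compact); last first.
  by move=> _ [S _ <-] i j; exact: orth_proj_entry.
rewrite orth_proj_image.
have ceq (f g : 'M[R]_n -> R) : continuous f -> continuous g -> closed [set M | f M = g M].
  move=> cf cg; rewrite (_ : [set M | _] = (fun M => f M - g M) @^-1` [set 0]).
    apply: closed_comp => [M _|]; last exact: closed_eq.
    by apply: (@continuousB _ _ _ f g M); [exact: cf|exact: cg].
  by apply/seteqP; split => M /= /eqP; [rewrite -subr_eq0 => /eqP|rewrite subr_eq0 => /eqP].
rewrite (_ : [set M | _] = \bigcap_(ij in [set: 'I_n * 'I_n])
    ([set M : 'M[R]_n | M ij.2 ij.1 = M ij.1 ij.2] `&` [set M : 'M[R]_n | (M *m M) ij.1 ij.2 = M ij.1 ij.2])).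
  apply: closed_bigI => -[i j] _; apply: closedI; apply: ceq;
    solve [exact: mx_entry_continuous|exact: mx_mul_continuous].
apply/seteqP; split => [M [symM idM] [i j] _ /=|M H].
  by split; [rewrite -{1}symM mxE|rewrite idM].
split; apply/matrixP => i j; have [/= h1 h2] := H (i, j) Logic.I.
  by rewrite mxE.
exact: h2.
Qed.

(** The topology is induced by [orth_proj], so a cluster point in the compact image can be pulled
    back. *)
Lemma subspaces_compact : compact [set: subspaces R n].
Proof.
move=> F FF _.
have [|M [[S _ SM] clM]] := orth_proj_range_compact (F := orth_proj @ F) _.
  change (F (orth_proj @^-1` range orth_proj)).
  by apply: filterS (@filterT _ F _) => S _; exists S.
exists S; split => // A B FA [_ [[C oC <-] CS] CB].
have FA' : (orth_proj @ F) (orth_proj @` A).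
  change (F (orth_proj @^-1` (orth_proj @` A))).
  by apply: filterS FA => z Az; exists z.
have nC : nbhs M C by apply: open_nbhs_nbhs; split => //; rewrite -SM.
have [_ [[z Az <-] Cz]] := clM _ _ FA' nC.
by exists z; split => //; exact: CB.
Qed.

(** The dimension is the trace of the projection, a continuous function with integer values. This is
    why G(n,m) is both closed and open; [grassmann_gap] is the quantitative form. *)
Lemma grassmannE m : grassmann m =
  (fun S : subspaces R n => \tr (orth_proj S)) @^-1` [set m%:R].
Proof.
apply/seteqP; split => S /=; first by move=> <-; rewrite orth_proj_trace.
by rewrite orth_proj_trace => /eqP; rewrite eqr_nat => /eqP.
Qed.

Lemma orth_proj_trace_continuous :
  continuous (fun S : subspaces R n => \tr (orth_proj S)).
Proof.
move=> S; apply: (@continuous_comp _ _ _ (orth_proj : subspaces R n -> 'M[R]_n) mxtrace).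
  exact: orth_proj_continuous.
exact: mx_trace_continuous.
Qed.

Lemma grassmann_gap m (S : subspaces R n) : ~ grassmann m S ->
  1 <= `|\tr (orth_proj S) - m%:R|.
Proof.
rewrite /grassmann/= orth_proj_trace => nS.
rewrite leNgt; apply/negP; rewrite ltr_norml => /andP[h1 h2]; apply: nS.
apply/eqP; rewrite eqn_leq; apply/andP; split; rewrite leqNgt; apply/negP => lt.
  have : (m.+1)%:R <= (\dim (S : {vspace 'rV[R]_n}))%:R :> R by rewrite ler_nat.
  by rewrite -natr1; lra.
have : (\dim (S : {vspace 'rV[R]_n})).+1%:R <= m%:R :> R by rewrite ler_nat.
by rewrite -natr1; lra.
Qed.

Lemma grassmann_closed m : closed (@grassmann R n m).
Proof.
rewrite grassmannE; apply: closed_comp => [S _|]; last exact: closed_eq.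
exact: orth_proj_trace_continuous.
Qed.

Lemma setX_grassmann_compact m (K : set 'rV[R]_n) : compact K ->
  compact (K `*` @grassmann R n m).
Proof.
move=> cK; apply: compact_setX => //; apply: (@subclosed_compact _ _ setT) => //.
  exact: grassmann_closed.
exact: subspaces_compact.
Qed.

Lemma grassmann_open m : open (@grassmann R n m).
Proof.
rewrite (_ : grassmann m = (fun S : subspaces R n => \tr (orth_proj S)) @^-1`
    [set x | `|x - m%:R| < 1]).
  apply: open_comp => [S _|]; first exact: orth_proj_trace_continuous.
  rewrite (_ : [set x | _] = ball (m%:R : R) 1); first exact: ball_open.
  by apply/seteqP; split => x /=; rewrite /ball/= distrC.
apply/seteqP; split => S /=; first by move=> <-; rewrite orth_proj_trace subrr normr0.
by move=> lt1; apply: contrapT => /grassmann_gap; rewrite leNgt lt1.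
Qed.

Lemma bundle_hausdorff : hausdorff_space bundle.
Proof.
have inj (S S' : subspaces R n) : orth_proj S = orth_proj S' -> S = S'.
  move=> e; apply/vspaceP => u.
  have char (W : {vspace 'rV[R]_n}) : (u \in W) = (u *m orth_proj W == u).
    rewrite mem_vbasis_mx; apply/idP/eqP => [/mul_orth_proj//|<-].
    exact: (submx_trans (submxMl _ _) (orth_proj_sub W)).
  by rewrite !char e.
move=> [x S] [y S'] cl.
have ex : x = y.
  apply: (@norm_hausdorff _ 'rV[R]_n) => A B xA yB.
  have [||[z T] [Az Bz]] := cl (A `*` setT) (B `*` setT).
  - by exists (A, setT) => //=; split => //; exact: filterT.
  - by exists (B, setT) => //=; split => //; exact: filterT.
  - by exists z; split; [exact: (Az).1|exact: (Bz).1].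
rewrite ex; congr pair; apply: inj.
apply: (@norm_hausdorff _ 'M[R]_n) => A B xA yB.
have oc := @orth_proj_continuous.
have [||[z T] [Az Bz]] := cl (setT `*` (orth_proj @^-1` A)) (setT `*` (orth_proj @^-1` B)).
- by exists (setT, orth_proj @^-1` A) => //=; split => //=; [exact: filterT|exact: oc].
- by exists (setT, orth_proj @^-1` B) => //=; split => //=; [exact: filterT|exact: oc].
- by exists (orth_proj T); split; [exact: (Az).2|exact: (Bz).2].
Qed.

(** Continuous in [w], with small sublevel sets around [z] ([nbhs_bundle_dist]): a gauge from which
    bump functions on the bundle are made. *)
Definition bundle_dist (z w : bundle) : R :=
  `|w.1 - z.1| + `|orth_proj w.2 - orth_proj z.2|.

Lemma bundle_distxx z : bundle_dist z z = 0.
Proof. by rewrite /bundle_dist !subrr !normr0 addr0. Qed.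

Lemma bundle_dist_continuous z : continuous (bundle_dist z).
Proof.
move=> w; apply: (@continuousD _ _ _ (fun w : bundle => `|w.1 - z.1|)
  (fun w : bundle => `|orth_proj w.2 - orth_proj z.2|) w); apply: cvg_norm.
  by apply: (@continuousB _ _ _ fst (cst z.1) w); [exact: cvg_fst|exact: cvg_cst].
apply: (@continuousB _ _ _ (fun w : bundle => orth_proj w.2) (cst (orth_proj z.2)) w);
  last exact: cvg_cst.
apply: (@continuous_comp _ _ _ snd (orth_proj : subspaces R n -> 'M[R]_n) w).
  exact: cvg_snd.
exact: orth_proj_continuous.
Qed.

Lemma nbhs_bundle_dist z (A : set bundle) : nbhs z A ->
  exists2 r, 0 < r & forall w, bundle_dist z w < r -> A w.
Proof.
move=> [[B C] /= [/nbhs_ballP[r1 /= r10 r1B] [_ [[D oD <-] DS] DC]] BCA].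
have /nbhs_ballP[r2 /= r20 r2D] : nbhs (orth_proj z.2) D by exact: open_nbhs_nbhs.
exists (Num.min r1 r2); first by rewrite lt_min r10.
move=> w; rewrite lt_min => /andP[w1 w2]; apply: BCA; split => /=.
  apply: r1B; rewrite mx_norm_ball /ball_/= distrC; apply: le_lt_trans w1.
  by rewrite /bundle_dist lerDl.
apply: DC; apply: r2D; rewrite mx_norm_ball /ball_/= distrC; apply: le_lt_trans w2.
by rewrite /bundle_dist lerDr.
Qed.

End subspaces_topology.

(** * Radon measures and compactly supported functions *)

Section ereal_approximation.
Context {R : realType}.
Implicit Types x y z : \bar R.
Local Open Scope ereal_scope.

(** Used to approximate two suprema at the same time, infinite values included; [lee_addr_approx]
    does the same for infima. *)
Lemma lee_addl_approx x y z : 0 <= x -> 0 <= y ->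
  (forall a b : R, a%:E < x -> b%:E < y -> (a + b)%:E <= z) -> x + y <= z.
Proof.
have infty w : (forall a : R, a%:E <= z) -> w <= z.
  move=> az; suff -> : z = +oo by rewrite leey.
  by apply/eqyP => a _; exact: az.
move: x y => [x| |] [y| |] // x0 y0 H.
- apply/lee_addgt0Pr => e e0; rewrite -leeBlDr//.
  have -> : x%:E + y%:E - e%:E = ((x - e / 2) + (y - e / 2))%:E.
    by apply: (congr1 EFin); field.
  by apply: H; rewrite lte_fin ltrBlDr ltrDl divr_gt0.
- apply: infty => a; rewrite -(subrK (x - 1)%R a) addrC.
  by apply: H; rewrite ?ltry// lte_fin ltrBlDr ltrDl.
- apply: infty => a; rewrite -(subrK (y - 1)%R a).
  by apply: H; rewrite ?ltry// lte_fin ltrBlDr ltrDl.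
- by apply: infty => a; rewrite -(subrK 0%R a); apply: H; rewrite ltry.
Qed.

Lemma lee_addr_approx x y z : 0 <= x -> 0 <= y ->
  (forall a b : R, x < a%:E -> y < b%:E -> z <= (a + b)%:E) -> z <= x + y.
Proof.
move: x y => [x| |] [y| |] // x0 y0 H; rewrite ?addye ?addey ?leey//.
apply/lee_addgt0Pr => e e0;
have -> : x%:E + y%:E + e%:E = ((x + e / 2) + (y + e / 2))%:E.
  by apply: (congr1 EFin); field.
by apply: H; rewrite lte_fin ltrDl divr_gt0.
Qed.

End ereal_approximation.

Lemma spt_out (T : ptopologicalType) (V : zmodType) (f : T -> V) x :
  ~ spt f x -> f x = 0.
Proof. by move=> nx; apply/eqP; apply: contra_notT nx => fx; exact: subset_closure. Qed.

Section compactly_supported_functions.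
Context {R : realType} {T : ptopologicalType}.
Variable O : set T.
Hypotheses (hT : hausdorff_space T) (oO : open O).
Implicit Types (mu : {measure set (borel T) -> \bar R}) (f g : T -> R).

Lemma measurable_open (G : set T) : open G -> measurable (G : set (borel T)).
Proof. exact: sub_sigma_algebra. Qed.

Lemma measurable_closed (C : set T) : closed C -> measurable (C : set (borel T)).
Proof.
move=> cC; have /measurableC := measurable_open (closed_openC cC).
by rewrite setCK.
Qed.

Lemma measurable_compact (K : set T) : compact K -> measurable (K : set (borel T)).
Proof. move=> cK; apply: measurable_closed; exact: (compact_closed hT cK). Qed.

Lemma measurable_continuous f : continuous f ->
  measurable_fun (setT : set (borel T)) (f : borel T -> R).
Proof.
move=> cf; apply: (measurability _ (RGenOInfty.measurableE R)) => _ [_ [x ->] <-].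
rewrite setTI; apply: measurable_open; apply: open_comp => //.
Qed.

Lemma Kspace_of f (K : set T) : continuous f -> compact K -> K `<=` O ->
  (forall x, ~ K x -> f x = 0) -> Kspace O f.
Proof.
move=> cf cK KO f0; have sK : spt f `<=` K.
  rewrite /spt (closure_id K).1; last exact: (compact_closed hT cK).
  by apply: closure_subset => x /=; apply: contra_neqP => /f0.
split => //; last exact: subset_trans sK KO.
by apply: (subclosed_compact _ cK) => //; exact: closed_closure.
Qed.

Lemma KspaceD f g : Kspace O f -> Kspace O g -> Kspace O (fun x => f x + g x).
Proof.
move=> [cf kf fO] [cg kg gO]; apply: (@Kspace_of _ (spt f `|` spt g)).
- by move=> x; apply: (@continuousD _ _ _ f g x); [exact: cf|exact: cg].
- exact: compactU.
- by move=> x [/fO|/gO].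
- by move=> x /not_orP[nf ng]; rewrite (spt_out nf) (spt_out ng) addr0.
Qed.

Lemma KspaceM f g : continuous g -> Kspace O f -> Kspace O (fun x => g x * f x).
Proof.
move=> cg [cf kf fO]; apply: (@Kspace_of _ (spt f)) => //.
- by move=> x; apply: (@continuousM _ _ g f x); [exact: cg|exact: cf].
- by move=> x nf; rewrite (spt_out nf) mulr0.
Qed.

Lemma KspaceZ a f : Kspace O f -> Kspace O (fun x => a * f x).
Proof. by apply: KspaceM; exact: cst_continuous. Qed.

Lemma KspaceB f g : Kspace O f -> Kspace O g -> Kspace O (fun x => f x - g x).
Proof.
move=> Kf Kg; have := KspaceD Kf (KspaceZ (-1) Kg).
by under [in X in X -> _]eq_fun do rewrite mulN1r.
Qed.

Lemma Kspace_norm f : Kspace O f -> Kspace O (fun x => `|f x|).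
Proof.
move=> [cf kf fO]; apply: (@Kspace_of _ (spt f)) => //.
- by move=> x; apply: cvg_norm; exact: cf.
- by move=> x nf; rewrite (spt_out nf) normr0.
Qed.

Lemma Kspace_bounded f : Kspace O f -> exists2 M, 0 < M & forall x, `|f x| <= M.
Proof.
move=> [cf kf _]; have : compact (f @` spt f).
  by apply: continuous_compact => //; exact: continuous_subspaceT.
move=> /compact_bounded[M [_ Mf]]; exists (`|M| + 1); first by rewrite ltr_wpDl.
move=> x; have [sx|sx] := pselect (spt f x); last by rewrite (spt_out sx) normr0 addr_ge0.
by apply: (Mf _ _ (f x)); [rewrite ltr_pwDr// ler_norm|exists x].
Qed.

Definition finite_on_compacts mu :=
  forall K, compact K -> K `<=` O -> (mu K < +oo)%E.

Section integral_of_Kspace.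
Variable mu : {measure set (borel T) -> \bar R}.
Hypothesis fmu : finite_on_compacts mu.

Let mO : measurable (O : set (borel T)) := measurable_open oO.

Lemma Kspace_integrable f : Kspace O f ->
  mu.-integrable (O : set (borel T)) (EFin \o f : borel T -> \bar R).
Proof.
move=> Kf; have [cf kf fO] := Kf; have [M M0 Mf] := Kspace_bounded Kf.
have ms : measurable (spt f : set (borel T)) := measurable_compact kf.
have mf : measurable_fun (setT : set (borel T)) f := measurable_continuous cf.
have -> : EFin \o f = (EFin \o f) \_ (spt f).
  apply/funext => x /=; rewrite patchE; case: ifPn => //.
  by rewrite notin_setE => /spt_out/= ->.
apply: (@integrableS _ _ _ mu setT) => //.
apply/(integrable_mkcond _ ms); apply: measurable_bounded_integrable => //.
- exact: fmu.
- exact: measurable_funS mf.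
- exists M; split; first exact: num_real.
  by move=> N MN x _ /=; rewrite (le_trans (Mf x))// ltW.
Qed.

Lemma Rintegral_EFin f : Kspace O f ->
  (Rintegral mu O f)%:E = (\int[mu]_(x in (O : set (borel T))) (f x)%:E)%E.
Proof. by move=> Kf; rewrite fineK// integrable_fin_num// Kspace_integrable. Qed.

Lemma KintegralD f g : Kspace O f -> Kspace O g ->
  Rintegral mu O (fun x => f x + g x) = Rintegral mu O f + Rintegral mu O g.
Proof. by move=> Kf Kg; rewrite RintegralD//; exact: Kspace_integrable. Qed.

Lemma KintegralB f g : Kspace O f -> Kspace O g ->
  Rintegral mu O (fun x => f x - g x) = Rintegral mu O f - Rintegral mu O g.
Proof. by move=> Kf Kg; rewrite RintegralB//; exact: Kspace_integrable. Qed.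

Lemma KintegralZ a f : Kspace O f ->
  Rintegral mu O (fun x => a * f x) = a * Rintegral mu O f.
Proof. by move=> Kf; rewrite RintegralZl//; exact: Kspace_integrable. Qed.

Lemma Kintegral_ge0 f : (forall x, 0 <= f x) -> 0 <= Rintegral mu O f.
Proof. by move=> f0; apply: Rintegral_ge0. Qed.

Lemma Kintegral_norm f : Kspace O f ->
  `|Rintegral mu O f| <= Rintegral mu O (fun x => `|f x|).
Proof. by move=> Kf; apply: le_normr_Rintegral => //; exact: Kspace_integrable. Qed.

Lemma Kintegral_le_measure f (A : set T) M : Kspace O f -> 0 <= M ->
  measurable (A : set (borel T)) -> (forall x, `|f x| <= M) ->
  (forall x, O x -> ~ A x -> f x = 0) ->
  (`|Rintegral mu O f|%:E <= M%:E * mu A)%E.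
Proof.
move=> Kf M0 mA fM fA.
apply: (@le_trans _ _ (Rintegral mu O (fun x => `|f x|))%:E).
  by rewrite lee_fin Kintegral_norm.
rewrite Rintegral_EFin; last exact: Kspace_norm.
have mf : measurable_fun (O : set (borel T)) (fun x => (`|f x|)%:E).
  apply/measurable_EFinP; apply: (@measurable_funS _ _ _ _ setT) => //.
  by apply: measurable_continuous; have [] := Kspace_norm Kf.
apply: (@le_trans _ _ (\int[mu]_(x in (O : set (borel T))) (M * \1_A x)%:E)%E).
  apply: ge0_le_integral => //.
  - apply/measurable_EFinP; apply: measurable_funM; first exact: measurable_cst.
    exact: (@measurable_funTS _ _ _ _ _ _ (measurable_indic mA)).
  - move=> x Ox; rewrite lee_fin indicE; case: (boolP (x \in A)) => xA.
      by rewrite mulr1.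
    by rewrite mulr0 fA ?normr0//; move: xA; rewrite notin_setE.
under eq_integral do rewrite EFinM.
rewrite ge0_integralZl//; last first.
  by apply/measurable_EFinP; apply: measurable_funTS; exact: measurable_indic.
rewrite integral_indic// lee_wpmul2l ?lee_fin//.
by apply: le_measure; rewrite ?inE//; exact: measurableI.
Qed.

Lemma measure_le_Kintegral f (A : set T) : Kspace O f ->
  measurable (A : set (borel T)) -> A `<=` O -> (forall x, 0 <= f x) ->
  (forall x, A x -> 1 <= f x) -> (mu A <= (Rintegral mu O f)%:E)%E.
Proof.
move=> Kf mA AO f0 fA; rewrite Rintegral_EFin// -[A]setIid.
rewrite -(@integral_indic _ _ _ mu A mA A mA).
apply: (@le_trans _ _ (\int[mu]_(x in (A : set (borel T))) (f x)%:E)%E).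
  have m2 : measurable_fun (A : set (borel T)) (fun x => (f x)%:E).
    apply/measurable_EFinP; apply: measurable_funTS.
    by apply: measurable_continuous; have [] := Kf.
  apply: ge0_le_integral => //.
  - by apply/measurable_EFinP; exact: measurable_indic.
  - by move=> x Ax; rewrite lee_fin indicE mem_set// fA.
apply: ge0_subset_integral => //; last by move=> x _; rewrite lee_fin.
apply/measurable_EFinP; apply: measurable_funTS.
by apply: measurable_continuous; have [] := Kf.
Qed.

End integral_of_Kspace.

Section radon_measures.
Implicit Types (A B : set T).

Lemma radon_finite mu : radon O mu -> finite_on_compacts mu.
Proof. by case. Qed.

(** Outer regularity is imposed on arbitrary sets, so the comparison holds for them too, and only
    the part inside [O] counts. *)
Lemma radon_le mu A B : radon O mu -> A `&` O `<=` B -> (mu A <= mu B)%E.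
Proof.
move=> [_ _ out] AB; rewrite (out A) (out B).
apply: ereal_inf_le_tmp => _ [G [oG BG] <-]; exists G => //; split => //.
by move=> x [Ax Ox]; apply: BG; split => //; exact: AB.
Qed.

Lemma radon_ge0 mu A : radon O mu -> (0 <= mu A)%E.
Proof.
by move=> [_ _ out]; rewrite (out A); apply: le_ereal_inf_tmp => _ [G _ <-].
Qed.

(** Nearly optimal sets for the two measures are merged: compact sets by union for inner regularity,
    open sets by intersection for outer regularity. *)
Lemma radon_add mu nu : radon O mu -> radon O nu -> radon O (measure_add mu nu).
Proof.
move=> rmu rnu; have [f1 i1 o1] := rmu; have [f2 i2 o2] := rnu.
pose S : {measure set (borel T) -> \bar R} := measure_add mu nu.
have addE A : S A = (mu A + nu A)%E by exact: measure_addE.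
change (radon O S).
have ab A : (0 <= mu A /\ 0 <= nu A)%E by rewrite !radon_ge0.
split => [K cK KO|G oG GO|A].
- by rewrite addE lte_add_pinfty// ?f1 ?f2.
- apply/eqP; rewrite eq_le; apply/andP; split; last first.
    apply: ge_ereal_sup => _ [K [cK KG] <-].
    apply: le_measure; rewrite ?inE//; last exact: measurable_open.
    exact: measurable_compact.
  rewrite addE; apply: lee_addl_approx; rewrite ?radon_ge0// => a b.
  rewrite (i1 _ oG GO) (i2 _ oG GO).
  move=> /ereal_sup_gt[_ [K [cK KG] <-] aK] /ereal_sup_gt[_ [L [cL LG] <-] bL].
  apply: le_ereal_sup_tmp; exists (S (K `|` L)); last first.
    rewrite addE EFinD; apply: leeD; apply: ltW.
      by apply: (lt_le_trans aK); apply: radon_le => // x [? _]; left.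
    by apply: (lt_le_trans bL); apply: radon_le => // x [? _]; right.
  exists (K `|` L) => //.
  by split; [exact: compactU|move=> x []; [exact: KG|exact: LG]].
- apply/eqP; rewrite eq_le; apply/andP; split.
    apply: le_ereal_inf_tmp => _ [G [oG AG] <-].
    by rewrite !addE leeD// radon_le.
  rewrite addE; apply: lee_addr_approx; rewrite ?radon_ge0// => a b.
  rewrite (o1 A) (o2 A).
  move=> /ereal_inf_lt[_ [G [oG AG] <-] Ga] /ereal_inf_lt[_ [H [oH AH] <-] Hb].
  apply: (@le_trans _ _ (S (G `&` H))).
    apply: ereal_inf_lbound; exists (G `&` H) => //.
    by split; [exact: openI|move=> x Ax; split; [exact: AG|exact: AH]].
  rewrite addE EFinD; apply: leeD; apply: ltW.
    by apply: (le_lt_trans _ Ga); apply: radon_le => // x [[]].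
  by apply: (le_lt_trans _ Hb); apply: radon_le => // x [[]].
Qed.

End radon_measures.

End compactly_supported_functions.

Lemma compact_finite_cover (T : ptopologicalType) (K D : set T) (f : T -> set T) :
  compact K -> (forall z, D z -> open (f z)) -> K `<=` \bigcup_(z in D) f z ->
  exists2 s : seq T, (forall z, z \in s -> D z) &
    K `<=` \bigcup_(z in [set z | z \in s]) f z.
Proof.
move=> cK oF KD; have /(_ T D f oF KD) [D0 DD0 KD0] : cover_compact K.
  by rewrite -compact_cover.
by exists (finmap.enum_fset D0) => // z /DD0; rewrite inE.
Qed.

(** * Bump functions *)

Section urysohn_bumps.
Context {R : realType} {T : ptopologicalType}.

(* One construction serves both for continuous functions on the bundle and
   for smooth functions on R^n: C is the regularity class. *)
Lemma urysohn_of_bumps (C : (T -> R) -> Prop) (K G : set T) :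
  (forall c, C (cst c)) ->
  (forall f g, C f -> C g -> C (fun x => f x * g x)) ->
  (forall f g, C f -> C g -> C (fun x => f x - g x)) ->
  compact K ->
  (forall z, K z -> exists t, [/\ C t, forall w, 0 <= t w <= 1,
     exists2 B, open B /\ B z & forall w, B w -> t w = 1 &
     exists L, [/\ compact L, L `<=` G & forall w, ~ L w -> t w = 0]]) ->
  exists f, [/\ C f, forall w, 0 <= f w <= 1,
     exists W, [/\ open W, K `<=` W & forall w, W w -> f w = 1] &
     exists L, [/\ compact L, L `<=` G & forall w, ~ L w -> f w = 0]].
Proof.
move=> Cc CM CB cK bump.
have tex z : exists t, K z -> [/\ C t, forall w, 0 <= t w <= 1,
    exists2 B, open B /\ B z & forall w, B w -> t w = 1 &
    exists L, [/\ compact L, L `<=` G & forall w, ~ L w -> t w = 0]].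
  by have [/bump[tz]|nK] := pselect (K z); [exists tz|exists (cst 0)].
have [t tP] := choice tex.
have [||D DKz KD] := @compact_finite_cover _ K K (fun z => interior [set w | t z w = 1]) cK.
- by move=> z _; exact: open_interior.
- move=> z Kz; exists z => //; have [_ _ [B [oB Bz] B1] _] := tP z Kz.
  by apply: (filterS B1); apply: open_nbhs_nbhs.
(* This is 1 wherever some [t z] is 1 and 0 outside the union of their supports, and it uses only
   operations under which [C] is stable. *)
exists (fun w : T => 1 - \prod_(z <- D) (1 - t z w)).
have fac w z : z \in D -> 0 <= 1 - t z w <= 1.
  by move=> /DKz /tP[_ /(_ w) /andP[t0 t1] _ _]; rewrite subr_ge0 t1 gerBl.
split.
- apply: (CB (cst 1)); first exact: Cc.
  have : forall z, z \in D -> C (t z) by move=> z /DKz /tP[].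
  elim: D {DKz KD fac} => [|z s IH] Cs.
    by under eq_fun do rewrite big_nil; exact: Cc.
  under eq_fun do rewrite big_cons; apply: (CM (fun w => 1 - t z w)).
    by apply: (CB (cst 1)); [exact: Cc|apply: Cs; rewrite mem_head].
  by apply: IH => y ys; apply: Cs; rewrite inE ys orbT.
- move=> w; rewrite subr_ge0 gerBl; apply/andP; split.
    rewrite big_seq; apply: prodr_ile1 => z; exact: fac.
  by rewrite big_seq_cond; apply: prodr_ge0 => z; rewrite andbT => /(fac w)/andP[].
- exists (\bigcup_(z in [set z | z \in D]) interior [set w | t z w = 1]); split => //.
    by apply: bigcup_open => z _; exact: open_interior.
  move=> w [z /= zD /interior_subset/= tz1].
  by rewrite (big_rem z)//= tz1 subrr mul0r subr0.
- have : forall z, z \in D -> K z by [].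
  elim: D {DKz KD fac} => [|z s IH] Ks.
    exists set0; split; [exact: compact0|by []|].
    by move=> w _; rewrite big_nil subrr.
  have [|L [cL LG L0]] := IH; first by move=> y ys; apply: Ks; rewrite inE ys orbT.
  have [_ _ _ [M [cM MG M0]]] := tP z (Ks z (mem_head _ _)).
  exists (M `|` L); split; first exact: compactU.
    by move=> w [/MG|/LG].
  move=> w /not_orP[nM nL]; rewrite big_cons (M0 _ nM) subr0 mul1r.
  exact: L0.
Qed.

End urysohn_bumps.

Section bundle_functions.
Context {R : realType} {n : nat}.
Local Notation bundle := ('rV[R]_n * subspaces R n)%type.

Lemma cutoff_continuous : continuous (@cutoff R).
Proof.
move=> t; apply: differentiable_continuous.
exact: (@Ck_diff _ _ _ 0 _ _ (cutoff_Ck 0)).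
Qed.

Lemma fst_setX_compact (K : set 'rV[R]_n) : compact K ->
  compact (K `*` [set: subspaces R n]).
Proof. by move=> cK; apply: compact_setX => //; exact: subspaces_compact. Qed.

Lemma bundle_ball_compact (z : bundle) s : compact [set w | bundle_dist z w <= s].
Proof.
apply: (@subclosed_compact _ _ (ecball z.1 (n%:R * s) `*` setT)).
- rewrite (_ : [set w | _] = bundle_dist z @^-1` [set t | t <= s])//.
  by apply: closed_comp => [w _|]; [exact: bundle_dist_continuous|exact: closed_le].
- exact/fst_setX_compact/ecball_compact.
- move=> w /= ws; split => //=; rewrite /ecball/= (le_trans (enorm_le_norm _))//.
  by rewrite ler_wpM2l// (le_trans _ ws)// lerDl.
Qed.

Lemma bundle_urysohn (K G : set bundle) : compact K -> open G -> K `<=` G ->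
  exists f : bundle -> R, [/\ continuous f, forall w, 0 <= f w <= 1,
    forall w, K w -> f w = 1 &
    exists L, [/\ compact L, L `<=` G & forall w, ~ L w -> f w = 0]].
Proof.
move=> cK oG KG.
have [||||z Kz|f [cf f01 [W [_ KW W1]] fL]] :=
  @urysohn_of_bumps R _ (fun f : bundle -> R => continuous f) K G.
- by move=> c; exact: cst_continuous.
- by move=> f g cf cg w; apply: (@continuousM _ _ f g w); [exact: cf|exact: cg].
- by move=> f g cf cg w; apply: (@continuousB _ _ _ f g w); [exact: cf|exact: cg].
- exact: cK.
- have [r r0 rG] : exists2 r, 0 < r & forall w, bundle_dist z w < r -> G w.
    by apply: nbhs_bundle_dist; apply: open_nbhs_nbhs; split => //; exact: KG.
  exists (fun w => cutoff (bundle_dist z w / r)); split.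
  + move=> w; apply: (@continuous_comp _ _ _ (fun w => bundle_dist z w / r) cutoff).
      apply: (@continuousM _ _ (bundle_dist z) (cst r^-1)).
        exact: bundle_dist_continuous.
      exact: cst_continuous.
    exact: cutoff_continuous.
  + by move=> w; rewrite cutoff_ge0 cutoff_le1.
  + exists (bundle_dist z @^-1` [set t | t < r / 4]).
      split; last by rewrite /= bundle_distxx divr_gt0.
      apply: open_comp => [w _|]; [exact: bundle_dist_continuous|exact: open_lt].
    by move=> w /= wr; rewrite cutoff1// ler_pdivrMr// mulrC ltW.
  + exists [set w | bundle_dist z w <= r / 2]; split.
    * exact: bundle_ball_compact.
    * by move=> w /= wr; apply: rG; rewrite (le_lt_trans wr)// ltr_pdivrMr// ltr_pMr// ltr1n.
    * move=> w /negP; rewrite -ltNge => wr; apply: cutoff0.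
      by rewrite ler_pdivlMr// mulrC ltW.
by exists f; split => // w /KW; exact: W1.
Qed.

End bundle_functions.

Section smooth_urysohn.
Context {R : realType} {n : nat}.

Definition scalar_smooth (f : 'rV[R]_n -> R) := forall k, Ck k f.

Lemma dotp_shift_smooth (x : 'rV[R]_n) : scalar_smooth (fun y => dotp (y - x) (y - x)).
Proof. by move=> k; apply: Ck_sum => i; apply: CkM; exact: Ck_coord. Qed.

Lemma cutoff_dotp_smooth (x : 'rV[R]_n) a :
  scalar_smooth (fun y => cutoff (dotp (y - x) (y - x) * a)).
Proof.
move=> k; apply: (@Ck_comp1 _ _ cutoff (fun y => dotp (y - x) (y - x) * a)).
  exact: cutoff_Ck.
by apply: CkM; [exact: dotp_shift_smooth|exact: Ck_cst].
Qed.

Lemma smooth_urysohn (K G : set 'rV[R]_n) : compact K -> open G -> K `<=` G ->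
  exists f : 'rV[R]_n -> R, [/\ scalar_smooth f, forall w, 0 <= f w <= 1,
    exists W, [/\ open W, K `<=` W & forall w, W w -> f w = 1] &
    exists L, [/\ compact L, L `<=` G & forall w, ~ L w -> f w = 0]].
Proof.
move=> cK oG KG; apply: urysohn_of_bumps => //.
- by move=> c k; exact: Ck_cst.
- by move=> f g cf cg k; apply: CkM; [exact: cf|exact: cg].
- by move=> f g cf cg k; apply: CkB; [exact: cf|exact: cg].
move=> z Kz; have /nbhs_eball[r r0 rG] : nbhs z G.
  by apply: open_nbhs_nbhs; split => //; exact: KG.
have r20 : 0 < r ^+ 2 by rewrite exprn_gt0.
exists (fun w => cutoff (dotp (w - z) (w - z) * (r ^+ 2)^-1)); split.
- exact: cutoff_dotp_smooth.
- by move=> w; rewrite cutoff_ge0 cutoff_le1.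
- exists (eball z (r / 2)).
    by split; [exact: eball_open|rewrite /eball/= subrr enorm0 divr_gt0].
  move=> w; rewrite /eball/= enorm_lt ?divr_ge0 ?ltW// => wr.
  rewrite cutoff1// ler_pdivrMr//; apply: (le_trans (ltW wr)).
  by rewrite expr_div_n mulrC -natrX.
(* The cutoff vanishes once the squared ratio reaches 1/2, and [(3/4)^2 = 9/16] exceeds 1/2. *)
- exists (ecball z (3 / 4 * r)); split.
  + exact: ecball_compact.
  + move=> w wr; apply: rG; rewrite /eball/= (le_lt_trans wr)//.
    by rewrite gtr_pMl// ltr_pdivrMr// mul1r ltr_nat.
  + move=> w /negP; rewrite -ltNge => wr; apply: cutoff0.
    have r34 : 0 <= 3 / 4 * r by rewrite mulr_ge0 ?ltW.
    move: wr; rewrite ltNge enorm_le// -ltNge => wr.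
    rewrite ler_pdivlMr// (le_trans _ (ltW wr))// exprMn ler_pM2r//.
    by lra.
Qed.

End smooth_urysohn.

(** * The order on varifolds *)

Lemma measure_eq (R : realType) d (T : semiRingOfSetsType d)
  (mu nu : {measure set T -> \bar R}) : (forall A, mu A = nu A) -> mu = nu.
Proof.
case: mu => f [cf mf]; case: nu => g [cg mg] /= /funext fg; subst g.
have e : cf = cg.
  case: cf {mf} => a1 b1; case: cg {mg} => a2 b2.
  by rewrite (Prop_irrelevance a1 a2) (Prop_irrelevance b1 b2).
subst cg; have -> // : mf = mg.
by case: mf => c1; case: mg => c2; rewrite (Prop_irrelevance c1 c2).
Qed.

Section varifold_order.
Context {R : realType} {n m : nat} {U : set 'rV[R]_n}.
Hypothesis oU : open U.
Local Notation bundle := ('rV[R]_n * subspaces R n)%type.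
Local Notation O := (UG m U).
Implicit Types (V W Z : varifold m U) (k : bundle -> R) (A : set bundle).

Lemma UG_open : open O.
Proof.
rewrite (_ : O = fst @^-1` U `&` snd @^-1` grassmann m); last by [].
apply: openI; apply: open_comp => //.
- by move=> z _; exact: cvg_fst.
- by move=> z _; exact: cvg_snd.
- exact: grassmann_open.
Qed.

Lemma vfinite V : finite_on_compacts O V.
Proof. exact: (radon_finite (vradon V)). Qed.

Let hB := @bundle_hausdorff R n.

Lemma vfunD V k k' : Kspace O k -> Kspace O k' ->
  vfun V (fun z => k z + k' z) = vfun V k + vfun V k'.
Proof. exact: (KintegralD hB UG_open (@vfinite V)). Qed.

Lemma vfunB V k k' : Kspace O k -> Kspace O k' ->
  vfun V (fun z => k z - k' z) = vfun V k - vfun V k'.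
Proof. exact: (KintegralB hB UG_open (@vfinite V)). Qed.

Lemma vfunZ V a k : Kspace O k -> vfun V (fun z => a * k z) = a * vfun V k.
Proof. exact: (KintegralZ hB UG_open (@vfinite V)). Qed.

Lemma vfun_ge0 V k : (forall z, 0 <= k z) -> 0 <= vfun V k.
Proof. exact: Kintegral_ge0. Qed.

Lemma vfun_norm V k : Kspace O k -> `|vfun V k| <= vfun V (fun z => `|k z|).
Proof. exact: (Kintegral_norm hB UG_open (@vfinite V)). Qed.

Lemma vfun_vzero k : vfun (vzero m U) k = 0.
Proof. by rewrite /vfun /Rintegral/= integral_measure_zero. Qed.

(** Inner regularity and bump functions give the inequality on open sets; outer regularity carries
    it to arbitrary sets. *)
Lemma vle_measure W V A : vle W V -> (W A <= V A)%E.
Proof.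
move=> WV; have rW := vradon W; have rV := vradon V.
have oG G : open G -> (W G <= V G)%E.
  move=> oG; apply: (@le_trans _ _ (W (G `&` O))).
    by apply: (radon_le rW) => x [].
  have [_ iW _] := rW; rewrite iW; last 2 first.
  - by apply: openI => //; exact: UG_open.
  - by move=> x [].
  apply: ge_ereal_sup => _ [K [cK KG] <-].
  have [|f [cf f01 fK [L [cL LG L0]]]] := bundle_urysohn cK _ KG.
    by apply: openI => //; exact: UG_open.
  have Kf : Kspace O f by apply: (Kspace_of hB cf cL) => // z /LG[].
  have f0 w : 0 <= f w by have /andP[] := f01 w.
  apply: (@le_trans _ _ (vfun W f)%:E).
    apply: (measure_le_Kintegral hB UG_open (@vfinite W) Kf) => //.
    + exact: measurable_compact.
    + by move=> z /KG[].
    + by move=> z /fK ->.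
  apply: (@le_trans _ _ (vfun V f)%:E); first by rewrite lee_fin; exact: WV.
  have := @Kintegral_le_measure _ _ _ hB UG_open _ (@vfinite V) f G 1 Kf ler01.
  rewrite mul1e ger0_norm ?Kintegral_ge0//; apply.
  - exact: measurable_open.
  - by move=> x; rewrite ger0_norm//; have /andP[] := f01 x.
  - by move=> x _ nG; apply: L0 => /LG[].
have [_ _ ->] := rV; apply: le_ereal_inf_tmp => _ [G [oG' AG] <-].
by rewrite (le_trans _ (oG _ oG'))//; exact: (radon_le rW).
Qed.

(** Comparison in both directions. A varifold is thus determined, up to Leibniz equality, by its
    functional, which is what makes [vsum] and [vdiff] describe unique objects. *)
Lemma varifold_eq W V : (forall k, Kspace O k -> vfun W k = vfun V k) -> W = V.
Proof.
move=> WV; have e A : W A = V A.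
  by apply/eqP; rewrite eq_le !vle_measure// => k Kk _; rewrite WV.
case: W V e {WV} => [W rW] [V rV] /= e.
have {}e : W = V by apply: measure_eq => A; exact: e.
subst V; congr (Varifold _); exact: Prop_irrelevance.
Qed.

Lemma vsum_ex V W : exists Z, vsum V W Z.
Proof.
exists (Varifold (radon_add hB (vradon V) (vradon W))) => k Kk.
rewrite /vfun /Rintegral/=.
have mO : measurable (O : set (borel bundle)) := measurable_open UG_open.
rewrite integral_measure_add//; last 2 first.
- exact: (Kspace_integrable hB UG_open (@vfinite V)).
- exact: (Kspace_integrable hB UG_open (@vfinite W)).
rewrite fineD// integrable_fin_num//.
- exact: (Kspace_integrable hB UG_open (@vfinite V)).
- exact: (Kspace_integrable hB UG_open (@vfinite W)).
Qed.

Lemma bundle_bump (K : set bundle) : compact K -> K `<=` O -> exists k,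
  [/\ Kspace O k, forall z, 0 <= k z & forall z, K z -> k z = 1].
Proof.
move=> cK KO; have [f [cf f01 f1 [L [cL LG L0]]]] := bundle_urysohn cK (UG_open) KO.
exists f; split => //; last by move=> z; have /andP[] := f01 z.
exact: (Kspace_of hB cf cL).
Qed.

End varifold_order.

(** * First variation *)

Section variation_integrand.
Context {R : realType} {n : nat}.
Local Notation bundle := ('rV[R]_n * subspaces R n)%type.
Implicit Types (g h : 'rV[R]_n -> 'rV[R]_n) (x y : 'rV[R]_n) (z : bundle).

Definition divergence g z : R := \tr ('J g z.1 *m orth_proj z.2).

Lemma smooth_coord g i k : smooth g -> Ck k (fun x => g x 0 i).
Proof. by move=> /smooth_coordP. Qed.

Lemma smooth_differentiable g x : smooth g -> differentiable g x.
Proof. by move=> /smoothP/(_ 0%N)/Ck_diff; apply. Qed.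

Lemma jacobianE g x i j : differentiable g x ->
  ('J g x) i j = 'D_(delta_mx 0 i) (fun y => g y 0 j) x.
Proof.
move=> dg; have := deriveEjacobian (delta_mx 0 i) dg.
rewrite -rowE derive_mx; last exact: diff_derivable.
by move=> /(congr1 (fun M : 'rV_n => M 0 j)); rewrite !mxE.
Qed.

Lemma divergenceE g z : smooth g -> divergence g z =
  \sum_i \sum_j 'D_(delta_mx 0 i) (fun y => g y 0 j) z.1 * orth_proj z.2 j i.
Proof.
move=> sg; rewrite /divergence /mxtrace; apply: eq_bigr => i _; rewrite mxE.
by apply: eq_bigr => j _; rewrite jacobianE//; exact: smooth_differentiable.
Qed.

Lemma divergence_continuous g : smooth g -> continuous (divergence g).
Proof.
move=> sg; rewrite (funext (fun z => divergenceE z sg)).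
apply: sum_continuous => i; apply: sum_continuous => j z.
have [_ /(_ (delta_mx 0 i)) [dD _]] := smooth_coord j 1 sg.
apply: (@continuousM _ _ (fun z : bundle => 'D_(delta_mx 0 i) (fun y => g y 0 j) z.1)
  (fun z : bundle => orth_proj z.2 j i)).
  apply: (@continuous_comp _ _ _ fst ('D_(delta_mx 0 i) (fun y => g y 0 j))).
    exact: cvg_fst.
  exact: (differentiable_continuous (dD _)).
apply: (@continuous_comp _ _ _ snd (fun S : subspaces R n => orth_proj S j i)).
  exact: cvg_snd.
apply: (@continuous_comp _ _ _ (orth_proj : subspaces R n -> 'M[R]_n) (fun M => M j i)).
  exact: orth_proj_continuous.
exact: mx_entry_continuous.
Qed.

Lemma divergence_out g z : smooth g -> ~ spt g z.1 -> divergence g z = 0.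
Proof.
move=> sg nz; rewrite divergenceE//; apply: big1 => i _; apply: big1 => j _.
rewrite (@near_eq_derive _ _ _ _ (cst 0)) ?derive_cst ?mul0r//.
have : nbhs z.1 (~` spt g).
  by apply: open_nbhs_nbhs; split => //; apply: closed_openC; exact: closed_closure.
by apply: filterS => y /spt_out ->; rewrite mxE.
Qed.

Lemma divergenceD g h z : smooth g -> smooth h ->
  divergence (fun x => g x + h x) z = divergence g z + divergence h z.
Proof.
move=> sg sh; have sgh : smooth (fun x => g x + h x).
  apply/smooth_coordP => k i; under eq_fun do rewrite mxE.
  by apply: CkD; exact: smooth_coord.
rewrite !divergenceE// -big_split; apply: eq_bigr => i _ /=.
rewrite -big_split; apply: eq_bigr => j _ /=; rewrite -mulrDl; congr (_ * _).
rewrite (_ : (fun y => (g y + h y) 0 j) = (fun y => g y 0 j) + (fun y => h y 0 j)).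
  by rewrite deriveD//; apply: diff_derivable;
    apply: (@Ck_diff _ _ _ 0%N); exact: smooth_coord.
by apply/funext => y; rewrite mxE.
Qed.

(** The indicator function of G(n,m) in continuous form: the trace is an integer, so the cutoff only
    takes the values 1 and 0 here. *)
Definition grassmann_indic (m : nat) z : R :=
  cutoff ((\tr (orth_proj z.2) - m%:R) ^+ 2).

Lemma grassmann_indic1 m z : grassmann m z.2 -> grassmann_indic m z = 1.
Proof.
rewrite /grassmann/= => dz; rewrite /grassmann_indic orth_proj_trace dz subrr.
by rewrite expr0n cutoff1 //= invr_ge0.
Qed.

Lemma grassmann_indic0 m z : ~ grassmann m z.2 -> grassmann_indic m z = 0.
Proof.
move=> /grassmann_gap gap; apply: cutoff0.
by move: gap; rewrite -(real_normK (num_real _)) => ?; nra.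
Qed.

Lemma grassmann_indic_continuous m : continuous (grassmann_indic m).
Proof.
move=> z; apply: (@continuous_comp _ _ _
  (fun z : bundle => (\tr (orth_proj z.2) - m%:R) ^+ 2) cutoff).
  apply: (@continuous_comp _ _ _ snd
    (fun S : subspaces R n => (\tr (orth_proj S) - m%:R) ^+ 2)).
    exact: cvg_snd.
  apply: (@continuous_comp _ _ _ (fun S : subspaces R n => \tr (orth_proj S) - m%:R)
    (fun t : R => t ^+ 2)); last exact: exprn_continuous.
  apply: (@continuousB _ _ _ (fun S : subspaces R n => \tr (orth_proj S)) (cst m%:R)).
    exact: orth_proj_trace_continuous.
  exact: cst_continuous.
exact: cutoff_continuous.
Qed.

(** With this factor the integrand of the first variation becomes an element of K(U x G(n,m)), so
    that sums and limits of varifolds pass to first variations. *)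
Definition divergenceK m g z : R := grassmann_indic m z * divergence g z.

Lemma divergenceK_Kspace m (U : set 'rV[R]_n) g : smooth g -> compact (spt g) ->
  spt g `<=` U -> Kspace (UG m U) (divergenceK m g).
Proof.
move=> sg cg gU.
apply: (@Kspace_of _ _ _ (@bundle_hausdorff R n) _ (spt g `*` grassmann m)).
- move=> z; apply: (@continuousM _ _ (grassmann_indic m) (divergence g)).
    exact: grassmann_indic_continuous.
  exact: divergence_continuous.
- exact: setX_grassmann_compact.
- by move=> z [/gU].
- move=> z nz; rewrite /divergenceK.
  have [gz|/grassmann_indic0 ->] := pselect (grassmann m z.2); last by rewrite mul0r.
  by rewrite divergence_out ?mulr0// => sz; apply: nz.
Qed.

Lemma first_variationE m (U : set 'rV[R]_n) (V : varifold m U) g :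
  first_variation V g = vfun V (divergenceK m g).
Proof.
apply: eq_Rintegral => z; rewrite inE => -[_ gz].
by rewrite /divergenceK grassmann_indic1// mul1r.
Qed.

End variation_integrand.

Section first_variation.
Context {R : realType} {n m : nat} {U : set 'rV[R]_n}.
Hypothesis oU : open U.
Implicit Types (V W Z : varifold m U) (g h : 'rV[R]_n -> 'rV[R]_n) (A G : set 'rV[R]_n).

Lemma first_variationD V g h : smooth g -> compact (spt g) -> spt g `<=` U ->
  smooth h -> compact (spt h) -> spt h `<=` U ->
  first_variation V (fun x => g x + h x) = first_variation V g + first_variation V h.
Proof.
move=> sg cg gU sh ch hU; rewrite !first_variationE -vfunD//;
  do ?[exact: divergenceK_Kspace].
by congr (vfun V _); apply/funext => z; rewrite /divergenceK divergenceD// mulrDr.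
Qed.

Lemma first_variation_vsum V W Z g : smooth g -> compact (spt g) -> spt g `<=` U ->
  vsum V W Z -> first_variation Z g = first_variation V g + first_variation W g.
Proof.
by move=> sg cg gU VWZ; rewrite !first_variationE VWZ//; exact: divergenceK_Kspace.
Qed.

Lemma spt_sub (V : zmodType) (g : 'rV[R]_n -> V) (L : set 'rV[R]_n) :
  closed L -> (forall x, ~ L x -> g x = 0) -> spt g `<=` L.
Proof.
move=> cL g0; rewrite /spt [X in _ `<=` X](closure_id L).1//.
by apply: closure_subset => x /=; apply: contra_neqP => /g0.
Qed.

Lemma closed_compact_rV (L : set 'rV[R]_n) : compact L -> closed L.
Proof. by apply: compact_closed; exact: norm_hausdorff. Qed.

Lemma sub_compact_rV (L M : set 'rV[R]_n) : compact M -> closed L -> L `<=` M -> compact L.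
Proof. by move=> cM cL LM; exact: (subclosed_compact cL cM LM). Qed.

Lemma spt0 : spt (cst 0 : 'rV[R]_n -> 'rV[R]_n) = set0.
Proof.
rewrite /spt (_ : [set _ | _] = set0) ?closure0//.
by apply/seteqP; split => x //=; rewrite eqxx.
Qed.

Lemma test_field0 G : test_field G (cst 0).
Proof.
split => [||y|x]; rewrite ?spt0 ?enorm0//.
- apply/smooth_coordP => k i; rewrite (_ : (fun _ => _) = cst 0); first exact: Ck_cst.
  by apply/funext => y; rewrite mxE.
- exact: compact0.
Qed.

Lemma first_variation0 V : first_variation V (cst 0) = 0.
Proof.
have [s0 _ _ _] := test_field0 set0.
rewrite first_variationE (_ : divergenceK m (cst 0) = cst 0).
  by rewrite /vfun /Rintegral integral0.
by apply/funext => z; rewrite /divergenceK divergence_out ?mulr0// spt0.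
Qed.

Definition variation V G : \bar R :=
  ereal_sup [set (first_variation V g)%:E | g in test_field G].

Lemma test_field_sub G G' : G `<=` G' -> test_field G `<=` test_field G'.
Proof. by move=> GG' g [sg cg gG g1]; split => //; exact: subset_trans gG GG'. Qed.

Lemma le_variation V G G' : G `<=` G' -> (variation V G <= variation V G')%E.
Proof.
move=> GG'; apply: ge_ereal_sup => _ [g gG <-]; apply: ereal_sup_ubound.
by exists g => //; exact: test_field_sub gG.
Qed.

Lemma variation_ge0 V G : (0 <= variation V G)%E.
Proof.
apply: le_ereal_sup_tmp; exists 0%E => //; exists (cst 0); first exact: test_field0.
by rewrite first_variation0.
Qed.

Lemma le_variation_test V G g : test_field G g -> ((first_variation V g)%:E <= variation V G)%E.
Proof. by move=> gG; apply: ereal_sup_ubound; exists g. Qed.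

Lemma smooth_scale (b : 'rV[R]_n -> R) g : scalar_smooth b -> smooth g ->
  smooth (fun x => b x *: g x).
Proof.
move=> sb sg; apply/smooth_coordP => k i; under eq_fun do rewrite mxE.
by apply: CkM; [exact: sb|exact: smooth_coord].
Qed.

Lemma test_field_cut (b : 'rV[R]_n -> R) g G L : scalar_smooth b ->
  (forall x, 0 <= b x <= 1) -> test_field U g -> compact L -> L `<=` G ->
  (forall x, ~ L x -> b x *: g x = 0) -> test_field G (fun x => b x *: g x).
Proof.
move=> sb b01 [sg cg gU g1] cL LG L0.
have sL : spt (fun x => b x *: g x) `<=` L.
  by apply: spt_sub => //; exact: closed_compact_rV.
split.
- exact: smooth_scale.
- by apply: (sub_compact_rV cL) => //; exact: closed_closure.
- exact: subset_trans LG.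
- move=> x; rewrite enormZ; have /andP[b0 b1] := b01 x.
  by rewrite ger0_norm// mulr_ile1 ?enorm_ge0.
Qed.

(** A field [g] is split as [b g + (1 - b) g] with [b] supported in [G] and equal to 1 on a
    neighbourhood of [spt g] minus [G']; the second summand then has its support in [G']. *)
Lemma variationU V G G' : open G -> open G' -> G `|` G' `<=` U ->
  (variation V (G `|` G') <= variation V G + variation V G')%E.
Proof.
move=> oG oG' GU; apply: ge_ereal_sup => _ [g gT <-].
have [sg cg gG g1] := gT.
have gU : test_field U g by exact: test_field_sub gT.
pose K := spt g `\` G'.
have cK : compact K.
  apply: (sub_compact_rV cg); last by move=> x [].
  by rewrite ?/K setDE; apply: closedI; [exact: closed_closure|exact: open_closedC].
have KG : K `<=` G by move=> x [/gG[]].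
have [b [sb b01 [W [oW KW W1]] [L [cL LG L0]]]] := smooth_urysohn cK oG KG.
have s1b : scalar_smooth (fun x => 1 - b x).
  by move=> k; apply: CkB; [exact: Ck_cst|exact: sb].
have t1 : test_field G (fun x => b x *: g x).
  by apply: (@test_field_cut b g G L) => // x /L0 ->; rewrite scale0r.
have t2 : test_field G' (fun x => (1 - b x) *: g x).
  apply: (@test_field_cut (fun x => 1 - b x) g G' (spt g `\` W)) => //.
  - by move=> x; have /andP[b0 b1] := b01 x; rewrite subr_ge0 b1 gerBl.
  - apply: (sub_compact_rV cg); last by move=> x [].
    by rewrite ?/K setDE; apply: closedI; [exact: closed_closure|exact: open_closedC].
  - by move=> x [gx nW]; apply: contrapT => nG'; apply: nW; exact: KW.
  - move=> x nx; have [Wx|nWx] := pselect (W x); first by rewrite W1// subrr scale0r.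
    by rewrite (@spt_out _ _ g x) ?scaler0// => gx; apply: nx.
have -> : first_variation V g =
    first_variation V (fun x => b x *: g x) +
    first_variation V (fun x => (1 - b x) *: g x).
  have [s1 c1 u1 _] := t1; have [s2 c2 u2 _] := t2.
  have u1U : spt (fun x => b x *: g x) `<=` U.
    by apply: (subset_trans u1) => x Gx; apply: GU; left.
  have u2U : spt (fun x => (1 - b x) *: g x) `<=` U.
    by apply: (subset_trans u2) => x Gx; apply: GU; right.
  rewrite -(first_variationD V s1 c1 u1U s2 c2 u2U).
  congr (first_variation V _); apply/funext => x.
  by rewrite -scalerDl addrC subrK scale1r.
by rewrite EFinD leeD// le_variation_test.
Qed.

(** The support of a test field is compact, hence contained in finitely many of the sets, and finite
    subadditivity applies. *)
Lemma variation_bigcup V (G : nat -> set 'rV[R]_n) :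
  (forall i, open (G i)) -> (forall i, G i `<=` U) ->
  (variation V (\bigcup_i G i) <= \sum_(i <oo) variation V (G i))%E.
Proof.
move=> oG GU; apply: ge_ereal_sup => _ [g [sg cg gG g1] <-].
have fin N : (variation V (\big[setU/set0]_(i < N) G i) <=
    \sum_(i < N) variation V (G i))%E.
  elim: N => [|N IH].
    rewrite !big_ord0 (_ : variation V set0 = 0%E)//.
    apply/eqP; rewrite eq_le variation_ge0 andbT.
    apply: ge_ereal_sup => _ [h [_ _ h0 _] <-].
    rewrite (_ : h = cst 0) ?first_variation0//; apply/funext => x.
    by apply: spt_out => /h0.
  rewrite !big_ord_recr/=; apply: (le_trans (variationU _ _ _ _)) => //.
  - by rewrite -bigcup_mkord; apply: bigcup_open => i _; exact: oG.
  - by rewrite -bigcup_mkord => x [[i _ /GU]|/GU].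
  - by rewrite leeD2r.
have [N gN] : exists N, spt g `<=` \big[setU/set0]_(i < N) G i.
  move: (cg); rewrite compact_cover => /(_ nat setT G)[//|//|D _ gD].
  exists (\max_(i <- finmap.enum_fset D) i.+1).
  move=> x /gD[i /= iD Gx]; rewrite -bigcup_mkord; exists i => //=.
  by apply: (@leq_bigmax_seq _ _ xpredT (fun i => i.+1) i).
apply: (le_trans (@le_variation_test V (\big[setU/set0]_(i < N) G i) g _)) => //.
apply: (le_trans (fin N)); rewrite -(big_mkord xpredT (fun i => variation V (G i))).
by apply: nneseries_lim_ge => i *; exact: variation_ge0.
Qed.

(** Where the supports are disjoint the sum of two fields is still bounded by 1. This
    superadditivity is what yields measurability of open sets. *)
Lemma variation_disjoint V G G' g h : test_field G g -> test_field G' h ->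
  G `<=` U -> G' `<=` U -> (forall x, spt g x -> spt h x -> False) ->
  ((first_variation V g + first_variation V h)%:E <= variation V (G `|` G'))%E.
Proof.
move=> [sg cg gG g1] [sh ch hG h1] GU GU' dis.
rewrite -(first_variationD V sg cg (subset_trans gG GU) sh ch (subset_trans hG GU')).
apply: le_variation_test.
have sub : spt (fun x => g x + h x) `<=` spt g `|` spt h.
  apply: spt_sub; first by apply: closedU; exact: closed_closure.
  by move=> x /not_orP[ng nh]; rewrite (spt_out ng) (spt_out nh) addr0.
split.
- apply/smooth_coordP => k i; under eq_fun do rewrite mxE.
  by apply: CkD; exact: smooth_coord.
- by apply: (sub_compact_rV (compactU cg ch)) => //; exact: closed_closure.
- by move=> x /sub[/gG|/hG]; [left|right].
- move=> x; have [gx|ng] := pselect (spt g x).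
    have nh : ~ spt h x by exact: dis.
    by rewrite (spt_out nh) addr0.
  by rewrite (spt_out ng) add0r.
Qed.

End first_variation.

Lemma lee_add_lt (R : realType) (a b c d : R) :
  (a%:E < c%:E)%E -> (b%:E < d%:E)%E -> ((a + b)%:E <= (c + d)%:E)%E.
Proof. by rewrite !lte_fin lee_fin => ac bd; rewrite lerD// ltW. Qed.

(** * The variation as a Borel regular measure *)

Section variation_measure.
Context {R : realType} {n m : nat} {U : set 'rV[R]_n}.
Hypothesis oU : open U.
Implicit Types (V W Z : varifold m U) (A B G : set 'rV[R]_n).

(** The outer regular extension of the variation from open sets; it turns out to be [delta_norm V],
    see [delta_normE]. *)
Definition variation_outer V A : \bar R :=
  ereal_inf [set variation V G | G in [set G | [/\ open G, G `<=` U & A `&` U `<=` G]]].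

Lemma variation_outer_le V A G : open G -> G `<=` U -> A `&` U `<=` G ->
  (variation_outer V A <= variation V G)%E.
Proof. by move=> oG GU AG; apply: ereal_inf_lbound; exists G. Qed.

Lemma variation_outer_open V G : open G -> G `<=` U ->
  variation_outer V G = variation V G.
Proof.
move=> oG GU; apply/eqP; rewrite eq_le; apply/andP; split.
  by apply: variation_outer_le => // x [].
apply: le_ereal_inf_tmp => _ [H [oH HU GH] <-]; apply: le_variation.
by move=> x Gx; apply: GH; split => //; exact: GU.
Qed.

Lemma variation_outer_ge0 V A : (0 <= variation_outer V A)%E.
Proof. by apply: le_ereal_inf_tmp => _ [G _ <-]; exact: variation_ge0. Qed.

Lemma variation_outer0 V : variation_outer V set0 = 0%E.
Proof.
rewrite variation_outer_open; [|exact: open0|exact: sub0set].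
apply/eqP; rewrite eq_le variation_ge0 andbT.
apply: ge_ereal_sup => _ [h [_ _ h0 _] <-].
rewrite (_ : h = cst 0) ?first_variation0//; apply/funext => x.
by apply: spt_out => /h0.
Qed.

Lemma le_variation_outer V : {homo variation_outer V : A B / A `<=` B >-> (A <= B)%E}.
Proof.
move=> A B AB; apply: ereal_inf_le_tmp => _ [G [oG GU BG] <-]; exists G => //.
by split => // x [/AB Bx Ux]; apply: BG.
Qed.

Lemma variation_outer_subadditive V : sigma_subadditive (variation_outer V).
Proof.
move=> A; have [[i ioo]|] := pselect (exists i, variation_outer V (A i) = +oo%E).
  rewrite (eseries_pinfty _ _ ioo) ?leey// => k _.
  by rewrite -ltNye (lt_le_trans _ (variation_outer_ge0 _ _)).
rewrite -forallNE => Aoo.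
apply/lee_addgt0Pr => e e0.
rewrite (le_trans _ (epsilon_trick _ _ _))//; last 2 first.
- by move=> k; exact: variation_outer_ge0.
- exact: ltW.
have [G GP] : {G : nat -> set 'rV[R]_n & forall k,
    [/\ open (G k), G k `<=` U & A k `&` U `<=` G k] /\
    (variation V (G k) <= variation_outer V (A k) + (e / (2 ^ k.+1)%:R)%:E)%E}.
  apply: (@choice _ _ (fun k G => [/\ open G, G `<=` U & A k `&` U `<=` G] /\
    (variation V G <= variation_outer V (A k) + (e / (2 ^ k.+1)%:R)%:E)%E)) => k.
  have Afin : variation_outer V (A k) \is a fin_num.
    by rewrite ge0_fin_numE ?variation_outer_ge0// ltey; apply/eqP/Aoo.
  have ek : 0 < e / (2 ^ k.+1)%:R by rewrite divr_gt0// ltr0n expn_gt0.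
  have [_ [G PG <-] Gle] := lb_ereal_inf_adherent ek Afin.
  by exists G; split => //; exact: ltW.
apply: (@le_trans _ _ (variation V (\bigcup_k G k))).
  apply: variation_outer_le.
  - by apply: bigcup_open => k _; have [[]] := GP k.
  - by move=> x [k _]; have [[_ GU _] _] := GP k; exact: GU.
  - move=> x [[k _ Ax] Ux]; exists k => //; have [[_ _ AG] _] := GP k; exact: AG.
apply: (le_trans (variation_bigcup oU V _ _)).
- by move=> k; have [[]] := GP k.
- by move=> k; have [[]] := GP k.
- apply: lee_nneseries => [k _ _|k _]; first exact: variation_ge0.
  by have [_] := GP k.
Qed.

(** For [H] open around [A], take [g] nearly optimal in [H] intersected with [G]. Then [H] minus
    [spt g] is open, still contains the part of [A] outside [G], and its test fields have supports
    disjoint from that of [g]. *)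
Lemma variation_outer_open_measurable V G : open G ->
  forall A, (variation_outer V (A `&` G) + variation_outer V (A `&` ~` G) <=
    variation_outer V A)%E.
Proof.
move=> oG A; apply: le_ereal_inf_tmp => _ [H [oH HU AH] <-].
apply: lee_addl_approx; rewrite ?variation_outer_ge0// => a b aA bA.
have oHG : open (H `&` G) by exact: openI.
have : (a%:E < variation V (H `&` G))%E.
  apply: (lt_le_trans aA); apply: variation_outer_le => //; first by move=> x [/HU].
  by move=> x [[Ax Gx] Ux]; split => //; exact: AH.
move=> /ereal_sup_gt[_ [g gT <-]] ag; have [sg cg gG g1] := gT.
have oK : open (H `\` spt g).
  by rewrite setDE; apply: openI => //; apply: closed_openC; exact: closed_closure.
have : (b%:E < variation V (H `\` spt g))%E.
  apply: (lt_le_trans bA); apply: variation_outer_le => //; first by move=> x [/HU].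
  by move=> x [[Ax nG] Ux]; split; [exact: AH|move=> /gG[]].
move=> /ereal_sup_gt[_ [h hT <-]] bh; have [sh ch hG h1] := hT.
apply: (@le_trans _ _ (first_variation V g + first_variation V h)%:E).
  exact: lee_add_lt ag bh.
have s1 : H `&` G `<=` U by move=> x [/HU].
have s2 : H `\` spt g `<=` U by move=> x [/HU].
have dis x : spt g x -> spt h x -> False by move=> gx /hG[].
apply: (le_trans (@variation_disjoint _ _ _ _ oU V _ _ g h gT hT s1 s2 dis)).
by apply: le_variation => x [[]|[]].
Qed.

(** Open sets are Caratheodory measurable, hence all Borel sets are. The set function itself is
    kept, so its values on arbitrary sets remain those of the outer measure. *)
Lemma variation_measure_ex V :
  exists mu : {measure set (borel 'rV[R]_n) -> \bar R}, forall A, mu A = variation_outer V A.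
Proof.
pose om := isOuterMeasure.Build R 'rV[R]_n (variation_outer V)
  (variation_outer0 V) (variation_outer_ge0 V) (@le_variation_outer V)
  (@variation_outer_subadditive V).
pose o : {outer_measure set 'rV[R]_n -> \bar R} := HB.pack (variation_outer V) om.
have bc (A : set (borel 'rV[R]_n)) : measurable A -> o.-caratheodory A.
  apply: smallest_sub.
    split.
    - exact: caratheodory_measurable_set0.
    - by move=> B mB; rewrite setTD; exact: caratheodory_measurable_setC.
    - by move=> F mF; exact: caratheodory_measurable_bigcup.
  by move=> G oG; apply: le_caratheodory_measurable; exact: variation_outer_open_measurable.
have sa : semi_sigma_additive (variation_outer V : set (borel 'rV[R]_n) -> \bar R).
  move=> F mF tF mUF.
  apply: (@caratheodory_measure_sigma_additive R _ o) => //.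
  - by move=> i; exact: bc.
  - exact: bc.
pose mm := isMeasure.Build _ (borel 'rV[R]_n) R (variation_outer V)
  (variation_outer0 V) (variation_outer_ge0 V) sa.
pose mu : {measure set (borel 'rV[R]_n) -> \bar R} :=
  HB.pack (variation_outer V : set (borel 'rV[R]_n) -> \bar R) mm.
by exists mu.
Qed.

(** A competitor agrees with the variation on open sets, and open sets are among the Borel sets in
    its regularity formula; so it is at most the infimum over open sets. *)
Lemma largest_variation_outer V (mu : {measure set (borel 'rV[R]_n) -> \bar R}) :
  (forall A, mu A = variation_outer V A) ->
  largest_variation V mu.
Proof.
move=> muE; split; [split|].
- move=> A; apply/eqP; rewrite eq_le; apply/andP; split.
    apply: le_ereal_inf_tmp => _ [B [mB AB] <-]; rewrite !muE.
    apply: ereal_inf_le_tmp => _ [G [oG GU BG] <-]; exists G => //; split => //.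
    by move=> x Ax; apply: BG; split; [exact: AB|case: Ax].
  rewrite [leRHS]muE; apply: le_ereal_inf_tmp => _ [G [oG GU AG] <-].
  apply: ereal_inf_lbound; exists G; last by rewrite muE variation_outer_open.
  by split => //; exact: measurable_open.
- by move=> G oG GU; rewrite muE variation_outer_open.
- move=> nu [nureg nuE] A; rewrite muE.
  apply: le_ereal_inf_tmp => _ [G [oG GU AG] <-].
  rewrite -[leRHS](nuE G)// nureg; apply: ereal_inf_lbound; exists G => //.
  by split => //; exact: measurable_open.
Qed.

Lemma delta_normE V A : delta_norm V A = variation_outer V A.
Proof.
have [mu muE] := variation_measure_ex V.
have lmu := largest_variation_outer muE.
rewrite /delta_norm; case: pselect => [h|]; last by case; exists mu.
case: cid => nu [enu lnu] /=; rewrite -muE.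
apply/eqP; rewrite eq_le; apply/andP; split; [exact: (lmu.2 nu enu)|].
by apply: lnu; exact: lmu.1.
Qed.

Lemma delta_norm_open V G : open G -> G `<=` U -> delta_norm V G = variation V G.
Proof. by move=> oG GU; rewrite delta_normE variation_outer_open. Qed.

Lemma le_delta_norm V A B : A `<=` B -> (delta_norm V A <= delta_norm V B)%E.
Proof. by move=> AB; rewrite !delta_normE; exact: le_variation_outer. Qed.

Lemma delta_norm_ge_test V G g : open G -> G `<=` U -> test_field G g ->
  ((first_variation V g)%:E <= delta_norm V G)%E.
Proof. by move=> oG GU gG; rewrite delta_norm_open//; exact: le_variation_test. Qed.

Lemma delta_norm_ge0 V A : (0 <= delta_norm V A)%E.
Proof. by rewrite delta_normE variation_outer_ge0. Qed.

(* Comparison on open sets extends to all sets by outer regularity. *)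
Lemma delta_norm_le_sum V W Z A :
  (forall G, open G -> G `<=` U -> (variation Z G <= variation V G + variation W G)%E) ->
  (delta_norm Z A <= delta_norm V A + delta_norm W A)%E.
Proof.
move=> oG; rewrite !delta_normE; apply: lee_addr_approx; rewrite ?variation_outer_ge0//.
move=> a b /ereal_inf_lt[_ [G [oG1 GU AG] <-] Ga] /ereal_inf_lt[_ [H [oH HU AH] <-] Hb].
have oGH : open (G `&` H) by exact: openI.
apply: (@le_trans _ _ (variation Z (G `&` H))).
  apply: variation_outer_le => //; first by move=> x [/GU].
  by move=> x Ax; split; [exact: AG|exact: AH].
apply: (le_trans (oG _ oGH _)); first by move=> x [/GU].
rewrite EFinD; apply: leeD; apply: ltW.
  by apply: (le_lt_trans _ Ga); apply: le_variation => x [].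
by apply: (le_lt_trans _ Hb); apply: le_variation => x [].
Qed.

Lemma delta_norm_sum_le V W Z A :
  (forall G, open G -> G `<=` U -> (variation V G + variation W G <= variation Z G)%E) ->
  (delta_norm V A + delta_norm W A <= delta_norm Z A)%E.
Proof.
move=> oG; rewrite !delta_normE; apply: le_ereal_inf_tmp => _ [G [oG1 GU AG] <-].
by apply: (le_trans _ (oG G oG1 GU)); apply: leeD; exact: variation_outer_le.
Qed.

Lemma delta_norm_vsum V W Z A : vsum V W Z ->
  (delta_norm Z A <= delta_norm V A + delta_norm W A)%E.
Proof.
move=> VWZ; apply: delta_norm_le_sum => G oG GU.
apply: ge_ereal_sup => _ [g gT <-]; have [sg cg gG g1] := gT.
rewrite (first_variation_vsum sg cg _ VWZ); last exact: subset_trans GU.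
by rewrite EFinD leeD// le_variation_test.
Qed.

End variation_measure.

(** * The monotonicity estimate *)

Section inverse_power.
Context {R : realType} (m : nat).
Implicit Types (r s t : R).

(** The function [|y - x| ^- m] in terms of the squared distance. *)
Definition hpow t : R := t `^ (- (m%:R / 2)).

Lemma hpow_ge0 t : 0 <= hpow t.
Proof. exact: powR_ge0. Qed.

Lemma hpow_sqr r : 0 < r -> hpow (r ^+ 2) = r ^- m.
Proof.
move=> r0; rewrite /hpow powRN -(powR_mulrn 2 (ltW r0)) -powRrM.
by rewrite mulrCA divff ?mulr1 ?pnatr_eq0// powR_mulrn// ltW.
Qed.

Lemma le_hpow s t : 0 < s -> s <= t -> hpow t <= hpow s.
Proof.
move=> s0 st; have t0 := lt_le_trans s0 st.
rewrite /hpow !powRN lef_pV2 ?posrE ?powR_gt0//.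
by apply: ge0_ler_powR; rewrite ?nnegrE ?(ltW s0) ?(ltW t0) ?divr_ge0.
Qed.

Lemma hpow_derive t : 0 < t -> is_derive t 1 hpow (- (m%:R / 2) * (hpow t / t)).
Proof.
move=> t0; have := is_derive1_powR (- (m%:R / 2)) t0.
by rewrite powRD ?(gt_eqF t0) ?implybT// powR_inv1 ?ltW.
Qed.

(** The shift by [e] moves the singularity away from nonnegative arguments. The successive
    derivatives, with falling factorials as coefficients, are listed in the form that [Ck_comp]
    takes. *)
Lemma hpow_shift_family (e : R) : 0 < e -> exists phi : nat -> R -> R,
  phi 0%N = (fun t => hpow (t + e)) /\
  forall i t, - e < t -> is_derive t 1 (phi i) (phi i.+1 t).
Proof.
move=> e0; pose p := - (m%:R / 2) : R.
pose c i : R := \prod_(j < i) (p - j%:R).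
exists (fun i t => c i * (t + e) `^ (p - i%:R)); split.
  by apply/funext => t; rewrite /c big_ord0 mul1r subr0.
move=> i t te; have te0 : 0 < t + e by rewrite -ltrBlDr sub0r.
have d0 := is_derive1_powR (p - i%:R) te0.
have ds : is_derive t 1 (fun t => (t + e) `^ (p - i%:R)) ((p - i%:R) * (t + e) `^ (p - i%:R - 1)).
  have sh : is_derive t 1 (fun t : R => t + e) 1.
    have := @is_deriveD _ _ _ id (cst e) t 1 1 0 (is_derive_id _ _) (is_derive_cst _ _ _).
    by rewrite addr0.
  apply: DeriveDef.
    apply/derivable1_diffP; apply: (@differentiable_comp _ _ _ _ (fun t : R => t + e)
      (fun s : R => s `^ (p - i%:R))).
      by apply/derivable1_diffP; have [] := sh.
    by apply/derivable1_diffP; have [] := d0.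
  have [h1 h2] := sh; have [h3 h4] := d0.
  rewrite -derive1E (@derive1_comp _ (fun t : R => t + e) (fun s : R => s `^ (p - i%:R)))//.
  by rewrite !derive1E h2 h4 mulr1.
have := @is_deriveZ _ _ _ (fun t => (t + e) `^ (p - i%:R)) (c i) t 1 _ ds.
rewrite /c big_ord_recr/= scalerA.
rewrite (_ : p - i%:R - 1 = p - i.+1%:R)//.
by rewrite -addrA -opprD natr1.
Qed.

End inverse_power.

Section radial_fields.
Context {R : realType} {n : nat}.
Implicit Types (x y : 'rV[R]_n) (psi : 'rV[R]_n -> R).

Definition sqdist x y : R := dotp (y - x) (y - x).

Lemma sqdist_ge0 x y : 0 <= sqdist x y. Proof. exact: dotp_ge0. Qed.

Lemma sqdist_smooth x : scalar_smooth (sqdist x).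
Proof. exact: dotp_shift_smooth. Qed.

Lemma sqdist_derive x y i : 'D_(delta_mx 0 i) (sqdist x) y = 2 * (y - x) 0 i.
Proof.
have dc j : is_derive y (delta_mx 0 i : 'rV[R]_n) (fun y : 'rV[R]_n => (y - x) 0 j) ((i == j)%:R).
  apply: DeriveDef; first exact/diff_derivable/differentiable_coord_shift.
  by rewrite derive_coord_shift mxE eqxx/= eq_sym.
have -> : sqdist x = \sum_(j < n) (fun y : 'rV[R]_n => (y - x) 0 j * (y - x) 0 j).
  by apply/funext => z; rewrite fct_sumE.
rewrite derive_sum; last first.
  by move=> j; have [d _] := dc j; exact: derivableM.
rewrite (bigD1 i)//= big1 ?addr0 => [|j ji].
  have [d e] := dc i; rewrite deriveM// e eqxx.
  by transitivity ((y - x) 0 i * 1 + (y - x) 0 i * 1); [|ring].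
have [d e] := dc j; rewrite deriveM// e eq_sym (negbTE ji).
by rewrite !scaler0 addr0.
Qed.

Definition radial psi x : 'rV[R]_n -> 'rV[R]_n := fun y => psi y *: (y - x).

Lemma radial_smooth psi x : scalar_smooth psi -> smooth (radial psi x).
Proof.
move=> sp; apply/smooth_coordP => k i; under eq_fun do rewrite mxE.
by apply: CkM; [exact: sp|exact: Ck_coord].
Qed.

(** With [u = y - x] the Jacobian is [Psi] times the identity plus [2 Psi'] times the matrix of
    products [u_i u_j]. Its trace against the projection gives the dimension and the quadratic form
    of [u]. *)
Lemma divergence_radial (Psi : R -> R) dPsi x y (S : subspaces R n) :
  scalar_smooth (Psi \o sqdist x) ->
  is_derive (sqdist x y) 1 Psi dPsi ->
  divergence (radial (Psi \o sqdist x) x) (y, S) =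
  (\dim (S : {vspace 'rV[R]_n}))%:R * Psi (sqdist x y) +
  2 * dPsi * ((y - x) *m orth_proj S *m (y - x)^T) 0 0.
Proof.
move=> sP dP; rewrite divergenceE; last exact: radial_smooth.
set u := y - x.
have dE i j : 'D_(delta_mx 0 i) (fun z => radial (Psi \o sqdist x) x z 0 j) y =
    Psi (sqdist x y) * (i == j)%:R + u 0 j * (2 * dPsi * u 0 i).
  have -> : (fun z => radial (Psi \o sqdist x) x z 0 j) =
      (Psi \o sqdist x) * (fun z : 'rV[R]_n => (z - x) 0 j).
    by apply/funext => z; rewrite mxE.
  have d1 : differentiable (Psi \o sqdist x) y by exact: (Ck_diff y (sP 0%N)).
  have d2 : differentiable (fun z : 'rV[R]_n => (z - x) 0 j) y.
    exact: differentiable_coord_shift.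
  rewrite deriveM; [|exact: diff_derivable|exact: diff_derivable].
  congr (_ + _).
    by congr (_ *: _); rewrite derive_coord_shift mxE eqxx/= eq_sym.
  congr (_ *: _); have ds : differentiable (sqdist x) y.
    exact: (Ck_diff y (sqdist_smooth x 0%N)).
  have dPd : differentiable Psi (sqdist x y).
    by apply/derivable1_diffP; have [] := dP.
  rewrite deriveE// (@diff_comp _ _ _ _ (sqdist x) Psi)//=.
  have [dj vj] := dP.
  have /= e := (congr1 (fun h : R -> R => h ('d (sqdist x) y (delta_mx 0 i))) (deriv1E dj)).
  rewrite e /= -deriveE// sqdist_derive derive1E vj.
  by rewrite [_ *: _]mulrC mulrCA mulrA.
under eq_bigr do under eq_bigr do rewrite dE mulrDl.
under eq_bigr do rewrite big_split/=.
rewrite big_split/=; congr (_ + _).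
  rewrite -orth_proj_trace mulrC mulr_sumr; apply: eq_bigr => i _.
  rewrite (bigD1 i)//= eqxx mulr1 big1 ?addr0// => j ji.
  by rewrite eq_sym (negbTE ji) mulr0 mul0r.
rewrite mxE mulr_sumr; apply: eq_bigr => i _.
have -> : (u *m orth_proj S) 0 i = \sum_j u 0 j * orth_proj S j i by rewrite mxE.
have -> : u^T i 0 = u 0 i by rewrite mxE.
by rewrite mulr_suml mulr_sumr; apply: eq_bigr => j _; ring.
Qed.

End radial_fields.

Section cutoff_kernel.
Context {R : realType} (m : nat).
Implicit Types (a e s t : R).

Lemma cutoff_derive_lt t : t < 4^-1 -> cutoff^`()%classic t = 0.
Proof.
move=> t4; rewrite derive1E (@near_eq_derive _ _ _ _ (cst 1 : R -> R)) ?derive_cst//.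
by near=> s; rewrite cutoff1// ltW//; near: s; exact: lt_nbhsl.
Unshelve. all: by end_near. Qed.

Lemma cutoff_derive_gt t : 2^-1 < t -> cutoff^`()%classic t = 0.
Proof.
move=> t2; rewrite derive1E (@near_eq_derive _ _ _ _ (cst 0)) ?derive_cst//.
by near=> s; rewrite cutoff0// ltW//; near: s; exact: lt_nbhsr.
Unshelve. all: by end_near. Qed.

(** The kernel [|y - x| ^- m] with [t] the squared distance, truncated at radius about [a ^- (1/2)]
    and regularized at scale [e ^ (1/2)]. *)
Definition kern a e t : R := cutoff (t * a) * hpow m (t + e).

Lemma kern_smooth n (x : 'rV[R]_n) a e : 0 < e -> scalar_smooth (kern a e \o sqdist x).
Proof.
move=> e0 k; apply: CkM; first exact: cutoff_dotp_smooth.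
have [phi [phi0 dphi]] := hpow_shift_family m e0.
have := @Ck_comp _ _ k phi [set t | - e < t] (sqdist x) 0%N dphi.
rewrite phi0; apply; last exact: sqdist_smooth.
by move=> y /=; rewrite (lt_le_trans _ (sqdist_ge0 _ _))// oppr_lt0.
Qed.

Lemma kern_derive a e t : 0 < e -> 0 <= t -> is_derive t 1 (kern a e)
  (cutoff^`()%classic (t * a) * a * hpow m (t + e) +
   cutoff (t * a) * (- (m%:R / 2) * (hpow m (t + e) / (t + e)))).
Proof.
move=> e0 t0; have te : 0 < t + e by rewrite ltr_wpDl.
have d1 : is_derive t 1 (fun t : R => t * a) a.
  have /= := @is_deriveM _ _ id (cst a) t 1 1 0 (is_derive_id _ _) (is_derive_cst _ _ _).
  by rewrite scaler0 add0r [_ *: _]mulr1.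
have d2 : is_derive t 1 (fun t : R => t + e) 1.
  have := @is_deriveD _ _ _ id (cst e) t 1 1 0 (is_derive_id _ _) (is_derive_cst _ _ _).
  by rewrite addr0.
have chain (f g : R -> R) df dg : is_derive t 1 f df -> is_derive (f t) 1 g dg ->
    is_derive t 1 (fun s => g (f s)) (df * dg).
  move=> [h1 h2] [h3 h4]; apply: DeriveDef.
    apply/derivable1_diffP; apply: (@differentiable_comp _ _ _ _ f g).
      exact/derivable1_diffP.
    exact/derivable1_diffP.
  by rewrite -derive1E (@derive1_comp _ f g)// !derive1E h2 h4 mulrC.
have c1 := chain _ _ _ _ d1 (cutoff_derive (t * a)).
have c2 := chain _ _ _ _ d2 (hpow_derive m te).
have := is_deriveM c1 c2.
rewrite (_ : cutoff (t * a) *: _ + _ = cutoff^`()%classic (t * a) * a * hpow m (t + e) +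
   cutoff (t * a) * (- (m%:R / 2) * (hpow m (t + e) / (t + e))))//.
rewrite addrC; congr (_ + _); first by rewrite [LHS]mulrC (mulrC a).
by rewrite mul1r.
Qed.

Variable C : R.
Hypothesis C_gt0 : 0 < C.
Hypothesis cutoff_C : forall t, 0 <= t -> `|cutoff^`()%classic t| <= C.

(** Let [s] and [q <= s] be the squared lengths of [y - x] and of its projection, [h] the shifted
    power. The undifferentiated cutoff contributes at least [m h e^2 / (s + e^2)] near [x], which
    for [s <= e^2] is at least [m/2] times [(2 e) ^- m]. The derivative of the cutoff lives between
    [rho / 2] and [rho / sqrt 2], where [h <= (rho / 2) ^- m]; this is the negative term. *)
Lemma kern_divergence_ge n (x y : 'rV[R]_n) (S : subspaces R n) (rho e : R) :
  grassmann m S -> 0 < e -> e < rho / 2 ->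
  m%:R / 2 * 2 ^- m * e ^- m * \1_(ecball x e) y -
    C * 2 ^+ m * rho ^- m * \1_(ecball x rho) y <=
  divergence (radial (kern (rho ^+ 2)^-1 (e ^+ 2) \o sqdist x) x) (y, S).
Proof.
move=> GS e0 er; have rho0 : 0 < rho by rewrite -(@pmulr_lgt0 _ 2^-1) ?invr_gt0// (lt_trans e0).
have e20 : 0 < e ^+ 2 by rewrite exprn_gt0.
have r20 : 0 < rho ^+ 2 by rewrite exprn_gt0.
have e2r : e ^+ 2 < rho ^+ 2 / 4.
  by have := er; rewrite -subr_gt0 => h; nra.
rewrite (divergence_radial _ (kern_smooth _ _ e20) (kern_derive _ e20 (sqdist_ge0 _ _))).
rewrite (_ : \dim _ = m)//.
have q0 := orth_proj_dotp_ge0 S (y - x); have qs := orth_proj_dotp_le S (y - x).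
have inE1 (r : R) : 0 <= r -> \1_(ecball x r) y = ((sqdist x y <= r ^+ 2)%R)%:R :> R.
  by move=> r0; rewrite indicE mem_setE /= -enorm_le.
rewrite (inE1 _ (ltW e0)) (inE1 _ (ltW rho0)).
have s0 := sqdist_ge0 x y; rewrite -/(sqdist x y) in qs.
move: (sqdist x y) (_ 0 0) s0 q0 qs => s q s0 q0 qs.
rewrite /kern; set h := hpow m (s + e ^+ 2).
have h0 : 0 <= h by exact: hpow_ge0.
have se0 : 0 < s + e ^+ 2 by rewrite ltr_wpDl.
have [chi chiE] : {chi : R | chi = cutoff (s * (rho ^+ 2)^-1)} by eexists.
have [d dE] : {d : R | d = cutoff^`()%classic (s * (rho ^+ 2)^-1)} by eexists.
rewrite -chiE -dE.
have chi0 : 0 <= chi by rewrite chiE; exact: cutoff_ge0.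
have main : m%:R * chi * h * (e ^+ 2 / (s + e ^+ 2)) + 2 * d * (s * (rho ^+ 2)^-1) * h * (q / s) <=
   m%:R * (chi * h) + 2 * (d / rho ^+ 2 * h + chi * (- (m%:R / 2) * (h / (s + e ^+ 2)))) * q.
  have -> : m%:R * (chi * h) + 2 * (d / rho ^+ 2 * h + chi * (- (m%:R / 2) * (h / (s + e ^+ 2)))) * q
     = m%:R * chi * h * (1 - q / (s + e ^+ 2)) + 2 * d * (q / rho ^+ 2) * h.
    by field; rewrite gt_eqF//= gt_eqF.
  apply: lerD.
    apply: ler_wpM2l; first by rewrite !mulr_ge0.
    rewrite ler_pdivrMr// mulrBl mul1r divfK ?gt_eqF//; lra.
  (* The division by [s] is harmless, since [s = 0] forces [q = 0]. *)
  have [s00|sn0] := eqVneq s 0.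
    have -> : q = 0 by apply/eqP; rewrite eq_le q0 -s00 qs.
    by rewrite !(mul0r, mulr0).
  by rewrite le_eqVlt; apply/orP; left; apply/eqP; field; rewrite sn0 gt_eqF.
apply: le_trans main.
have qs1 : 0 <= q / s <= 1.
  have [->|sn0] := eqVneq s 0; first by rewrite invr0 mulr0 lexx ler01.
  have sp : 0 < s by rewrite lt_def sn0.
  by rewrite divr_ge0//= ler_pdivrMr// mul1r.
have cem : 0 <= m%:R / 2 * 2 ^- m * e ^- m.
  by rewrite !mulr_ge0 ?invr_ge0 ?exprn_ge0// ltW.
have crm : 0 <= C * 2 ^+ m * rho ^- m.
  by rewrite !mulr_ge0 ?invr_ge0 ?exprn_ge0// ltW.
have [lt4|ge4] := ltP (s * (rho ^+ 2)^-1) 4^-1.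
  rewrite dE cutoff_derive_lt// chiE cutoff1; last exact: ltW.
  rewrite mulr0 !mul0r addr0 mulr1.
  apply: (@le_trans _ _ (m%:R / 2 * 2 ^- m * e ^- m * ((s <= e ^+ 2)%R)%:R)).
    by rewrite gerBl mulr_ge0.
  have [se|_] := leP s (e ^+ 2); last first.
    by rewrite mulr0 !mulr_ge0 ?invr_ge0// ltW.
  rewrite mulr1 -!mulrA ler_wpM2l//.
  have hle : (2 * e) ^- m <= h.
    rewrite -(hpow_sqr m (_ : 0 < 2 * e)) ?mulr_gt0//; apply: le_hpow => //.
    by rewrite exprMn; lra.
  have frac : 2^-1 <= e ^+ 2 / (s + e ^+ 2).
    by rewrite ler_pdivlMr// ; lra.
  have -> : 2 ^- m * e ^- m = (2 * e) ^- m :> R by rewrite exprMn invfM.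
  rewrite mulrC; apply: ler_pM => //.
    by rewrite invr_ge0 exprn_ge0// mulr_ge0// ltW.
  by rewrite mulrA -expr2.
have nse : (s <= e ^+ 2) = false.
  apply/negbTE; rewrite -ltNge (lt_le_trans e2r)//.
  by move: ge4; rewrite ler_pdivlMr//; lra.
rewrite nse mulr0 sub0r.
have p1 : 0 <= m%:R * chi * h * (e ^+ 2 / (s + e ^+ 2)).
  by rewrite !mulr_ge0 ?invr_ge0// ltW.
have [gt2|le2] := ltP 2^-1 (s * (rho ^+ 2)^-1).
  rewrite dE cutoff_derive_gt// mulr0 !mul0r addr0 (le_trans _ p1)// oppr_le0.
  by rewrite mulr_ge0.
have srho : (s <= rho ^+ 2).
  move: le2; rewrite ler_pdivrMr//; lra.
rewrite srho mulr1.
apply: (@le_trans _ _ (2 * d * (s * (rho ^+ 2)^-1) * h * (q / s))); last by rewrite lerDr.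
have hr : h <= (2 ^+ m * rho ^- m).
  have -> : 2 ^+ m * rho ^- m = (rho / 2) ^- m by rewrite exprMn invfM exprVn invrK mulrC.
  rewrite -(hpow_sqr m (_ : 0 < rho / 2)) ?divr_gt0//; apply: le_hpow.
    by rewrite exprn_gt0 ?divr_gt0.
  rewrite exprMn exprVn -natrX; move: ge4; rewrite ler_pdivlMr//.
  by have := e20; lra.
have sa0 : 0 <= s * (rho ^+ 2)^-1 by rewrite mulr_ge0// invr_ge0 ltW.
have dC : `|d| <= C by rewrite dE; exact: cutoff_C.
have [q1 q2] := andP qs1.
apply: (@le_trans _ _ (- (C * h))).
  by rewrite lerN2 -mulrA ler_wpM2l// ltW.
have -> : 2 * d * (s * (rho ^+ 2)^-1) * h * (q / s) =
  d * (2 * (s * (rho ^+ 2)^-1) * (q / s)) * h by ring.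
have w0 : 0 <= 2 * (s * (rho ^+ 2)^-1) * (q / s).
  by apply: mulr_ge0 => //; exact: mulr_ge0.
have w1 : 2 * (s * (rho ^+ 2)^-1) * (q / s) <= 1.
  by apply: mulr_ile1 => //; [exact: mulr_ge0|lra].
move: (2 * (s * (rho ^+ 2)^-1) * (q / s)) w0 w1 => w w0 w1.
rewrite -mulNr ler_wpM2r//.
have : `|d * w| <= C.
  by rewrite normrM (ger0_norm w0) (le_trans _ dC)// ler_piMr.
by rewrite ler_norml => /andP[].
Qed.

End cutoff_kernel.

Section first_variation_bounds.
Context {R : realType} {n m : nat} {U : set 'rV[R]_n}.
Hypothesis oU : open U.
Local Notation bundle := ('rV[R]_n * subspaces R n)%type.
Implicit Types (W : varifold m U) (g : 'rV[R]_n -> 'rV[R]_n) (G : set 'rV[R]_n).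

Lemma smooth_const_scale c g : smooth g -> smooth (fun x => c *: g x).
Proof. by apply: smooth_scale => k; exact: Ck_cst. Qed.

Lemma divergenceZ c g z : smooth g -> divergence (fun x => c *: g x) z = c * divergence g z.
Proof.
move=> sg; rewrite !divergenceE//; last exact: smooth_const_scale.
rewrite mulr_sumr; apply: eq_bigr => i _.
rewrite mulr_sumr; apply: eq_bigr => j _; rewrite mulrA; congr (_ * _).
have -> : (fun y => (c *: g y) 0 j) = c *: (fun y => g y 0 j).
  by apply/funext => y; rewrite mxE.
rewrite deriveZ//; apply: diff_derivable; apply: (@Ck_diff _ _ _ 0%N).
exact: smooth_coord.
Qed.

Lemma first_variationZ W c g : smooth g -> compact (spt g) -> spt g `<=` U ->
  first_variation W (fun x => c *: g x) = c * first_variation W g.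
Proof.
move=> sg cg gU; have Kg := @divergenceK_Kspace R n m U g sg cg gU.
have e := vfunZ oU W c Kg; rewrite first_variationE first_variationE.
rewrite (_ : divergenceK m (fun x => c *: g x) = fun z => c * divergenceK m g z)//.
by apply/funext => z; rewrite /divergenceK divergenceZ// mulrCA.
Qed.

Lemma first_variation_bound W G g (L : set 'rV[R]_n) B N : open G -> G `<=` U ->
  smooth g -> compact L -> L `<=` G -> (forall x, ~ L x -> g x = 0) -> 0 < B ->
  (forall x, enorm (g x) <= B) ->
  (delta_norm W G <= N%:E)%E -> first_variation W g <= B * N.
Proof.
move=> oG GU sg cL LG L0 B0 gB WN.
have cg : compact (spt g).
  apply: (sub_compact_rV cL); first exact: closed_closure.
  by apply: spt_sub => //; exact: closed_compact_rV.
have gG : spt g `<=` G.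
  by apply: subset_trans LG; apply: spt_sub => //; exact: closed_compact_rV.
have tg : test_field G (fun x => B^-1 *: g x).
  have sL : spt (fun x => B^-1 *: g x) `<=` L.
    by apply: spt_sub => [|x /L0 ->]; [exact: closed_compact_rV|rewrite scaler0].
  split.
  - exact: smooth_const_scale.
  - by apply: (sub_compact_rV cL) => //; exact: closed_closure.
  - exact: subset_trans LG.
  - by move=> x; rewrite enormZ ger0_norm ?invr_ge0 ?(ltW B0)// ler_pdivrMl// mulr1.
have le1 := le_trans (delta_norm_ge_test oU W oG GU tg) WN.
have e := @first_variationZ W B^-1 g sg cg (subset_trans gG GU).
move: le1; rewrite e lee_fin => le1.
by rewrite -ler_pdivrMl.
Qed.

Definition mass W (B : set 'rV[R]_n) : R := fine (weight W B).

Lemma weight_compact W (K : set 'rV[R]_n) : compact K -> K `<=` U ->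
  (weight W K < +oo)%E.
Proof.
move=> cK KU; have rW := vradon W.
apply: (@le_lt_trans _ _ (W (K `*` grassmann m))).
  by apply: (radon_le rW) => z [[Kz _] [_ gz]].
by apply: (vfinite W); [exact: setX_grassmann_compact|move=> z [/KU]].
Qed.

Lemma weight_ge0 W A : (0 <= weight W A)%E.
Proof. exact: (radon_ge0 _ (vradon W)). Qed.

Lemma weight_measurable A : closed A -> measurable (A `*` setT : set (borel bundle)).
Proof.
move=> cA; apply: measurable_closed.
rewrite (_ : A `*` setT = fst @^-1` A); last by apply/seteqP; split => z //= [].
by apply: closed_comp => // z _; exact: cvg_fst.
Qed.

Lemma indic_integrable W A c : closed A -> (weight W A < +oo)%E ->
  W.-integrable (UG m U : set (borel bundle)) (fun z => (c * \1_(A `*` setT) z)%:E) /\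
  Rintegral W (UG m U) (fun z => c * \1_(A `*` setT) z) = c * mass W A.
Proof.
move=> cA WA; have mA := weight_measurable cA.
have mO : measurable (UG m U : set (borel bundle)).
  by apply: measurable_open; exact: UG_open.
have WAO : W ((A `*` setT) `&` UG m U) = weight W A.
  have rW := vradon W.
  by apply/eqP; rewrite eq_le; apply/andP; split; apply: (radon_le rW) => z [] // [].
have i1 : W.-integrable (UG m U : set (borel bundle)) (EFin \o \1_(A `*` setT)).
  apply/integrableP; split.
    by apply/measurable_EFinP; exact: measurable_indic.
  under eq_integral do rewrite /= ger0_norm//.
  by rewrite integral_indic// WAO.
split.
  have := @integrableZl _ _ _ W _ mO c _ i1.
  by apply: eq_integrable => // z _ /=; rewrite EFinM.
rewrite RintegralZl//; congr (_ * _).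
by rewrite /Rintegral /= integral_indic// WAO.
Qed.

End first_variation_bounds.

Lemma mul_exprVn (F : fieldType) (a t : F) k : a ^+ k * t ^- k = (t / a) ^- k.
Proof. by rewrite exprMn invfM exprVn invrK mulrC. Qed.

Section monotonicity.
Context {R : realType} {n m : nat} {U : set 'rV[R]_n}.
Hypotheses (oU : open U) (m0 : (0 < m)%N).
Variable C : R.
Hypothesis C_gt0 : 0 < C.
Hypothesis cutoff_C : forall t, 0 <= t -> `|cutoff^`()%classic t| <= C.
Variables (W : varifold m U) (x : 'rV[R]_n) (rho : R) (J : nat) (N : nat -> R).
Hypotheses (rho0 : 0 < rho) (J2 : (2 <= J)%N) (BU : ecball x rho `<=` U).
Let r j : R := rho / 2 ^+ j.
Hypothesis WN : forall j, (delta_norm W (eball x (r j)) <= (N j)%:E)%E.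
Let e := r J.
(* The difference of two consecutive fields is supported in the ball of radius
   [r j] and of size at most [4 ^+ m * r j ^+ (1 - m)], so that only the variation
   at the dyadic scale [r j] enters its first variation. *)
Let field j := radial (kern m (r j ^+ 2)^-1 (e ^+ 2) \o sqdist x) x.

Let r0 j : 0 < r j. Proof. by rewrite divr_gt0// exprn_gt0. Qed.

Let rS j : r j.+1 = r j / 2.
Proof. by rewrite /r exprSr invfM mulrA. Qed.

Let r_le j : r j <= rho.
Proof. by rewrite ler_pdivrMr ?exprn_gt0// ler_peMr ?(ltW rho0)// exprn_ege1// ler1n. Qed.

Let e_lt : e < rho / 2.
Proof.
rewrite /e /r ltr_pM2l// ltf_pV2 ?posrE ?exprn_gt0//.
by rewrite -[ltLHS]expr1 ltr_eXn2l// ltr1n.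
Qed.

Let e20 : 0 < e ^+ 2. Proof. by rewrite /e exprn_gt0. Qed.

Let kern_out s j : 2^-1 <= s * (r j ^+ 2)^-1 -> kern m (r j ^+ 2)^-1 (e ^+ 2) s = 0.
Proof. by move=> ?; rewrite /kern cutoff0// mul0r. Qed.

Let out_ball j y : ~ ecball x (3 / 4 * r j) y -> 2^-1 <= sqdist x y * (r j ^+ 2)^-1.
Proof.
have r34 : 0 <= 3 / 4 * r j by rewrite mulr_ge0 ?(ltW (r0 j)).
move=> /negP; rewrite -ltNge ltNge enorm_le// -ltNge => wr.
rewrite ler_pdivlMr ?exprn_gt0// (le_trans _ (ltW wr))//.
by have : 0 < r j ^+ 2; [rewrite exprn_gt0|nra].
Qed.

Let sub_eball j : ecball x (3 / 4 * r j) `<=` eball x (r j).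
Proof.
move=> y yr; rewrite /eball/= (le_lt_trans yr)//.
by rewrite gtr_pMl// ltr_pdivrMr// mul1r ltr_nat.
Qed.

Let eballU j : eball x (r j) `<=` U.
Proof. by move=> y yr; apply: BU; rewrite /ecball/= (le_trans (ltW yr)). Qed.

Let field_smooth j : smooth (field j).
Proof. by apply: radial_smooth; exact: kern_smooth. Qed.

Let field_out j y : ~ ecball x (3 / 4 * r j) y -> field j y = 0.
Proof. by move=> /out_ball ny; rewrite /field /radial /= kern_out// scale0r. Qed.

Let field_spt j : compact (spt (field j)) /\ spt (field j) `<=` U.
Proof.
have sL : spt (field j) `<=` ecball x (3 / 4 * r j).
  by apply: spt_sub; [exact: ecball_closed|exact: field_out].
split.
  apply: (sub_compact_rV (@ecball_compact _ _ x (3 / 4 * r j))) => //.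
  exact: closed_closure.
by apply: (subset_trans sL) => y /sub_eball /eballU.
Qed.

Let shell j y := field j y - field j.+1 y.

Let shellE j y : shell j y = ((cutoff (sqdist x y * (r j ^+ 2)^-1) -
  cutoff (sqdist x y * (r j.+1 ^+ 2)^-1)) * hpow m (sqdist x y + e ^+ 2)) *: (y - x).
Proof. by rewrite /shell /field /radial /kern/= -scalerBl -mulrBl. Qed.

Let enorm_sqdist y t : 0 <= t -> (enorm (y - x) <= t) = (sqdist x y <= t ^+ 2).
Proof. exact: enorm_le. Qed.

(** Within [r j / 4] both cutoffs are 1, beyond [r j / sqrt 2] both are 0. In between the kernel is
    at most [(r j / 4) ^- m] and the distance to [x] at most [r j]. *)
Let shell_bound j y : enorm (shell j y) <= 4 ^+ m * (r j * r j ^- m).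
Proof.
have B0 : 0 <= 4 ^+ m * (r j * r j ^- m).
  have rj0 := ltW (r0 j).
  by apply: mulr_ge0; [exact: exprn_ge0|rewrite mulr_ge0// invr_ge0 exprn_ge0].
have rj2 : 0 < r j ^+ 2 by rewrite exprn_gt0.
have [lo|hi] := leP (sqdist x y) ((r j / 4) ^+ 2).
  have c1 : sqdist x y * (r j ^+ 2)^-1 <= 4^-1.
    by rewrite ler_pdivrMr// (le_trans lo)//; nra.
  have c2 : sqdist x y * (r j.+1 ^+ 2)^-1 <= 4^-1.
    by rewrite ler_pdivrMr ?exprn_gt0// (le_trans lo)// rS; nra.
  by rewrite shellE !cutoff1// subrr mul0r scale0r enorm0.
have [far|near] := leP (2^-1) (sqdist x y * (r j ^+ 2)^-1).
  have far2 : 2^-1 <= sqdist x y * (r j.+1 ^+ 2)^-1.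
    apply: (le_trans far); rewrite ler_wpM2l ?sqdist_ge0//.
    rewrite lef_pV2 ?posrE ?exprn_gt0// rS exprMn ler_piMr// ?(ltW rj2)//; lra.
  by rewrite shellE !cutoff0// subrr mul0r scale0r enorm0.
rewrite shellE enormZ normrM (ger0_norm (hpow_ge0 _ _)).
have ny : enorm (y - x) <= r j.
  rewrite enorm_sqdist ?(ltW (r0 j))//; move: near; rewrite ltr_pdivrMr// => near.
  by rewrite (le_trans (ltW near))// ler_piMl ?(ltW rj2)//; lra.
have hy : hpow m (sqdist x y + e ^+ 2) <= 4 ^+ m * r j ^- m.
  rewrite mul_exprVn.
  rewrite -(hpow_sqr m (_ : 0 < r j / 4)) ?divr_gt0//; apply: le_hpow.
    by rewrite exprn_gt0 ?divr_gt0.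
  by rewrite (le_trans (ltW hi))// lerDl ltW.
have d1 : `|cutoff (sqdist x y * (r j ^+ 2)^-1) - cutoff (sqdist x y * (r j.+1 ^+ 2)^-1)| <= 1.
  rewrite ler_norml; apply/andP; split.
    by rewrite lerBrDl (le_trans _ (cutoff_ge0 _))// subr_le0 cutoff_le1.
  by rewrite lerBlDl (le_trans (cutoff_le1 _))// lerDr cutoff_ge0.
apply: (@le_trans _ _ ((1 * (4 ^+ m * r j ^- m)) * r j)); last first.
  by rewrite mul1r mulrAC -mulrA.
apply: ler_pM => //; [|exact: enorm_ge0|].
  by rewrite mulr_ge0// hpow_ge0.
by apply: ler_pM => //; exact: hpow_ge0.
Qed.

Let shell_smooth j : smooth (shell j).
Proof.
apply/smooth_coordP => k i; under eq_fun do rewrite mxE [X in _ + X]mxE.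
by apply: CkB; exact: smooth_coord.
Qed.

Let shell_out j y : ~ ecball x (3 / 4 * r j) y -> shell j y = 0.
Proof.
move=> ny; rewrite /shell field_out// field_out ?subrr// => ny'; apply: ny.
rewrite /ecball/= (le_trans ny')// ler_wpM2l//.
by rewrite rS ler_pdivrMr// ler_peMr ?(ltW (r0 _))// ler1n.
Qed.

Let shell_first_variation j :
  first_variation W (shell j) <= 4 ^+ m * (r j * r j ^- m) * N j.
Proof.
have rj0 := ltW (r0 j).
apply: (@first_variation_bound _ _ _ _ oU W (eball x (r j)) _ (ecball x (3 / 4 * r j))) => //.
- exact: eball_open.
- exact: ecball_compact.
- exact: shell_out.
- apply: mulr_gt0; first exact: exprn_gt0.
  by apply: mulr_gt0 => //; rewrite invr_gt0 exprn_gt0.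
Qed.

(** At the last scale the regularization by [e ^+ 2] bounds the kernel by [e ^- m]; the factor
    [4 ^+ m] only gives this term the shape of the others. *)
Let last_first_variation :
  first_variation W (field J) <= 4 ^+ m * (r J * r J ^- m) * N J.
Proof.
have rj0 := ltW (r0 J).
apply: (@first_variation_bound _ _ _ _ oU W (eball x (r J)) _ (ecball x (3 / 4 * r J))) => //.
- exact: eball_open.
- exact: ecball_compact.
- exact: field_out.
- apply: mulr_gt0; first exact: exprn_gt0.
  by apply: mulr_gt0 => //; rewrite invr_gt0 exprn_gt0.
move=> y; have [yb|/field_out ->] := pselect (ecball x (3 / 4 * r J) y); last first.
  rewrite enorm0; apply: mulr_ge0; first exact: exprn_ge0.
  by apply: mulr_ge0 => //; rewrite invr_ge0 exprn_ge0.
rewrite enormZ /= /kern normrM (ger0_norm (hpow_ge0 _ _)) (ger0_norm (cutoff_ge0 _)).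
apply: (@le_trans _ _ ((1 * r J ^- m) * r J)); last first.
  rewrite mul1r mulrC ler_peMl ?exprn_ege1 ?ler1n//.
  by apply: mulr_ge0 => //; rewrite invr_ge0 exprn_ge0.
apply: ler_pM => //; [|exact: enorm_ge0| |].
- by rewrite mulr_ge0 ?hpow_ge0 ?cutoff_ge0.
- apply: ler_pM; [exact: cutoff_ge0|exact: hpow_ge0|exact: cutoff_le1|].
  by rewrite -(hpow_sqr m (r0 J)) le_hpow// lerDr sqdist_ge0.
- by rewrite (le_trans yb)// ler_piMl// ler_pdivrMr// mul1r ler_nat.
Qed.

(** Telescoping: each field is a shell plus the field at the next smaller scale. *)
Let field_first_variation i : (i <= J)%N -> first_variation W (field (J - i)%N) <=
  \sum_(J - i <= j < J.+1) 4 ^+ m * (r j * r j ^- m) * N j.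
Proof.
elim: i => [|i IH] iJ; first by rewrite subn0 big_nat1; exact: last_first_variation.
have [cf fU] := field_spt (J - i.+1); have [cg gU] := field_spt (J - i).
have eS : (J - i.+1).+1 = (J - i)%N by rewrite subnSK.
have sL : spt (shell (J - i.+1)) `<=` ecball x (3 / 4 * r (J - i.+1)).
  by apply: spt_sub; [exact: ecball_closed|exact: shell_out].
have cS : compact (spt (shell (J - i.+1))).
  apply: (sub_compact_rV (@ecball_compact _ _ x (3 / 4 * r (J - i.+1)))) => //.
  exact: closed_closure.
have SU : spt (shell (J - i.+1)) `<=` U by apply: (subset_trans sL) => y /sub_eball /eballU.
have fE : field (J - i.+1) = (fun y => shell (J - i.+1) y + field (J - i) y).
  by apply/funext => y; rewrite /shell eS subrK.
have dE := first_variationD oU W (@shell_smooth _) cS SU (field_smooth (J - i)) cg gU.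
rewrite fE dE big_ltn; last by rewrite ltnS leq_subr.
by apply: lerD; [exact: shell_first_variation|rewrite eS; apply: IH; exact: ltnW].
Qed.

(** The first variation of [field 0] is bounded below by integrating [kern_divergence_ge] against
    [W], and above by the sum over the shells. If [N j] is of order [r j ^+ m], that sum is
    geometric and the bound is independent of [J]. *)
Lemma monotonicity_estimate :
  m%:R / 2 * 2 ^- m * e ^- m * mass W (ecball x e) <=
  C * 2 ^+ m * rho ^- m * mass W (ecball x rho) +
  \sum_(0 <= j < J.+1) 4 ^+ m * (r j * r j ^- m) * N j.
Proof.
have := field_first_variation (leqnn J); rewrite subnn => up.
rewrite -lerBlDl; apply: le_trans up.
have r00 : r 0 = rho by rewrite /r expr0 divr1.
have [c0 U0] := field_spt 0.
have wB t : t <= rho -> (weight W (ecball x t) < +oo)%E.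
  move=> tr; apply: weight_compact; first exact: ecball_compact.
  by move=> y yt; apply: BU; exact: le_trans tr.
have [i1 I1] := indic_integrable oU (m%:R / 2 * 2 ^- m * e ^- m)
  (@ecball_closed _ _ x e) (wB _ (r_le J)).
have [i2 I2] := indic_integrable oU (C * 2 ^+ m * rho ^- m)
  (@ecball_closed _ _ x rho) (wB _ (lexx rho)).
have mO : measurable (UG m U : set (borel ('rV[R]_n * subspaces R n)%type)).
  by apply: measurable_open; exact: UG_open.
rewrite -I1 -I2 -(RintegralB mO i1 i2) first_variationE.
apply: le_Rintegral => //.
- exact: (integrableB mO i1 i2).
- apply: (Kspace_integrable (@bundle_hausdorff R n) (UG_open oU) (@vfinite _ _ _ _ W)).
  exact: divergenceK_Kspace.
move=> [y S] [Uy GS]; rewrite /divergenceK grassmann_indic1// mul1r.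
have ind t : \1_(ecball x t `*` setT) (y, S) = \1_(ecball x t) y :> R.
  rewrite !indicE; congr (_ %:R); congr (nat_of_bool _).
  by apply/idP/idP => /set_mem; [case=> /mem_set|move=> yt; apply/mem_set].
rewrite !ind /field r00.
exact: (@kern_divergence_ge _ _ _ C_gt0 cutoff_C _ x y S rho e GS (r0 J) e_lt).
Qed.

End monotonicity.

(** * Points where the variation is controlled *)

Section covering.
Context {R : realType} {n : nat}.
Implicit Types (x y : 'rV[R]_n) (r : 'rV[R]_n -> R) (s : seq 'rV[R]_n).

Definition disjoint_balls r s := pairwise (fun x y => `[< eball x (r x) `&` eball y (r y) = set0 >]) s.

Lemma seq_maximal (T : eqType) (r : T -> R) a (s : seq T) :
  exists2 p, p \in a :: s & forall q, q \in a :: s -> r q <= r p.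
Proof.
elim: s a => [|b s IH] a.
  by exists a; rewrite ?mem_head// => q; rewrite inE => /eqP ->.
have [p ps pmax] := IH b.
have [rap|rpa] := leP (r a) (r p).
  exists p; first by rewrite inE ps orbT.
  by move=> q; rewrite inE => /orP[/eqP ->//|]; exact: pmax.
exists a; first exact: mem_head.
by move=> q; rewrite inE => /orP[/eqP ->//|/pmax /le_trans]; apply; exact: ltW.
Qed.

(** A ball of largest radius is chosen, the balls meeting it are dropped, and the procedure is
    repeated; a ball meeting a ball at least as large lies in the threefold enlargement of the
    latter. *)
Lemma finite_vitali r s : (forall x, x \in s -> 0 < r x) ->
  exists t, [/\ {subset t <= s}, disjoint_balls r t &
    forall y, (exists2 x, x \in s & eball x (r x) y) ->
      exists2 x, x \in t & ecball x (3 * r x) y].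
Proof.
move: {2}(size s) (leqnn (size s)) => k.
elim: k s => [|k IH] s sk r0.
  exists [::]; split => // y [x]; move: sk; rewrite leqn0 => /nilP ->.
  by rewrite in_nil.
case: s => [|a s'] in sk r0 *; first by exists [::]; split => // y [x]; rewrite in_nil.
set s := a :: s' in sk r0 *.
have [p ps pmax] := seq_maximal r a s'.
pose s1 := [seq q <- s | `[< eball p (r p) `&` eball q (r q) = set0 >]].
have p1 : p \notin s1.
  rewrite mem_filter negb_and; apply/orP; left; apply/asboolPn => e.
  have : (eball p (r p) `&` eball p (r p)) p.
    by rewrite setIid /eball/= subrr enorm0 r0.
  by rewrite e.
have [||t [ts td tc]] := IH s1.
- rewrite -ltnS; apply: leq_trans sk.
  rewrite -(count_predC (fun q => `[< eball p (r p) `&` eball q (r q) = set0 >]) s).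
  rewrite /s1 size_filter -addn1 leq_add2l -has_count; apply/hasP; exists p => //.
  by move: p1; rewrite mem_filter ps andbT.
- by move=> x; rewrite mem_filter => /andP[_]; exact: r0.
exists (p :: t); split.
- by move=> q; rewrite inE => /orP[/eqP ->//|/ts]; rewrite mem_filter => /andP[].
- apply/andP; split=> //; apply/allP => q /ts.
  by rewrite mem_filter => /andP[].
- move=> y [q qs qy]; have [q1|q1] := boolP (q \in s1).
    have [x xt xy] := tc y (ex_intro2 _ _ q q1 qy).
    by exists x => //; rewrite inE xt orbT.
  exists p; first exact: mem_head.
  move: q1; rewrite mem_filter qs andbT => /asboolPn/eqP/set0P[z [pz qz]].
  have rqp := pmax _ qs.
  rewrite /ecball/= (le_trans (enorm_dist _ q _))//.
  have := enorm_dist q z p; rewrite (enormC q z) => h.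
  move: pz qz qy; rewrite /eball/= => pz qz qy.
  by lra.
Qed.

Lemma disjoint_balls_sum r s (mu : {measure set (borel 'rV[R]_n) -> \bar R}) :
  disjoint_balls r s ->
  (\sum_(x <- s) mu (eball x (r x)) = mu (\bigcup_(x in [set x | x \in s]) eball x (r x)))%E.
Proof.
elim: s => [|x s IH] /=.
  move=> _; rewrite big_nil (_ : \bigcup_(_ in _) _ = set0) ?measure0//.
  by apply/seteqP; split => y //= [z].
move=> /andP[/allP xd sd]; rewrite big_cons IH//.
have -> : \bigcup_(z in [set z | z \in x :: s]) eball z (r z) =
    eball x (r x) `|` \bigcup_(z in [set z | z \in s]) eball z (r z).
  apply/seteqP; split => y.
    by move=> [z /=]; rewrite inE => /orP[/eqP -> ?|zs zy]; [left|right; exists z].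
  by move=> [xy|[z /= zs zy]]; [exists x => //=; rewrite mem_head|exists z => //=; rewrite inE zs orbT].
rewrite measureU//.
- by apply: measurable_open; exact: eball_open.
- by apply: measurable_open; apply: bigcup_open => z _; exact: eball_open.
- apply/seteqP; split => y // [xy [z /= zs zy]].
  have /asboolP e := xd z zs.
  by have : (eball x (r x) `&` eball z (r z)) y by []; rewrite e.
Qed.

End covering.

Section growth.
Context {R : realType}.

Lemma sum_dyadic_le (rho : R) k : 0 <= rho -> \sum_(0 <= j < k) rho / 2 ^+ j <= 2 * rho.
Proof.
move=> rho0; suff : \sum_(0 <= j < k) rho / 2 ^+ j + 2 * (rho / 2 ^+ k) = 2 * rho.
  by move=> <-; rewrite lerDl mulr_ge0// divr_ge0// exprn_ge0.
elim: k => [|k IH]; first by rewrite big_geq// add0r expr0 divr1.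
rewrite big_nat_recr//= exprSr invfM -[RHS]IH -addrA; congr (_ + _).
by field; rewrite expf_neq0.
Qed.

(** The weights sum to at most [2 * rho], so by the smallness condition the sum contributes at most
    half of a bound for the earlier terms. The recursion starts at index 4, hence the first four
    values in the bound. *)
Lemma dyadic_gronwall (a : nat -> R) (B D rho : R) : (forall j, 0 <= a j) ->
  0 <= D -> 0 <= rho -> 4 * D * rho <= 1 ->
  (forall J, (2 <= J)%N -> a J.+2 <= B + D * \sum_(0 <= j < J.+1) (rho / 2 ^+ j) * a j) ->
  exists M, forall j, a j <= M.
Proof.
move=> a0 D0 rho0 small rec.
exists (a 0%N + a 1%N + a 2%N + a 3%N + 2 * `|B|) => j.
set M := (X in _ <= X).
have M0 : 0 <= M by rewrite /M !addr_ge0// mulr_ge0.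
elim/ltn_ind: j => -[|[|[|[|j]]]] IH.
- by rewrite /M -!addrA lerDl !addr_ge0// mulr_ge0.
- have := a0 0%N; have := a0 1%N; have := a0 2%N; have := a0 3%N; have := normr_ge0 B.
  by rewrite /M; lra.
- have := a0 0%N; have := a0 1%N; have := a0 2%N; have := a0 3%N; have := normr_ge0 B.
  by rewrite /M; lra.
- have := a0 0%N; have := a0 1%N; have := a0 2%N; have := a0 3%N; have := normr_ge0 B.
  by rewrite /M; lra.
apply: (le_trans (rec j.+2 _)) => //.
have sumM : \sum_(0 <= i < j.+3) (rho / 2 ^+ i) * a i <= (2 * rho) * M.
  apply: (@le_trans _ _ (\sum_(0 <= i < j.+3) (rho / 2 ^+ i) * M)).
    rewrite !big_nat; apply: ler_sum => i /andP[_ ij].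
    rewrite ler_wpM2l//; first by rewrite divr_ge0// exprn_ge0.
    by apply: IH; exact: (leq_trans ij).
  by rewrite -mulr_suml ler_wpM2r// sum_dyadic_le.
have h1 : D * \sum_(0 <= i < j.+3) (rho / 2 ^+ i) * a i <= M / 2.
  apply: (@le_trans _ _ (D * ((2 * rho) * M))); first exact: ler_wpM2l.
  have -> : D * ((2 * rho) * M) = (4 * D * rho) * (M / 2) by field.
  by rewrite ler_piMl// divr_ge0.
have h2 : B <= M / 2.
  have := a0 0%N; have := a0 1%N; have := a0 2%N; have := a0 3%N; have := ler_norm B.
  by rewrite /M; lra.
by apply: (le_trans (lerD h2 h1)); lra.
Qed.

Lemma dyadic_between (rho t : R) : 0 < t -> t <= rho ->
  exists j, rho / 2 ^+ j.+1 < t <= rho / 2 ^+ j.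
Proof.
move=> t0 trho; have rho0 := lt_le_trans t0 trho.
have ex : exists j, rho / 2 ^+ j < t.
  exists (Num.truncn (rho / t)).+1; rewrite ltr_pdivrMr ?exprn_gt0// mulrC -ltr_pdivrMr//.
  apply: (lt_le_trans (truncnS_gt _)); rewrite -natrX ler_nat ltnW//.
  exact: ltn_expl.
have [[|j] jt jmin] := ex_minnP ex.
  by move: jt; rewrite expr0 divr1 ltNge trho.
exists j; rewrite jt/= leNgt; apply/negP => /jmin.
by rewrite ltnn.
Qed.

End growth.

Section density.
Context {R : realType} {n m : nat} {U : set 'rV[R]_n}.
Hypothesis oU : open U.
Implicit Types (W : varifold m U) (x : 'rV[R]_n).

Lemma density_lower W x t : has_density m (weight W) x t -> (1 <= t)%E ->
  0 < alpha R m /\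
  exists2 d, 0 < d & forall r, 0 < r < d -> ecball x r `<=` U ->
    alpha R m / 2 * r ^+ m <= mass W (ecball x r).
Proof.
move=> dens t1.
have [d /= d0 dP] : \forall r \near 0^'+,
    (2^-1%:E < ((alpha R m)^-1 * r ^- m)%:E * weight W (ecball x r))%E.
  apply: (dens [set y | (2^-1%:E < y)%E]).
  apply: open_nbhs_nbhs; split; first exact: open_ereal_gt_ereal.
  by rewrite /= (lt_le_trans _ t1)// lte_fin; lra.
have ballr r : 0 < r < d -> (2^-1%:E < ((alpha R m)^-1 * r ^- m)%:E * weight W (ecball x r))%E.
  move=> /andP[r0 rd]; apply: dP => //.
  by rewrite /ball_ /= sub0r normrN gtr0_norm.
have al0 : 0 < alpha R m.
  (* If [alpha] were 0, its inverse would be 0 by convention and the ratio could not exceed 1/2. *)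
  rewrite lt_def alpha_ge0 andbT; apply/eqP => al0.
  have /ballr : 0 < d / 2 < d by rewrite divr_gt0//= ltr_pdivrMr// ltr_pMr// ltr1n.
  by rewrite al0 invr0 mul0r mul0e lte_fin ltNge invr_ge0 ler0n.
split => //; exists d => // r rd BU.
have := ballr r rd; have /andP[r0 _] := rd.
have wfin : weight W (ecball x r) \is a fin_num.
  by rewrite ge0_fin_numE ?weight_ge0// weight_compact//; exact: ecball_compact.
rewrite -(fineK wfin) -EFinM lte_fin => /ltW.
rewrite -/(mass W (ecball x r)); move: (mass W _) => M h.
have rm0 : 0 < r ^+ m by rewrite exprn_gt0.
have -> : M = (alpha R m * r ^+ m) * ((alpha R m)^-1 * r ^- m * M).
  by move: (alpha R m) (r ^+ m) al0 rm0 => u v u0 v0; field; rewrite !gt_eqF.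
have -> : alpha R m / 2 * r ^+ m = (alpha R m * r ^+ m) * 2^-1 by ring.
by rewrite ler_wpM2l// ltW// mulr_gt0.
Qed.

(** The monotonicity estimate is run down to a scale where the density already forces mass
    [alpha / 2 * r ^+ m]. With [N j = L * r j ^+ m] the powers cancel and the errors add up to at
    most [4 ^+ m * L * (2 * rho)]. *)
Lemma lower_mass (C : R) W x rho L : 0 < C ->
  (forall t, 0 <= t -> `|cutoff^`()%classic t : R| <= C) ->
  0 < rho -> ecball x rho `<=` U -> 0 <= L ->
  (forall t, 0 < t <= rho -> (delta_norm W (eball x t) <= (L * t ^+ m)%:E)%E) ->
  forall t, has_density m (weight W) x t -> (1 <= t)%E ->
  m%:R / 2 * 2 ^- m * (alpha R m / 2) <=
  C * 2 ^+ m * rho ^- m * mass W (ecball x rho) + 4 ^+ m * L * (2 * rho).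
Proof.
move=> C0 cC rho0 BU L0 dL t dens t1.
have [al0 [d d0 dP]] := density_lower dens t1.
pose r j := rho / 2 ^+ j.
have r0 j : 0 < r j by rewrite divr_gt0// exprn_gt0.
have rr j : r j <= rho.
  by rewrite ler_pdivrMr ?exprn_gt0// ler_peMr ?(ltW rho0)// exprn_ege1// ler1n.
have [J J2 rJ] : exists2 J, (2 <= J)%N & r J < d.
  exists ((Num.truncn (rho / d)).+1 + 2)%N; first exact: leq_addl.
  rewrite /r ltr_pdivrMr ?exprn_gt0// mulrC -ltr_pdivrMr//.
  apply: (lt_le_trans (truncnS_gt _)); rewrite -natrX ler_nat ltnW//.
  by rewrite (leq_ltn_trans (leq_addr 2 _))// ltn_expl.
have := @monotonicity_estimate _ _ _ _ oU C C0 cC W x rho J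
  (fun j => L * r j ^+ m) rho0 J2 BU.
have dLj j : (delta_norm W (eball x (rho / 2 ^+ j)) <= (L * r j ^+ m)%:E)%E.
  by apply: dL; rewrite r0 rr.
move=> /(_ dLj) est.
apply: (@le_trans _ _ (m%:R / 2 * 2 ^- m * (r J) ^- m * mass W (ecball x (r J)))).
  rewrite -[leRHS]mulrA; apply: ler_wpM2l; first by rewrite !mulr_ge0 ?invr_ge0 ?exprn_ge0.
  rewrite [leRHS]mulrC ler_pdivlMr ?exprn_gt0//; apply: dP; first by rewrite r0.
  by move=> y yr; apply: BU; exact: le_trans (rr J).
apply: (le_trans est); rewrite lerD2l.
have -> : \sum_(0 <= j < J.+1) 4 ^+ m * (rho / 2 ^+ j * (rho / 2 ^+ j) ^- m) * (L * r j ^+ m) =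
    4 ^+ m * L * \sum_(0 <= j < J.+1) rho / 2 ^+ j.
  rewrite mulr_sumr; apply: eq_bigr => j _; rewrite -/(r j).
  have : r j ^+ m != 0 by rewrite expf_neq0// gt_eqF.
  by move: (r j) (r j ^+ m) => u v v0; field.
by rewrite ler_wpM2l ?sum_dyadic_le ?(ltW rho0)// mulr_ge0// exprn_ge0.
Qed.

End density.

Section growth_of_variation.
Context {R : realType} {n m : nat} {U : set 'rV[R]_n}.
Hypotheses (oU : open U) (m0 : (0 < m)%N).
Implicit Types (V W : varifold m U) (x y : 'rV[R]_n) (A B : set 'rV[R]_n).

Lemma mass_ge0 W A : 0 <= mass W A.
Proof. by rewrite fine_ge0// weight_ge0. Qed.

Lemma le_weight W A B : A `<=` B -> (weight W A <= weight W B)%E.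
Proof. by move=> AB; apply: (radon_le (vradon W)) => z [[/AB Bz _] _]. Qed.

Lemma le_mass W A B : A `<=` B -> (weight W B < +oo)%E -> mass W A <= mass W B.
Proof.
move=> AB WB; apply: fine_le; [| |exact: le_weight].
- by rewrite ge0_fin_numE ?weight_ge0// (le_lt_trans (le_weight _ AB)).
- by rewrite ge0_fin_numE ?weight_ge0.
Qed.

Lemma ecball_sub_eball x (r s : R) : r < s -> ecball x r `<=` eball x s.
Proof. by move=> rs y yr; exact: le_lt_trans rs. Qed.

Lemma eball_sub_ecball x (r : R) : eball x r `<=` ecball x r.
Proof. by move=> y; exact: ltW. Qed.

Lemma le_ecball x (r s : R) : r <= s -> ecball x r `<=` ecball x s.
Proof. by move=> rs y yr; exact: le_trans rs. Qed.

Lemma le_eball x (r s : R) : r <= s -> eball x r `<=` eball x s.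
Proof. by move=> rs y yr; exact: lt_le_trans rs. Qed.

Variable V : varifold m U.
Hypothesis fV : finite_on_compacts U (delta_norm V).

Lemma delta_norm_finite (K A : set 'rV[R]_n) : compact K -> K `<=` U -> A `<=` K ->
  delta_norm V A \is a fin_num.
Proof.
move=> cK KU AK; rewrite ge0_fin_numE ?delta_norm_ge0//.
apply: (le_lt_trans (le_delta_norm oU V AK)).
exact: fV.
Qed.

(* If the variation of all small balls were controlled by the mass of slightly
   larger ones, the monotonicity estimate would become a Gronwall inequality for
   the mass ratios at dyadic scales; these would be bounded, and hence the
   variation of the ball of radius [t] would be O(t ^+ m). *)
Lemma bad_ball x (s k : R) : 0 < k -> 0 < s -> eball x s `<=` U ->
  ~ (exists L tau : R, 0 < tau /\ forall t, 0 < t <= tau ->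
     (delta_norm V (eball x t) <= (L * t ^+ m)%:E)%E) ->
  exists2 t, 0 < t /\ 4 * t < s &
    mass V (ecball x (3 * t)) <= k * fine (delta_norm V (eball x t)).
Proof.
move=> k0 s0 sU nb; apply: contrapT => nex.
have H t : 0 < t -> 4 * t < s ->
    k * fine (delta_norm V (eball x t)) < mass V (ecball x (3 * t)).
  by move=> t0 ts; rewrite ltNge; apply/negP => h; apply: nex; exists t.
have [C C0 cC] := @cutoff_derive_bound R.
pose c : R := m%:R / 2 * 2 ^- m.
have c0 : 0 < c.
  by rewrite /c !mulr_gt0 ?ltr0n// invr_gt0 exprn_gt0.
pose D := 4 ^+ m / c * (4 ^+ m / k).
have D0 : 0 < D by rewrite /D !mulr_gt0 ?exprn_gt0 ?invr_gt0.
(* The first bound keeps the balls of radius [4 * rho] inside the ball of radius [s]; the second is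
   the smallness required by [dyadic_gronwall]. *)
pose rho := Num.min (s / 8) (4 * D)^-1.
have rho0 : 0 < rho.
  by rewrite lt_min divr_gt0//= invr_gt0 mulr_gt0.
have rhos : 4 * rho < s.
  have : rho <= s / 8 by rewrite ge_min lexx.
  by lra.
pose r j := rho / 2 ^+ j.
have r0 j : 0 < r j by rewrite divr_gt0// exprn_gt0.
have rr j : r j <= rho.
  by rewrite ler_pdivrMr ?exprn_gt0// ler_peMr ?(ltW rho0)// exprn_ege1// ler1n.
have rS j : r j = 4 * r j.+2.
  by rewrite /r !exprS; field; rewrite expf_neq0.
have BU t : t < s -> ecball x t `<=` U.
  by move=> ts; exact: subset_trans (ecball_sub_eball ts) sU.
have fin_mass t : t < s -> (weight V (ecball x t) < +oo)%E.
  by move=> ts; apply: weight_compact; [exact: ecball_compact|exact: BU].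
have r4 j : 4 * r j < s.
  by rewrite (le_lt_trans _ rhos)// ler_pM2l.
have fin_delta j : delta_norm V (eball x (r j)) \is a fin_num.
  apply: (@delta_norm_finite (ecball x (r j))); first exact: ecball_compact.
    apply: BU; apply: le_lt_trans (r4 j); rewrite ler_peMl ?(ltW (r0 j))//; lra.
  exact: eball_sub_ecball.
pose N j := mass V (ecball x (4 * r j)) / k.
have gN j : fine (delta_norm V (eball x (r j))) <= N j.
  rewrite ler_pdivlMr// mulrC (le_trans (ltW (H _ (r0 j) (r4 j))))//.
  apply: le_mass; last exact: fin_mass.
  by apply: le_ecball; rewrite ler_pM2r//; lra.
have WN j : (delta_norm V (eball x (r j)) <= (N j)%:E)%E.
  by rewrite -(fineK (fin_delta j)) lee_fin.
have rhos1 : rho < s by lra.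
(* The factor 4 absorbs the enlargement by 3 in [H], and since [r J = 4 * r J.+2] the estimate at
   scale [r J] is a bound for [a J.+2]. *)
pose a j := r j ^- m * mass V (ecball x (4 * r j)).
have [M aM] : exists M, forall j, a j <= M.
  apply: (@dyadic_gronwall R a (4 ^+ m / c * (C * 2 ^+ m * rho ^- m * mass V (ecball x rho))) D rho).
  - by move=> j; rewrite mulr_ge0 ?mass_ge0// invr_ge0 exprn_ge0// ltW.
  - exact: ltW.
  - exact: ltW.
  - have D4 : 0 < 4 * D by rewrite mulr_gt0.
    have : rho <= (4 * D)^-1 by rewrite /rho ge_min lexx orbT.
    by rewrite -(ler_pM2l D4) divff// gt_eqF.
  - move=> J J2.
    have est := @monotonicity_estimate _ _ _ _ oU C C0 cC V x rho J N rho0 J2 (BU _ rhos1) WN.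
    have -> : a J.+2 = 4 ^+ m / c * (c * r J ^- m * mass V (ecball x (r J))).
      rewrite /a -rS; have -> : r J.+2 = r J / 4 by rewrite (rS J); field.
      by rewrite -mul_exprVn -(mulrA c) [RHS]mulrA divfK ?gt_eqF// mulrA.
    have cm0 : 0 <= 4 ^+ m / c by rewrite mulr_ge0 ?exprn_ge0// invr_ge0 ltW.
    apply: (le_trans (ler_wpM2l cm0 est)); rewrite mulrDr lerD2l.
    rewrite /D -[leRHS]mulrA; apply: ler_wpM2l => //.
    rewrite mulr_sumr; apply: ler_sum => j _.
    rewrite -/(r j) /N /a.
    by rewrite le_eqVlt; apply/orP; left; apply/eqP;
      move: (r j) (r j ^- m) (mass V _) (4 ^+ m) => u v w z; ring.
(* The factor [2 ^+ m] is the cost of passing from [t] to the next larger dyadic radius. *)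
apply: nb; exists (M / k * 2 ^+ m), rho; split => // t /andP[t0 trho].
have [j /andP[jt tj]] := dyadic_between t0 trho.
apply: (le_trans (le_delta_norm oU V (le_eball (x := x) tj))).
apply: (le_trans (WN j)); rewrite lee_fin /N.
have M0 : 0 <= M.
  by apply: le_trans (aM 0%N); rewrite mulr_ge0 ?mass_ge0// invr_ge0 exprn_ge0// ltW.
have -> : mass V (ecball x (4 * r j)) = r j ^+ m * a j.
  by rewrite /a mulVKf// expf_neq0// gt_eqF.
have rjt : r j ^+ m <= 2 ^+ m * t ^+ m.
  rewrite -exprMn; apply: lerXn2r.
  - by rewrite nnegrE ltW.
  - by rewrite nnegrE mulr_ge0// ltW.
  - move: jt; rewrite exprSr invfM mulrA -/(r j) ltr_pdivrMr// => /ltW.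
    by rewrite (mulrC t).
have -> : M / k * 2 ^+ m * t ^+ m = (2 ^+ m * t ^+ m) * M / k by ring.
rewrite ler_wpM2r ?invr_ge0 ?(ltW k0)//.
have a0 : 0 <= a j by rewrite mulr_ge0 ?mass_ge0// invr_ge0 exprn_ge0// ltW.
by rewrite ler_pM// exprn_ge0// ltW.
Qed.

End growth_of_variation.

Section null_sets.
Context {R : realType} {T : ptopologicalType} (O : set T).
Hypothesis (oO : open O).
Variable mu : {measure set (borel T) -> \bar R}.
Hypothesis rmu : radon O mu.

Lemma radon_null_cover (A : set T) : mu A = 0%E ->
  exists2 B : set (borel T), measurable B /\ mu B = 0%E & A `&` O `<=` B.
Proof.
move=> A0; have [_ _ /(_ A)] := rmu; rewrite A0 => inf0.
have Gex k : exists G, [/\ open G, A `&` O `<=` G & (mu G < (k.+1%:R^-1)%:E)%E].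
  have : (ereal_inf [set mu G | G in [set G | open G /\ A `&` O `<=` G]] < (k.+1%:R^-1)%:E)%E.
    by rewrite -inf0 lte_fin.
  by move=> /ereal_inf_lt[_ [G [oG AG] <-] Gk]; exists G.
have [G GP] := choice Gex.
exists (\bigcap_k G k); last by move=> x Ax k _; have [_ AG _] := GP k; exact: AG.
have mG : measurable (\bigcap_k G k : set (borel T)).
  by apply: bigcapT_measurable => k; apply: measurable_open; have [] := GP k.
split => //; apply/eqP; rewrite eq_le measure_ge0 andbT.
apply/lee_addgt0Pr => e e0; rewrite add0e.
have [k ke] : exists k, k.+1%:R^-1 < e.
  exists (Num.truncn e^-1); rewrite invf_plt ?posrE//.
  exact: truncnS_gt.
have [oG _ Gk] := GP k.
apply: (@le_trans _ _ (mu (G k))).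
  by apply: le_measure; rewrite ?inE//; [exact: measurable_open|exact: bigcap_inf].
by apply: (le_trans (ltW Gk)); rewrite lee_fin ltW.
Qed.

(** Each null set is first enlarged to a Borel null set, because the lemma is applied to good and
    bad sets, for which no measurability is established. *)
Lemma radon_null_bigcup (A : nat -> set T) : (forall i, mu (A i) = 0%E) ->
  mu (\bigcup_i A i) = 0%E.
Proof.
move=> A0.
have Bex i : exists B : set (borel T), (measurable B /\ mu B = 0%E) /\ A i `&` O `<=` B.
  by have [B mB AB] := radon_null_cover (A0 i); exists B.
have [B BP] := choice Bex.
apply/eqP; rewrite eq_le (radon_ge0 _ rmu) andbT.
apply: (@le_trans _ _ (mu (\bigcup_i B i))).
  apply: (radon_le rmu) => x [[i _ Ax] Ox]; exists i => //.
  by have [_ AB] := BP i; exact: AB.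
have mB i : measurable (B i) by have [[]] := BP i.
apply: (le_trans (measure_sigma_subadditive mu mB _ (@subset_refl _ _))).
  exact: bigcupT_measurable.
by rewrite eseries0// => i _ _; have [[]] := BP i.
Qed.

End null_sets.

Lemma quarter_bounds (R : realType) (a t : R) : 0 < t -> 4 * t < a / 2 ->
  [/\ 3 * t < a, t < a & t <= a / 2].
Proof. by move=> t0 ta; split; lra. Qed.

Section charged_sets.
Context {R : realType} {n m : nat} {U : set 'rV[R]_n}.
Hypotheses (oU : open U) (m0 : (0 < m)%N).
Implicit Types (V W Z : varifold m U) (x y : 'rV[R]_n) (i : nat).

Let s_ i : R := i.+1%:R^-1.

Let s_le1 i : s_ i <= 1. Proof. by rewrite invf_le1// ler1n. Qed.

Let s_nincr i j : (i <= j)%N -> s_ j <= s_ i.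
Proof. by move=> ij; rewrite lef_pV2 ?posrE// ler_nat ltnS. Qed.

Definition core i : set 'rV[R]_n := [set x | enorm x <= i.+1%:R /\ eball x (i.+1%:R^-1) `<=` U].

(** A compact subset of [U] containing the balls of radius [1 / (2 (i + 1))] about points of
    [core i]; it is the fixed region on which masses of pieces are measured. *)
Definition hull i : set 'rV[R]_n := [set x | enorm x <= i.+2%:R /\ eball x (i.+1%:R^-1 / 2) `<=` U].

Lemma core_nondecreasing i j : (i <= j)%N -> core i `<=` core j.
Proof.
move=> ij x [xi xU]; split; first by rewrite (le_trans xi)// ler_nat ltnS.
exact: (subset_trans (le_eball (s_nincr ij))).
Qed.

Lemma core_cover x (L tau : R) : 0 < tau -> U x ->
  exists i, [/\ core i x, L <= i.+1%:R & i.+1%:R^-1 <= tau].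
Proof.
move=> tau0 Ux; have /nbhs_eball[r r0 rU] : nbhs x U by exact: open_nbhs_nbhs.
pose M := Num.truncn (`|enorm x| + `|L| + r^-1 + tau^-1).
have sumM : `|enorm x| + `|L| + r^-1 + tau^-1 < M.+1%:R by exact: truncnS_gt.
have h1 := normr_ge0 L; have h2 := normr_ge0 (enorm x).
have h3 : 0 < r^-1 by rewrite invr_gt0.
have h4 : 0 < tau^-1 by rewrite invr_gt0.
have h5 := ler_norm L; have h6 := ler_norm (enorm x).
exists M; split; [split| |].
- by lra.
- apply: subset_trans rU; apply: le_eball.
  by rewrite invf_ple ?posrE//; lra.
- by lra.
- by rewrite invf_ple ?posrE//; lra.
Qed.

Lemma hull_sub i : hull i `<=` U.
Proof.
move=> x [_]; apply; rewrite /eball/= subrr enorm0.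
by rewrite divr_gt0// invr_gt0.
Qed.

Lemma hull_compact i : compact (hull i).
Proof.
apply: (@sub_compact_rV _ _ _ (ecball 0 i.+2%:R)).
- exact: ecball_compact.
- rewrite (_ : hull i = ecball 0 i.+2%:R `&` ~` \bigcup_(z in ~` U) eball z (i.+1%:R^-1 / 2)).
    apply: closedI; first exact: ecball_closed.
    by apply: open_closedC; apply: bigcup_open => z _; exact: eball_open.
  apply/seteqP; split => y.
    move=> [yi yU]; split; first by rewrite /ecball/= subr0.
    by move=> [z nUz zy]; apply: nUz; apply: yU; rewrite /eball/= enormC.
  move=> []; rewrite /ecball/= subr0 => yi ny; split => // z zy.
  by apply: contrapT => nUz; apply: ny; exists z => //; rewrite /eball/= enormC.
- by move=> y [yi _]; rewrite /ecball/= subr0.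
Qed.

Lemma ecball_hull i x t : core i x -> t <= i.+1%:R^-1 / 2 -> ecball x t `<=` hull i.
Proof.
move=> [xi xU] ts y yt; have ts' := ts.
have s2 : i.+1%:R^-1 / 2 + i.+1%:R^-1 / 2 = i.+1%:R^-1 :> R.
  by move: (i.+1%:R^-1 : R) => s; field.
have s1 : i.+1%:R^-1 / 2 <= 1 :> R.
  by rewrite ler_pdivrMr// mul1r (le_trans (s_le1 i))// ler1n.
split.
  rewrite -(subrK x y) (le_trans (enormD _ _))// -(natr1 i.+1) addrC lerD//.
  exact: le_trans yt (le_trans ts s1).
move=> z zy; apply: xU; rewrite /eball/=.
rewrite (le_lt_trans (enorm_dist z y x))// -s2 ltr_leD//.
exact: le_trans yt ts.
Qed.

Lemma weightU W (A B : set 'rV[R]_n) : closed A -> closed B ->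
  (weight W (A `|` B) <= weight W A + weight W B)%E.
Proof.
move=> cA cB; rewrite /weight (_ : (A `|` B) `*` _ =
    (A `*` [set: subspaces R n]) `|` (B `*` [set: subspaces R n])).
  by apply: measureU2; exact: weight_measurable.
apply/seteqP; split => z /=; first by move=> [[Az|Bz] _]; [left|right].
by move=> [[Az _]|[Bz _]]; split => //; [left|right].
Qed.

Section good_points.
Variable V : varifold m U.
Hypothesis fV : finite_on_compacts U (delta_norm V).

(** One index serves as growth constant, as scale and, through [core i], as localization: the sets
    increase, and every point of [U] with growth O(t ^ m) is in one of them. *)
Definition good i : set 'rV[R]_n := [set x | core i x /\
  forall t, 0 < t <= i.+1%:R^-1 -> (delta_norm V (eball x t) <= (i.+1%:R * t ^+ m)%:E)%E].

Lemma good_nondecreasing i : good i `<=` good i.+1.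
Proof.
move=> x [cx gx]; split; first exact: (core_nondecreasing (leqnSn i)).
move=> t /andP[t0 ts]; apply: (le_trans (gx t _)).
  by rewrite t0 (le_trans ts)// s_nincr.
by rewrite lee_fin ler_wpM2r ?exprn_ge0 ?(ltW t0)// ler_nat.
Qed.

Let bad i := core i `\` \bigcup_j good j.

Let bad_unbounded i x : bad i x -> ~ (exists L tau : R, 0 < tau /\
  forall t, 0 < t <= tau -> (delta_norm V (eball x t) <= (L * t ^+ m)%:E)%E).
Proof.
move=> [cx ngx] [L [tau [tau0 H]]]; apply: ngx.
have Ux : U x.
  by have [_] := cx; apply; rewrite /eball/= subrr enorm0 invr_gt0.
have [j [cj Lj jtau]] := core_cover L tau0 Ux.
exists j => //; split => // t /andP[t0 tj].
apply: (le_trans (H t _)); first by rewrite t0 (le_trans tj).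
by rewrite lee_fin ler_wpM2r// exprn_ge0// ltW.
Qed.

Lemma weight_seq_ecball (s : seq 'rV[R]_n) (r : 'rV[R]_n -> R) :
  (weight V (\bigcup_(x in [set x | x \in s]) ecball x (r x)) <=
   \sum_(x <- s) weight V (ecball x (r x)))%E.
Proof.
elim: s => [|x s IH].
  rewrite big_nil (_ : \bigcup_(_ in _) _ = set0); last first.
    by apply/seteqP; split => y //= [z].
  by rewrite /weight set0X measure0.
rewrite big_cons.
have cls (t : seq 'rV[R]_n) : closed (\bigcup_(x in [set x | x \in t]) ecball x (r x)).
  elim: t => [|z t IHt].
    by rewrite (_ : \bigcup_(_ in _) _ = set0); [exact: closed0|apply/seteqP; split => y //= [z]].
  rewrite (_ : \bigcup_(_ in _) _ = ecball z (r z) `|` \bigcup_(x in [set x | x \in t]) ecball x (r x)).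
    by apply: closedU => //; exact: ecball_closed.
  apply/seteqP; split => y.
    by move=> [w /=]; rewrite inE => /orP[/eqP -> ?|zs zy]; [left|right; exists w].
  by move=> [xy|[w /= zs zy]]; [exists z => //=; rewrite mem_head|exists w => //=; rewrite inE zs orbT].
apply: (@le_trans _ _ (weight V (ecball x (r x) `|` \bigcup_(x in [set x | x \in s]) ecball x (r x)))).
  apply: le_weight => y [w /=]; rewrite inE => /orP[/eqP -> ?|zs zy]; first by left.
  by right; exists w.
apply: (@le_trans _ _ (weight V (ecball x (r x)) +
    weight V (\bigcup_(x in [set x | x \in s]) ecball x (r x)))%E); last first.
  by rewrite leeD2l.
by apply: weightU => //; exact: ecball_closed.
Qed.

(** Around each bad point [bad_ball] gives a ball whose threefold enlargement has mass at most [k]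
    times the variation of the ball. Disjoint balls chosen by [finite_vitali] lie in [hull i], so
    the total is at most [k] times its finite variation, and [k] is arbitrary. *)
Let bad_null i : weight V (bad i) = 0%E.
Proof.
pose D := fine (delta_norm V (hull i)).
have Dfin : delta_norm V (hull i) \is a fin_num.
  by apply: (delta_norm_finite oU fV (@hull_compact i) (@hull_sub i)).
have D0 : 0 <= D by rewrite fine_ge0// delta_norm_ge0.
suff key (k : R) : 0 < k -> (weight V (bad i) <= (k * D)%:E)%E.
  apply/eqP; rewrite eq_le weight_ge0 andbT; apply/lee_addgt0Pr => e e0.
  have D1 : 0 < D + 1 by rewrite ltr_wpDl.
  rewrite add0e (le_trans (key (e / (D + 1)) _)) ?divr_gt0// lee_fin.
  by rewrite mulrAC ler_pdivrMr// ler_wpM2l ?(ltW e0)// lerDl.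
move=> k0.
have tex x : exists t, bad i x -> (0 < t /\ 4 * t < i.+1%:R^-1 / 2) /\
    mass V (ecball x (3 * t)) <= k * fine (delta_norm V (eball x t)).
  have [bx|nb] := pselect (bad i x); last by exists 0.
  have [[_ xU] _] := bx.
  have s2 : 0 < i.+1%:R^-1 / 2 :> R by rewrite divr_gt0// invr_gt0.
  have s2U : eball x (i.+1%:R^-1 / 2) `<=` U.
    apply: subset_trans xU; apply: le_eball.
    by rewrite ler_pdivrMr// ler_peMr ?ler1n// invr_ge0.
  by have [t tt mt] := bad_ball oU m0 fV k0 s2 s2U (bad_unbounded bx); exists t.
have [t tP] := choice tex.
pose G := \bigcup_(x in bad i) eball x (t x).
have oG : open G by apply: bigcup_open => x _; exact: eball_open.
have ballU x r : bad i x -> r < i.+1%:R^-1 -> ecball x r `<=` U.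
  move=> [[_ xU] _] rs; apply: subset_trans xU; exact: ecball_sub_eball.
have oGT : open (G `*` [set: subspaces R n]).
  rewrite (_ : _ `*` _ = fst @^-1` G); last by apply/seteqP; split => z //= [].
  by apply: open_comp => // z _; exact: cvg_fst.
have rW := vradon V.
apply: (@le_trans _ _ (V ((G `*` setT) `&` UG m U))).
  apply: (radon_le rW) => z [[bz _] Uz]; split => //; split => //.
  by exists z.1 => //; have [[t0 _] _] := tP _ bz; rewrite /eball/= subrr enorm0.
(* Inner regularity on the open union of the balls replaces the bad set by a compact set, for which
   a finite covering suffices. *)
have [_ inner _] := rW; rewrite inner; last 2 first.
- by apply: openI => //; exact: UG_open.
- by move=> z [].
apply: ge_ereal_sup => _ [K [cK KG] <-].
have cfK : compact (fst @` K).
  by apply: continuous_compact => //; apply: continuous_subspaceT => z; exact: cvg_fst.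
have [||s sb Ks] := @compact_finite_cover _ _ (bad i) (fun x => eball x (t x)) cfK.
- by move=> x _; exact: eball_open.
- by move=> _ [z /KG[[Gz _] _] <-].
have [|q [qs qd qc]] := @finite_vitali R n t s.
  by move=> x /sb /tP[[]].
have qb x : x \in q -> bad i x by move=> /qs; exact: sb.
apply: (@le_trans _ _ (weight V (\bigcup_(x in [set x | x \in q]) ecball x (3 * t x)))).
  apply: (radon_le rW) => z [Kz _]; split => //.
  have [x /= xs xz] := Ks _ (ex_intro2 _ _ z Kz erefl).
  by have [w wq wz] := qc z.1 (ex_intro2 _ _ x xs xz); exists w.
apply: (le_trans (weight_seq_ecball _ _)).
apply: (@le_trans _ _ (\sum_(x <- q) k%:E * delta_norm V (eball x (t x)))%E).
  rewrite !big_seq; apply: lee_sum => x xq.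
  have bx := qb x xq; have [[t0 ts] mt] := tP x bx.
  have [b1 b2 b3] := quarter_bounds t0 ts.
  have wf : weight V (ecball x (3 * t x)) \is a fin_num.
    rewrite ge0_fin_numE ?weight_ge0//; apply: weight_compact; first exact: ecball_compact.
    exact: ballU.
  have df : delta_norm V (eball x (t x)) \is a fin_num.
    apply: (@delta_norm_finite _ _ _ _ oU V fV (ecball x (t x))).
    - exact: ecball_compact.
    - exact: ballU.
    - exact: eball_sub_ecball.
  by rewrite -(fineK wf) -(fineK df) -EFinM lee_fin.
rewrite -ge0_sume_distrr; last by move=> x _; exact: delta_norm_ge0.
rewrite disjoint_balls_sum// EFinM lee_wpmul2l ?lee_fin ?(ltW k0)//.
rewrite /D fineK//; apply: le_delta_norm => //.
move=> y [x /= xq xy]; have bx := qb x xq; have [[t0 ts] _] := tP x bx.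
have [_ _ b3] := quarter_bounds t0 ts.
by apply: (@ecball_hull i x (t x)); [case: bx|exact: b3|exact: ltW].
Qed.

Lemma good_cover : weight V (U `\` \bigcup_i good i) = 0%E.
Proof.
have b0 : weight V (\bigcup_i bad i) = 0%E.
  rewrite /weight (_ : _ `*` _ = \bigcup_i (bad i `*` [set: subspaces R n])).
    by apply: (radon_null_bigcup (vradon V)) => i; exact: bad_null.
  apply/seteqP; split => z; first by move=> [[i _ bz] _]; exists i.
  by move=> [i _ [bz _]]; split => //; exists i.
apply/eqP; rewrite eq_le weight_ge0 andbT -b0; apply: le_weight => x [Ux ngx].
by have [i [ci _ _]] := core_cover 0 ltr01 Ux; exists i.
Qed.

End good_points.

End charged_sets.

(** * Uniform mass of pieces charging a good set *)

Section charged_pieces.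
Context {R : realType} {n m : nat} {U : set 'rV[R]_n}.
Hypotheses (oU : open U) (m0 : (0 < m)%N).
Local Notation bundle := ('rV[R]_n * subspaces R n)%type.
Implicit Types (V W Z : varifold m U) (A : set bundle).

Lemma vsum_measure V W Z A : vsum V W Z -> Z A = (V A + W A)%E.
Proof.
move=> VWZ.
pose S := Varifold (radon_add (@bundle_hausdorff R n) (vradon V) (vradon W)).
have -> : Z = S.
  apply: (varifold_eq oU) => k Kk; rewrite (VWZ k Kk).
  rewrite /vfun /Rintegral/=.
  have mO : measurable (UG m U : set (borel bundle)) := measurable_open (UG_open oU).
  have I W' : (vmeasure W').-integrable (UG m U : set (borel bundle)) (EFin \o k : borel bundle -> \bar R).
    exact: (Kspace_integrable (@bundle_hausdorff R n) (UG_open oU) (@vfinite _ _ _ _ W') Kk).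
  by rewrite integral_measure_add// [RHS]fineD//; apply: integrable_fin_num => //; exact: I.
exact: measure_addE.
Qed.

Lemma vle_vsum V W Z : vsum V W Z -> vle V Z.
Proof.
by move=> VWZ k Kk k0; rewrite (VWZ k Kk) lerDl; exact: vfun_ge0.
Qed.

Definition dense_points W : Prop := weight W
  [set x | ~ exists2 t, has_density m (weight W) x t & (1 <= t)%E] = 0%E.

(** A varifold charging the good set has a good point of density at least 1, and there it inherits
    the growth bound of [V]. The radius [rho] depends on [i] only and makes the error [D * rho] in
    [lower_mass] at most half of the main term [c]. *)
Lemma hull_mass_lower V : finite_on_compacts U (delta_norm V) -> forall i,
  exists2 d, 0 < d & forall W, dense_points W ->
    (forall B, (delta_norm W B <= delta_norm V B)%E) ->
    weight W (good V i) <> 0%E -> d <= mass W (@hull _ _ U i).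
Proof.
move=> fV i.
have pick W : dense_points W -> weight W (good V i) <> 0%E ->
    exists2 x, good V i x & exists2 t, has_density m (weight W) x t & (1 <= t)%E.
  move=> dW nz; apply: contrapT => nex; apply: nz; apply/eqP.
  rewrite eq_le weight_ge0 andbT -dW; apply: le_weight => x gx /= h.
  by apply: nex; exists x.
(* If [alpha] is not positive, no point has density at least 1 and the claim is vacuous. *)
have [al0|al0] := ltP 0 (alpha R m); last first.
  exists 1 => // W dW _ /(pick W dW)[x _ [t dt t1]].
  by have [al _] := density_lower dt t1; move: al0; rewrite leNgt al.
have [C C0 cC] := @cutoff_derive_bound R.
pose c : R := m%:R / 2 * 2 ^- m * (alpha R m / 2).
have c0 : 0 < c.
  by rewrite /c !mulr_gt0 ?ltr0n ?invr_gt0// exprn_gt0.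
pose D : R := 4 ^+ m * i.+1%:R * 2.
have D0 : 0 < D by rewrite /D !mulr_gt0// exprn_gt0.
pose rho := Num.min (i.+1%:R^-1 / 2) (c / 2 / D).
have rho0 : 0 < rho.
  by rewrite lt_min; apply/andP; split; rewrite divr_gt0 ?invr_gt0// divr_gt0.
have rho1 : rho <= i.+1%:R^-1 / 2 by rewrite ge_min lexx.
have rho2 : D * rho <= c / 2.
  have : rho <= c / 2 / D by rewrite ge_min lexx orbT.
  by rewrite ler_pdivlMr// mulrC.
pose E := C * 2 ^+ m * rho ^- m.
have E0 : 0 < E by rewrite /E !mulr_gt0 ?exprn_gt0// invr_gt0 exprn_gt0.
exists (c / 2 / E); first by apply: divr_gt0 => //; apply: divr_gt0.
move=> W dW WV nz; have [x [cx gx] [t dt t1]] := pick W dW nz.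
have BH := ecball_hull cx rho1.
have BU : ecball x rho `<=` U := subset_trans BH (@hull_sub _ _ _ i).
have dL s : 0 < s <= rho -> (delta_norm W (eball x s) <= (i.+1%:R * s ^+ m)%:E)%E.
  move=> /andP[s0 sr]; apply: (le_trans (WV _)); apply: gx; rewrite s0 (le_trans sr)//.
  by rewrite (le_trans rho1)// ler_pdivrMr// ler_peMr ?ler1n// invr_ge0.
have := lower_mass oU C0 cC rho0 BU (ler0n _ _) dL dt t1.
rewrite -/c -/E => est.
apply: (@le_trans _ _ (mass W (ecball x rho))); last first.
  by apply: le_mass => //; apply: weight_compact; [exact: hull_compact|exact: hull_sub].
rewrite ler_pdivrMr// mulrC.
have : 4 ^+ m * i.+1%:R * (2 * rho) = D * rho by rewrite /D; ring.
by move: est rho2; move: (mass W _) (D * rho) (4 ^+ m * _ * _) => u v w; lra.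
Qed.

(* [b i W] stands for: W charges [good V i]; [k i] is a bump function on a compact
   neighbourhood of [good V i], whose integral then has the fixed lower
   bound [d i]. *)
Lemma charged_pieces V : finite_on_compacts U (delta_norm V) ->
  exists (b : nat -> varifold m U -> Prop) (k : nat -> bundle -> R) (d : nat -> R),
  [/\ forall i j W, (i <= j)%N -> b i W -> b j W,
      (forall i W Z T, vsum W Z T -> b i T -> b i W \/ b i Z) /\
      (forall i W Z, vle W Z -> b i W -> b i Z),
      forall i, [/\ Kspace (UG m U) (k i), forall z, 0 <= k i z & 0 < d i],
      forall i W, dense_points W -> (forall B, (delta_norm W B <= delta_norm V B)%E) ->
        b i W -> d i <= vfun W (k i) &
      forall W, vle W V -> W <> vzero m U -> exists i, b i W].
Proof.
move=> fV.
have dex i : exists d, 0 < d /\ forall W, dense_points W ->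
    (forall B, (delta_norm W B <= delta_norm V B)%E) ->
    weight W (good V i) <> 0%E -> d <= mass W (@hull _ _ U i).
  by have [d d0 dP] := hull_mass_lower fV i; exists d.
have [d dP] := choice dex.
have cH i : compact ((@hull _ _ U i) `*` @grassmann R n m).
  exact/setX_grassmann_compact/hull_compact.
have HU i : (@hull _ _ U i) `*` grassmann m `<=` UG m U.
  by move=> z [/hull_sub].
have [k kP] := choice (fun i => bundle_bump oU (cH i) (HU i)).
exists (fun i W => weight W (good V i) <> 0%E), k, d; split.
- move=> i j W ij nz e; apply: nz; apply/eqP; rewrite eq_le weight_ge0 andbT -e.
  apply: le_weight; elim: j ij {e} => [|j IH]; first by rewrite leqn0 => /eqP ->.
  rewrite leq_eqVlt => /orP[/eqP -> //|ij].
  exact: (subset_trans (IH ij) (@good_nondecreasing _ _ _ _ V j)).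
- split => [i W Z T WZT nz|i W Z WZ nz e].
    apply: contrapT => /not_orP[/contrapT w0 /contrapT z0]; apply: nz.
    by rewrite /weight (vsum_measure _ WZT) -/(weight W _) -/(weight Z _) w0 z0 adde0.
  apply: nz; apply/eqP; rewrite eq_le weight_ge0 andbT -e.
  exact: (vle_measure oU).
- by move=> i; have [Kk k0 _] := kP i; have [d0 _] := dP i.
- move=> i W dW WV nz; have [_ /(_ W dW WV nz) dm] := dP i; apply: (le_trans dm).
  have [Kk k0 k1] := kP i.
  have hfin : weight W (@hull _ _ U i) \is a fin_num.
    rewrite ge0_fin_numE ?weight_ge0//.
    by apply: weight_compact; [exact: hull_compact|exact: hull_sub].
  rewrite -lee_fin /mass fineK//.
  apply: (@le_trans _ _ (W (@hull _ _ U i `*` grassmann m))).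
    by apply: (radon_le (vradon W)) => z [[hz _] [_ gz]].
  apply: (measure_le_Kintegral (@bundle_hausdorff R n) (UG_open oU) (@vfinite _ _ _ _ W) Kk) => //.
    exact: (measurable_compact (@bundle_hausdorff R n)).
  by move=> z /k1 ->.
- move=> W WV nz; apply: contrapT => nex; apply: nz.
  have g0 i : weight W (good V i) = 0%E by apply: contrapT => h; apply: nex; exists i.
  have WO : W (UG m U) = 0%E.
    (* [F 0] is the part of [U] missed by all good sets, null by [good_cover]; the good sets follow
       from index 1 on. *)
    pose F i := if i is j.+1 then good V j `*` [set: subspaces R n]
      else (U `\` \bigcup_j good V j) `*` [set: subspaces R n].
    have F0 : W (\bigcup_i F i) = 0%E.
      apply: (radon_null_bigcup (vradon W)) => -[|j] /=; last exact: g0.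
      apply/eqP; rewrite eq_le (radon_ge0 _ (vradon W)) andbT -(good_cover oU m0 fV).
      exact: (vle_measure oU).
    apply/eqP; rewrite eq_le (radon_ge0 _ (vradon W)) andbT -F0.
    apply: (radon_le (vradon W)) => z [[Uz _] _].
    have [[j _ gz]|ng] := pselect ((\bigcup_j good V j) z.1).
      by exists j.+1.
    by exists 0%N.
  apply: (varifold_eq oU) => f Kf; rewrite vfun_vzero.
  have [M M0 Mf] := Kspace_bounded Kf.
  have mO : measurable (UG m U : set (borel bundle)) := measurable_open (UG_open oU).
  have out z : UG m U z -> ~ UG m U z -> f z = 0 by [].
  have := @Kintegral_le_measure _ _ _ (@bundle_hausdorff R n) (UG_open oU) _
    (@vfinite _ _ _ _ W) f (UG m U) M Kf (ltW M0) mO Mf out.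
  by rewrite WO mule0 lee_fin normr_le0 => /eqP.
Qed.

End charged_pieces.

(** * Strong limits and splittings *)

Section varifold_limits.
Context {R : realType} {n m : nat} {U : set 'rV[R]_n}.
Hypothesis oU : open U.
Local Notation bundle := ('rV[R]_n * subspaces R n)%type.
Local Notation O := (UG m U).
Implicit Types (V W Z : varifold m U) (w : nat -> varifold m U) (f k : bundle -> R).

Definition vcvg w W := forall f, Kspace O f -> vfun (w i) f @[i --> \oo] --> vfun W f.

(** Both [k - f] and [k + f] are nonnegative, and on each of them [W] is at most [V]. *)
Lemma vle_diff_bound V W f k : Kspace O f -> Kspace O k ->
  (forall z, `|f z| <= k z) -> vle W V ->
  `|vfun V f - vfun W f| <= `|vfun V k - vfun W k|.
Proof.
move=> Kf Kk fk WV.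
have h1 := WV _ (KspaceB (@bundle_hausdorff R n) Kk Kf).
have h2 := WV _ (KspaceD (@bundle_hausdorff R n) Kk Kf).
rewrite !(vfunB oU) // in h1; rewrite !(vfunD oU) // in h2.
have {}h1 : vfun W k - vfun W f <= vfun V k - vfun V f.
  by apply: h1 => z; have := fk z; rewrite ler_norml => /andP[]; lra.
have {}h2 : vfun W k + vfun W f <= vfun V k + vfun V f.
  by apply: h2 => z; have := fk z; rewrite ler_norml => /andP[]; lra.
by apply: (le_trans _ (ler_norm _)); rewrite ler_norml; apply/andP; split; lra.
Qed.

Lemma comparable_diff_bound V W f k : Kspace O f -> Kspace O k ->
  (forall z, `|f z| <= k z) -> vle W V \/ vle V W ->
  `|vfun V f - vfun W f| <= `|vfun V k - vfun W k|.
Proof.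
move=> Kf Kk fk [|] h; first exact: vle_diff_bound.
by rewrite distrC (distrC (vfun V k)); exact: vle_diff_bound.
Qed.

Lemma vfun_cvgn w : (forall f, Kspace O f -> (forall z, 0 <= f z) ->
    cvgn (fun i => vfun (w i) f)) ->
  forall f, Kspace O f -> cvgn (fun i => vfun (w i) f).
Proof.
move=> wcvg f Kf.
have Kn := Kspace_norm (@bundle_hausdorff R n) Kf.
have Kp := KspaceD (@bundle_hausdorff R n) Kn Kf.
have c1 := wcvg _ Kn (fun z => normr_ge0 _).
have c2 : cvgn (fun i => vfun (w i) (fun z => `|f z| + f z)).
  by apply: wcvg => // z; have := ler_norm (- f z); rewrite normrN; lra.
rewrite (_ : (fun i => _) = (fun i => vfun (w i) (fun z => `|f z| + f z)) -
    (fun i => vfun (w i) (fun z => `|f z|))).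
  exact: is_cvgB.
by apply/funext => i; rewrite !fctE (vfunD oU _ Kn Kf) addrC addKr.
Qed.

Lemma vfun_linear V a f g h : Kspace O f -> Kspace O g ->
  (forall z, h z = a * f z + g z) -> vfun V h = a * vfun V f + vfun V g.
Proof.
move=> Kf Kg /funext ->; have Ka := KspaceZ (@bundle_hausdorff R n) a Kf.
by rewrite (vfunD oU V Ka Kg) (vfunZ oU V a Kf).
Qed.

Lemma vdual_daniell V : daniell (vdual V).
Proof.
exists (vdual V), (cst 0); split; [split|split|] => //.
- by move=> a f g h hE; exact: vfun_linear (set_valP f) (set_valP g) hE.
- by move=> f f0; apply: vfun_ge0.
- by move=> a f g h _ /=; rewrite mulr0 addr0.
- by move=> f; rewrite subr0.
Qed.

(* For comparable varifolds [|f| <= k] gives [|V f - W f| <= |V k - W k|], which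
   turns convergence on one bump [k] into uniform convergence on a bounded set. *)
Lemma strong_limit (P : set (varifold m U)) w :
  strong_closed (vdual (U := U) @` P) ->
  (forall i j, vle (w i) (w j) \/ vle (w j) (w i)) ->
  (forall f, Kspace O f -> (forall z, 0 <= f z) -> cvgn (fun i => vfun (w i) f)) ->
  (\forall i \near \oo, P (w i)) ->
  exists2 W, P W & vcvg w W.
Proof.
move=> cP comp /vfun_cvgn wcvg PW.
pose L (f : Kspace O) : R := limn (fun i => vfun (w i) (set_val f)).
have LE (f : Kspace O) : vfun (w i) (set_val f) @[i --> \oo] --> L f.
  by apply: wcvg; exact: set_valP.
have LD : daniell L.
  exists L, (cst 0); split; [split|split|].
  - move=> a f g h hE; apply: cvg_lim => //.
    rewrite (_ : (fun i => _) = (fun i => a * vfun (w i) (set_val f)) \+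
        (fun i => vfun (w i) (set_val g))).
      by apply: cvgD; [apply: cvgMr|]; exact: LE.
    by apply/funext => i /=; exact: vfun_linear (set_valP f) (set_valP g) hE.
  - move=> f f0; apply: limr_ge; first exact: LE.
    by apply: nearW => i; apply: vfun_ge0.
  - by move=> a f g h _ /=; rewrite mulr0 addr0.
  - by move=> f _ /=.
  - by move=> f; rewrite subr0.
have famL : {family @Kbounded R bundle O, (fun i => vdual (w i)) @ \oo --> L}.
  apply/fam_cvgP => _ [K [cK KO] <-].
  have [k [Kk k0 k1]] := bundle_bump oU cK KO.
  move=> B /uniform_nbhs[E [entE EB]].
  have [e e0 eE] : exists2 e : R, 0 < e & forall a b : R, `|a - b| < e -> E (a, b).
    by move: entE; rewrite -entourage_ballE => -[e e0 eE]; exists e => // a b ab; apply: eE.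
  have /cvgrPdist_lt/(_ e e0)[N _ HN] := wcvg _ Kk.
  exists N => // i Ni; apply: EB => f [fK f1]; apply: eE.
  have Kf : Kspace O (set_val f) := set_valP f.
  apply: (le_lt_trans _ (HN i Ni)).
  have cn (h : bundle -> R) l : vfun (w j) h @[j --> \oo] --> l ->
      `|vfun (w j) h - vfun (w i) h| @[j --> \oo] --> `|l - vfun (w i) h|.
    by move=> hl; apply: cvg_norm; apply: cvgB => //; exact: cvg_cst.
  (* The limit [L] is not yet known to come from a varifold, so [w i] is compared with [w j] and
     then [j] tends to infinity. *)
  apply: (ler_cvg_to (cn _ _ (LE f)) (cn _ _ (wcvg _ Kk))).
  apply: nearW => j; apply: comparable_diff_bound => //.
  move=> z; have [sz|sz] := pselect (spt (set_val f) z).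
    by rewrite k1 ?f1//; exact: fK.
  by rewrite (spt_out sz) normr0.
have /cP : closure (vdual (U := U) @` P : set (subspace (daniell (O := O) : set {family @Kbounded R bundle O, Kspace O -> R}))) L.
  move=> B; rewrite /nbhs/= -nbhs_subspace_in // => nB.
  have /famL[N _ HN] : nbhs (L : {family @Kbounded R bundle O, Kspace O -> R}) [set x | daniell x -> B x] by exact: nB.
  case: PW => M _ HM; exists (vdual (w (maxn M N))); split.
    by exists (w (maxn M N)) => //; apply: HM; rewrite /= leq_maxl.
  apply: HN; first by rewrite /= leq_maxr.
  exact: vdual_daniell.
move=> [W PWW WL]; exists W => // f Kf.
have := LE (exist _ f (mem_set Kf)); rewrite -WL.
exact.
Qed.

End varifold_limits.

Section splittings.
Context {R : realType} {n m : nat} {U : set 'rV[R]_n}.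
Hypothesis oU : open U.
Local Notation bundle := ('rV[R]_n * subspaces R n)%type.
Local Notation O := (UG m U).
Implicit Types (V W Z : varifold m U) (w : nat -> varifold m U) (f k : bundle -> R).
Local Notation vzero := (vzero m U).

Lemma vsumC V W Z : vsum V W Z -> vsum W V Z.
Proof. by move=> h k Kk; rewrite h// addrC. Qed.

Lemma vsum_vzero V : vsum V vzero V.
Proof. by move=> k Kk; rewrite vfun_vzero addr0. Qed.

Lemma vle_trans W V Z : vle V W -> vle W Z -> vle V Z.
Proof. by move=> VW WZ k Kk k0; exact: le_trans (VW k Kk k0) (WZ k Kk k0). Qed.

Lemma delta_norm_vzero A : delta_norm vzero A = 0%E.
Proof.
apply/eqP; rewrite eq_le delta_norm_ge0// andbT delta_normE//.
apply: (@le_trans _ _ (variation vzero U)).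
  by apply: variation_outer_le => // x [].
apply: ge_ereal_sup => _ [g _ <-].
by rewrite first_variationE vfun_vzero.
Qed.

Definition split_sum V W Z : Prop := vsum W Z V /\ splits_variation V W Z.

Lemma split_sumC V W Z : split_sum V W Z -> split_sum V Z W.
Proof. by move=> [s d]; split; [exact: vsumC|move=> A; rewrite d addeC]. Qed.

Lemma split_sum_vle V W Z : split_sum V W Z -> vle W V.
Proof. by move=> [s _]; exact: vle_vsum s. Qed.

Lemma split_sum_delta_le V W Z A : split_sum V W Z ->
  (delta_norm W A <= delta_norm V A)%E.
Proof. by move=> [_ ->]; rewrite leeDl// delta_norm_ge0. Qed.

Lemma split_sum_vzero V : split_sum V V vzero.
Proof.
by split; [exact: vsum_vzero|move=> A; rewrite delta_norm_vzero adde0].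
Qed.

(** The variation of [V] is the sum of those of [A], [B] and [Z], hence at least that of [A] plus
    that of [B + Z]; subadditivity gives the reverse inequality. *)
Lemma split_sum_trans V W Z A B : split_sum V W Z -> split_sum W A B ->
  exists2 T, vsum B Z T & split_sum V A T.
Proof.
move=> [sV dV] [sW dW]; have [T sT] := vsum_ex oU B Z.
exists T => //.
have sAT : vsum A T V by move=> k Kk; rewrite sV// sW// sT// addrA.
split => // C; apply/eqP; rewrite eq_le (delta_norm_vsum oU _ sAT)/=.
by rewrite dV dW -addeA leeD2l// delta_norm_vsum.
Qed.

(** One inequality is subadditivity. For the other, test fields nearly optimal for [W] and for [Z]
    on an open set are nearly optimal for [w j] and [z j] at a common large [j], where the
    variations add up to that of [V]. *)
Lemma split_sum_limit V w z W Z : (forall j, split_sum V (w j) (z j)) ->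
  vcvg w W -> vcvg z Z -> split_sum V W Z.
Proof.
move=> s wW zZ.
have sV : vsum W Z V.
  move=> k Kk; apply: (@cvg_unique _ (@norm_hausdorff _ R^o) (vfun (w j) k + vfun (z j) k @[j --> \oo])).
    rewrite (_ : (fun j => _) = cst (vfun V k)); first exact: cvg_cst.
    by apply/funext => j; rewrite (s j).1.
  by apply: cvgD; [exact: wW|exact: zZ].
split => // A; apply/eqP; rewrite eq_le (delta_norm_vsum oU _ sV)/=.
apply: delta_norm_sum_le => // G oG GU; apply: lee_addl_approx; rewrite ?variation_ge0//.
have near_test (y : nat -> varifold m U) (Y : varifold m U) g c : vcvg y Y -> test_field G g -> (c%:E < (first_variation Y g)%:E)%E ->
    \forall j \near \oo, (c%:E <= variation (y j) G)%E.
  move=> yY gT; rewrite lte_fin first_variationE => cg.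
  have [sg cpg gG _] := gT.
  have Kg := divergenceK_Kspace m sg cpg (subset_trans gG GU).
  have : \forall j \near \oo, c < vfun (y j) (divergenceK m g).
    exact: cvgr_gt (yY _ Kg) _ cg.
  apply: filterS => j cj; apply: (le_trans _ (le_variation_test (y j) gT)).
  by rewrite lee_fin first_variationE ltW.
move=> a b /ereal_sup_gt[_ [g gT <-] ag] /ereal_sup_gt[_ [h hT <-] bh].
have [j [aj bj]] := filter_ex (filterI (near_test _ _ _ _ wW gT ag) (near_test _ _ _ _ zZ hT bh)).
rewrite EFinD (le_trans (leeD aj bj))//.
by rewrite -!(delta_norm_open oU)// -(s j).2.
Qed.

Lemma vle_cvgn w : (forall i, vle (w i.+1) (w i)) ->
  forall f, Kspace O f -> (forall z, 0 <= f z) -> cvgn (fun i => vfun (w i) f).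
Proof.
move=> wle f Kf f0; apply: nonincreasing_is_cvgn.
  by apply/nonincreasing_seqP => i; exact: wle.
by exists 0 => _ [i _ <-]; exact: vfun_ge0.
Qed.

End splittings.

Section appropriate_families.
Context {R : realType} {n m : nat} {U : set 'rV[R]_n}.
Hypothesis oU : open U.
Local Notation bundle := ('rV[R]_n * subspaces R n)%type.
Local Notation O := (UG m U).
Implicit Types (V W Z : varifold m U) (w : nat -> varifold m U) (f k : bundle -> R).
Local Notation vzero := (vzero m U).
Variable P : set (varifold m U).
Hypothesis aP : appropriate P.
Local Notation Q := (P `|` [set vzero]).

Lemma appropriate0_vsum V W Z : Q V -> Q W -> vsum V W Z -> Q Z.
Proof.
have [_ addP _ _] := aP.
move=> [PV|->] [PW|->] s.
- by left; exact: addP s.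
- by left; have <- : V = Z by apply: (varifold_eq oU) => k Kk; rewrite s// vfun_vzero addr0.
- by left; have <- : W = Z by apply: (varifold_eq oU) => k Kk; rewrite s// vfun_vzero add0r.
- by right; apply: (varifold_eq oU) => k Kk; rewrite s// !vfun_vzero addr0.
Qed.

Lemma appropriate0_dense W : Q W -> dense_points W.
Proof. by have [_ _ dP _] := aP => -[/dP//|->]; rewrite /dense_points /weight. Qed.

(** Either the sequence is eventually in [P] and strong closedness applies, or it is 0 infinitely
    often, and then its limit is 0. *)
Lemma appropriate0_limit w : (forall i, Q (w i)) ->
  (forall i j, vle (w i) (w j) \/ vle (w j) (w i)) ->
  (forall f, Kspace O f -> (forall z, 0 <= f z) -> cvgn (fun i => vfun (w i) f)) ->
  exists2 W, Q W & vcvg w W.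
Proof.
move=> Qw comp wcvg; have [_ _ _ cP] := aP.
have [PW|nPW] := pselect (\forall i \near \oo, P (w i)).
  by have [W PW' wW] := strong_limit oU cP comp wcvg PW; exists W => //; left.
exists vzero; first by right.
have often N : exists2 i, (N <= i)%N & w i = vzero.
  apply: contrapT => nex; apply: nPW; exists N => // i Ni.
  by have [//|wi] := Qw i; case: nex; exists i.
move=> f Kf; rewrite vfun_vzero.
have cf := vfun_cvgn oU wcvg Kf.
suff : limn (fun i => vfun (w i) f) = 0 by move=> <-.
apply/eqP; rewrite -normr_le0; apply/ler_addgt0Pr => e e0; rewrite add0r.
have /cvgrPdist_le/(_ e e0)[N _ HN] := cf.
by have [i Ni wi] := often N; have := HN i Ni; rewrite /= wi vfun_vzero subr0.
Qed.

(** For fixed [i] the complements of [w (i + p)] in [w i] form a monotone sequence too, so they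
    converge within [Q], and the splittings pass to the limit together with both parts. *)
Lemma chain_limit w : (forall j, Q (w j)) ->
  (forall j, exists2 Z, Q Z & split_sum (w j) (w j.+1) Z) ->
  exists W, [/\ Q W, vcvg w W & forall i, exists2 T, Q T & split_sum (w i) W T].
Proof.
move=> Qw sw.
have wS j : vle (w j.+1) (w j) by have [Z _ /split_sum_vle] := sw j.
have wle i p : vle (w (i + p)%N) (w i).
  elim: p => [|p IH]; first by rewrite addn0.
  by rewrite addnS; exact: vle_trans (wS _) IH.
have wcomp i j : vle (w i) (w j) \/ vle (w j) (w i).
  by case: (leqP i j) => [/subnKC <-|/ltnW/subnKC <-]; [right|left]; exact: wle.
have wcvg := vle_cvgn wS.
have [W QW wW] := appropriate0_limit Qw wcomp wcvg.
exists W; split => // i.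
have ex p : exists T, Q T /\ split_sum (w i) (w (i + p)%N) T.
  elim: p => [|p [T [QT sT]]].
    by rewrite addn0; exists vzero; split; [right|exact: split_sum_vzero].
  have [Z QZ sZ] := sw (i + p)%N.
  have [T' s' sT'] := split_sum_trans oU sT sZ.
  by exists T'; rewrite addnS; split => //; exact: appropriate0_vsum s'.
have [t tP] := choice ex.
have tE p f : Kspace O f -> vfun (t p) f = vfun (w i) f - vfun (w (i + p)%N) f.
  by move=> Kf; have [_ [s _]] := tP p; rewrite s// addrC addKr.
have shift f : Kspace O f -> vfun (w (i + p)%N) f @[p --> \oo] --> vfun W f.
  by move=> /wW; rewrite -(cvg_shiftn i); under eq_fun do rewrite addnC.
have [T QT tT] : exists2 T, Q T & vcvg t T.
  apply: appropriate0_limit; first by move=> p; have [] := tP p.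
    move=> p q; have [h|h] := wcomp (i + p)%N (i + q)%N; [right|left] => f Kf f0;
      by rewrite !tE// lerD2l lerN2; exact: h.
  move=> f Kf f0; rewrite (funext (fun p => tE p f Kf)).
  by apply: is_cvgB; [exact: is_cvg_cst|apply/cvg_ex; exists (vfun W f); exact: shift].
exists T => //; apply: (@split_sum_limit _ _ _ _ oU (w i) (fun p => w (i + p)%N) t) => //.
by move=> p; have [] := tP p.
Qed.

Lemma indecomposableP V :
  ~ (exists W Z, [/\ Q W, W <> vzero, Q Z, Z <> vzero & split_sum V W Z]) ->
  indecomposable P V.
Proof.
move=> nex [W [Z [[PW W0] d [PZ Z0] s]]]; apply: nex; exists W, Z; split => //; [by left|by left|].
by split => // k Kk; rewrite d// addrC subrK.
Qed.

End appropriate_families.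

(** * Indecomposable pieces *)

Section indecomposable_pieces.
Context {R : realType} {n m : nat} {U : set 'rV[R]_n}.
Hypothesis oU : open U.
Local Notation bundle := ('rV[R]_n * subspaces R n)%type.
Local Notation O := (UG m U).
Implicit Types (V W X Y Z A B T : varifold m U) (w : nat -> varifold m U) (f k : bundle -> R).
Local Notation vzero := (vzero m U).
Variable P : set (varifold m U).
Hypothesis aP : appropriate P.
Local Notation Q := (P `|` [set vzero]).

Definition piece V W : Prop := Q W /\ exists2 T, Q T & split_sum V W T.

Lemma piece_refl V : Q V -> piece V V.
Proof. by move=> QV; split => //; exists vzero; [right|exact: split_sum_vzero]. Qed.

Lemma piece_trans V W X : piece V W -> piece W X -> piece V X.
Proof.
move=> [QW [T QT sV]] [QX [S QS sW]]; split => //.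
have [T' s' sT'] := split_sum_trans oU sV sW.
by exists T' => //; exact: (appropriate0_vsum oU aP QS QT s').
Qed.

Lemma piece_vle V W : piece V W -> vle W V.
Proof. by move=> [_ [T _ /split_sum_vle]]. Qed.

Lemma piece_delta_le V W (S : set 'rV[R]_n) : piece V W ->
  (delta_norm W S <= delta_norm V S)%E.
Proof. by move=> [_ [T _ s]]; exact: split_sum_delta_le s. Qed.

Lemma split_sum_pieces V A B : Q A -> Q B -> split_sum V A B -> piece V A /\ piece V B.
Proof.
move=> QA QB s; split; split => //; first by exists B.
by exists A => //; exact: split_sumC.
Qed.

Variable V : varifold m U.
Hypothesis fV : finite_on_compacts U (delta_norm V).
Variables (b : nat -> varifold m U -> Prop) (k : nat -> bundle -> R) (d : nat -> R).
Hypothesis b_mono : forall i j W, (i <= j)%N -> b i W -> b j W.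
Hypothesis b_split : forall i W Z T, vsum W Z T -> b i T -> b i W \/ b i Z.
Hypothesis b_le : forall i W Z, vle W Z -> b i W -> b i Z.
Hypothesis kP : forall i, [/\ Kspace O (k i), forall z, 0 <= k i z & 0 < d i].
Hypothesis b_lower : forall i W, dense_points W ->
  (forall S, (delta_norm W S <= delta_norm V S)%E) -> b i W -> d i <= vfun W (k i).
Hypothesis b_ex : forall W, vle W V -> W <> vzero -> exists i, b i W.

Lemma piece_lower i W : piece V W -> b i W -> d i <= vfun W (k i).
Proof.
move=> pW; apply: b_lower; first by case: pW => QW _; exact: appropriate0_dense QW.
by move=> B; exact: piece_delta_le.
Qed.

Definition atomic i W := ~ exists A B, [/\ Q A, Q B, split_sum W A B, b i A & b i B].

(* Splitting off a part that charges the [i]-th set costs at least [d i] of the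
   integral of [k i], so that this can be done only finitely often. *)
Lemma atomic_piece i0 i W : piece V W -> b i0 W ->
  exists X, [/\ piece W X, b i0 X & atomic i X].
Proof.
have [Kk k0 d0] := kP i.
have [N] : exists N : nat, vfun W (k i) < N%:R * d i.
  exists (Num.truncn (vfun W (k i) / d i)).+1.
  by rewrite -ltr_pdivrMr// truncnS_gt.
elim: N W => [|N IH] W WN pW bW.
  by have := vfun_ge0 W k0; rewrite leNgt; move: WN; rewrite mul0r => ->.
have [|/contrapT[A [B [QA QB s bA bB]]]] := pselect (atomic i W).
  by exists W; split => //; apply: piece_refl; case: pW.
(* One part still charges the set of index [i0], and the search continues in it; the other part
   charges the [i]-th set and takes away at least [d i]. *)
wlog bA0 : A B QA QB s bA bB / b i0 A.
  move=> H; have [h|h] := b_split s.1 bW; first exact: (H A B).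
  by apply: (H B A) => //; exact: split_sumC.
have [pA pB] := split_sum_pieces QA QB s.
have dB := piece_lower (piece_trans pW pB) bB.
have [|X [pX bX aX]] := IH A _ (piece_trans pW pA) bA0.
  by move: WN; rewrite (s.1 _ Kk) -natr1 mulrDl mul1r; lra.
by exists X; split => //; exact: piece_trans pA pX.
Qed.

Lemma exists_indecomposable W : piece V W -> W <> vzero ->
  exists X, [/\ piece W X, X <> vzero & indecomposable P X].
Proof.
move=> pW W0; have [i0 bW] := b_ex (piece_vle pW) W0.
have step (jY : nat * varifold m U) : exists X, piece V jY.2 -> b i0 jY.2 ->
    [/\ piece jY.2 X, b i0 X & atomic (i0 + jY.1) X].
  have [[pY bY]|nY] := pselect (piece V jY.2 /\ b i0 jY.2).
    by have [X XP] := atomic_piece (i0 + jY.1) pY bY; exists X.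
  by exists V => pY bY; case: nY.
have [F FP] := choice step.
pose w j := nat_rect (fun=> varifold m U) W (fun j Y => F (j, Y)) j.
have wP j : piece V (w j) /\ b i0 (w j).
  elim: j => [|j [pj bj]]; first by [].
  have [pS bS _] := FP (j, w j) pj bj.
  by split => //; exact: piece_trans pj pS.
have wS j : piece (w j) (w j.+1) /\ atomic (i0 + j) (w j.+1).
  by have [pj bj] := wP j; have [] := FP (j, w j) pj bj.
have Qw j : Q (w j) by have [[]] := wP j.
have sw j : exists2 Z, Q Z & split_sum (w j) (w j.+1) Z by have [[_]] := wS j.
have [X [QX wX pX]] := chain_limit oU aP Qw sw.
have pwX j : piece (w j) X by split.
exists X; split; first exact: pwX 0%N.
  (* Every [w j] has integral at least [d i0] against [k i0], hence so has the limit. *)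
  have [Kk k0 d0] := kP i0.
  move=> X0; have : d i0 <= vfun X (k i0).
    apply: (cvgr_to_ge (wX _ Kk)); apply: nearW => j.
    by have [pj bj] := wP j; exact: piece_lower.
  by rewrite X0 vfun_vzero leNgt d0.
apply: (indecomposableP (P := P)) => -[A [B [QA A0 QB B0 s]]].
have [pA pB] := split_sum_pieces QA QB s.
have pVX := piece_trans pW (pwX 0%N).
have [a ba] := b_ex (piece_vle (piece_trans pVX pA)) A0.
have [c bc] := b_ex (piece_vle (piece_trans pVX pB)) B0.
(* A splitting of [X] into [A] and [B] would split [w (a + c).+1] into [A] and [B + T], both
   charging the set of index [i0 + (a + c)], against its atomicity. *)
have [_ [T QT sT]] := pwX (a + c).+1.
have [T' s' sT'] := split_sum_trans oU sT s.
have [_ ] := wS (a + c)%N; apply; exists A, T'; split => //.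
- exact: (appropriate0_vsum oU aP QB QT s').
- by apply: b_mono ba; rewrite addnA addnAC leq_addl.
- apply: b_le (vle_vsum s') _; apply: b_mono bc; by rewrite addnA leq_addl.
Qed.

End indecomposable_pieces.

(** * Exhaustion by indecomposable pieces *)

(* [r] and [rb] are the values of an additive [p] and of its dominant [pb] on
   the remainders left after each stage. *)
Lemma sums_of_stages (R : realType) (I : choiceType) (x : nat -> I) (z : I)
    (N : I -> nat) (p pb : I -> R) (r rb : nat -> R) :
  p z = 0 ->
  (forall i, r i = p (x i) + r i.+1) -> (forall i, rb i = pb (x i) + rb i.+1) ->
  (forall i, `|p (x i)| <= pb (x i)) -> (forall i, `|r i| <= rb i) ->
  rb i @[i --> \oo] --> 0 ->
  (forall W, W <> z -> forall i, (N W <= i)%N -> x i <> W) ->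
  sums_to [set W | W <> z /\ exists i, x i = W]
    (fun W => (\sum_(i < N W) (x i == W))%:R * p W) (r 0%N).
Proof.
move=> pz rS rbS ppb rrb rb0 xN e e0.
have /cvgrPdist_lt/(_ e e0)[M _ HM] := rb0.
have rbM : rb M < e by have := HM M (leqnn M); rewrite /= sub0r normrN => /(le_lt_trans (ler_norm _)).
exists [set W | W <> z /\ exists2 i, (i < M)%N & x i = W].
  split; last by move=> W [Wz [i _ xi]]; split => //; exists i.
  apply: (@sub_finite_set _ _ (x @` `I_M)); last exact/finite_image/finite_II.
  by move=> W [_ [i iM <-]]; exists i.
move=> F fF F0F FH.
(* From stage [K] on no member of [F] occurs, so multiplicities can all be counted over the first
   [K] stages. *)
pose K := (M + \sum_(W <- finmap.enum_fset (fset_set F)) N W)%N.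
have KN W : F W -> (N W <= K)%N.
  move=> FW; rewrite /K (big_rem W) /=; last by rewrite in_fset_set// mem_set.
  by rewrite addnCA leq_addr.
have rK k : r 0%N = \sum_(i < k) p (x i) + r k.
  elim: k => [|k IH]; first by rewrite big_ord0 add0r.
  by rewrite big_ord_recr /= -addrA -rS.
have rbK k : rb M = \sum_(i < k) pb (x (M + i)%N) + rb (M + k)%N.
  elim: k => [|k IH]; first by rewrite big_ord0 add0r addn0.
  by rewrite big_ord_recr /= -addrA addnS -rbS.
have NE W : F W -> (\sum_(i < N W) (x i == W))%N = (\sum_(i < K) (x i == W))%N.
  move=> FW; have [Wz _] := FH _ FW.
  rewrite -(subnKC (KN _ FW)) big_split_ord /= [X in (_ = _ + X)%N]big1 ?addn0// => i _.
  by apply/eqP; rewrite eqb0; apply/eqP; apply: xN => //; rewrite leq_addr.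
have -> : \sum_(W \in F) (\sum_(i < N W) (x i == W))%:R * p W =
    \sum_(i < K) (if x i \in F then p (x i) else 0).
  rewrite fsbig_finite//=.
  transitivity (\sum_(W <- finmap.enum_fset (fset_set F)) \sum_(i < K) (x i == W)%:R * p W).
    rewrite !big_seq; apply: eq_bigr => W; rewrite in_fset_set// => /set_mem FW.
    by rewrite NE// natr_sum mulr_suml.
  rewrite exchange_big /=; apply: eq_bigr => i _; case: ifPn => xF.
    rewrite (bigD1_seq (x i))/= ?finmap.fset_uniq ?in_fset_set// eqxx mul1r big1 ?addr0// => W Wx.
    by rewrite eq_sym (negbTE Wx) mul0r.
  rewrite big_seq big1// => W; rewrite in_fset_set// => WF.
  by case: eqP => [xW|_]; rewrite ?mul0r//; rewrite xW WF in xF.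
(* The stages before [M] cancel, being in [F] or equal to [z]. The stages from [M] to [K] and the
   remainder [r K] are together dominated by [rb M]. *)
rewrite (rK K) opprD addrA -sumrB.
apply: (le_lt_trans _ rbM); rewrite (rbK (K - M)%N) subnKC ?leq_addr//.
apply: (le_trans (ler_normB _ _)); apply: lerD; last exact: rrb.
apply: (le_trans (ler_norm_sum _ _ _)).
have -> : K = (M + (K - M))%N by rewrite subnKC// leq_addr.
rewrite big_split_ord /= addKn -[leRHS]add0r; apply: lerD.
  rewrite big1// => i _; case: ifPn => [_|xF]; first by rewrite subrr normr0.
  suff -> : x i = z by rewrite pz subr0 normr0.
  by apply: contrapT => xz; move: xF; rewrite mem_set//; apply: F0F; split => //; exists i.
apply: ler_sum => i _; case: ifPn => _; last by rewrite sub0r normrN; exact: ppb.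
by rewrite subrr normr0 (le_trans _ (ppb _)).
Qed.

Section exhaustion.
Context {R : realType} {n m : nat} {U : set 'rV[R]_n}.
Hypothesis oU : open U.
Implicit Types (V W Z : varifold m U) (v : nat -> varifold m U) (f : 'rV[R]_n -> R).
Local Notation vzero := (vzero m U).

Lemma delta_norm_Rintegral V W Z f : finite_on_compacts U (delta_norm V) ->
  splits_variation V W Z -> Kspace U f ->
  Rintegral (delta_norm V) U f =
  Rintegral (delta_norm W) U f + Rintegral (delta_norm Z) U f.
Proof.
move=> fV s Kf; have hT : hausdorff_space 'rV[R]_n := @norm_hausdorff _ _.
have fW : finite_on_compacts U (delta_norm W).
  move=> K cK KU; apply: (le_lt_trans _ (fV K cK KU)).
  by rewrite s leeDl// delta_norm_ge0.
have fZ : finite_on_compacts U (delta_norm Z).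
  move=> K cK KU; apply: (le_lt_trans _ (fV K cK KU)).
  by rewrite s leeDr// delta_norm_ge0.
have -> : delta_norm V = measure_add (delta_norm W) (delta_norm Z).
  by apply: measure_eq => A; rewrite s [RHS]measure_addE.
have mU : measurable (U : set (borel 'rV[R]_n)) := measurable_open oU.
have iW := Kspace_integrable hT oU fW Kf.
have iZ := Kspace_integrable hT oU fZ Kf.
rewrite /Rintegral integral_measure_add// [LHS]fineD//; exact: integrable_fin_num.
Qed.

(** Convergence to 0 alone would not bound the variation from above. Here a field nearly optimal for
    [V] is, for large [i], nearly optimal for the complement of [v i], whose variation is then
    almost that of [V]; additivity leaves little for [v i]. *)
Lemma delta_norm_vanishes V v (G : set 'rV[R]_n) : open G -> G `<=` U ->
  (delta_norm V G < +oo)%E -> vcvg v vzero ->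
  (forall i, exists T, split_sum V (v i) T) ->
  forall e, 0 < e -> \forall i \near \oo, (delta_norm (v i) G <= e%:E)%E.
Proof.
move=> oG GU VG v0 sv e e0; have e2 : 0 < e / 2 by rewrite divr_gt0.
have VGf : delta_norm V G \is a fin_num by rewrite ge0_fin_numE// delta_norm_ge0.
have : ((fine (delta_norm V G) - e / 2)%:E < delta_norm V G)%E.
  by rewrite -[ltRHS]fineK// lte_fin ltrBlDr ltrDl.
rewrite [X in (_ < X)%E](delta_norm_open oU)// => /ereal_sup_gt[_ [g gT <-]].
rewrite lte_fin => gV; have [sg cg gG _] := gT.
have Kg := divergenceK_Kspace m sg cg (subset_trans gG GU).
have : \forall i \near \oo, vfun (v i) (divergenceK m g) < e / 2.
  by apply: (cvgr_lt _ (v0 _ Kg)); rewrite vfun_vzero.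
apply: filterS => i vi; have [T [sT dT]] := sv i.
have fvT : first_variation V g = first_variation (v i) g + first_variation T g.
  by rewrite !first_variationE sT.
have Tg := delta_norm_ge_test oU T oG GU gT.
have vif : delta_norm (v i) G \is a fin_num.
  rewrite ge0_fin_numE ?delta_norm_ge0//; apply: (le_lt_trans _ VG).
  by rewrite dT leeDl// delta_norm_ge0.
have Tf : delta_norm T G \is a fin_num.
  rewrite ge0_fin_numE ?delta_norm_ge0//; apply: (le_lt_trans _ VG).
  by rewrite dT leeDr// delta_norm_ge0.
have dE : fine (delta_norm V G) = fine (delta_norm (v i) G) + fine (delta_norm T G).
  by rewrite dT fineD.
rewrite -(fineK Tf) lee_fin in Tg.
rewrite -(fineK vif) lee_fin.
rewrite first_variationE in fvT; rewrite (first_variationE (v i)) in fvT.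
move: gV; rewrite first_variationE fvT dE.
by move: vi Tg; move: (vfun _ _) (first_variation _ _) (fine _) (fine _) => p q s t; lra.
Qed.

Lemma delta_norm_Rintegral_vanishes V v f : finite_on_compacts U (delta_norm V) ->
  vcvg v vzero -> (forall i, exists T, split_sum V (v i) T) ->
  Kspace U f -> Rintegral (delta_norm (v i)) U (fun x => `|f x|) @[i --> \oo] --> 0.
Proof.
move=> fV v0 sv Kf; have hT : hausdorff_space 'rV[R]_n := @norm_hausdorff _ _.
have Kn := Kspace_norm hT Kf.
have [M M0 Mf] := Kspace_bounded Kf.
have [cf kf fU] := Kf.
have [b [_ _ [G [oG KG G1]] [L [cL LU L0]]]] := smooth_urysohn kf oU fU.
have GL : G `<=` L.
  by move=> x Gx; apply: contrapT => /L0; rewrite G1// => /eqP; rewrite oner_eq0.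
have VG : (delta_norm V G < +oo)%E.
  by apply: (le_lt_trans (le_delta_norm oU V GL)); exact: fV.
apply/cvgrPdist_le => e e0.
have := delta_norm_vanishes oG (subset_trans GL LU) VG v0 sv (divr_gt0 e0 M0).
apply: filterS => i vi.
have fv : finite_on_compacts U (delta_norm (v i)).
  have [T sT] := sv i; move=> K cK KU; apply: (le_lt_trans _ (fV K cK KU)).
  exact: split_sum_delta_le sT.
rewrite sub0r normrN -lee_fin.
have nM x : `| `|f x| | <= M by rewrite normr_id.
have out x : U x -> ~ G x -> `|f x| = 0.
  by move=> _ nG; rewrite (spt_out (fun s => nG (KG _ s))) normr0.
apply: (le_trans (Kintegral_le_measure hT oU fv Kn (ltW M0) (measurable_open oG) nM out)).
apply: (le_trans (lee_wpmul2l _ vi)); first by rewrite lee_fin ltW.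
by rewrite -EFinM lee_fin mulrCA divff ?mulr1// gt_eqF.
Qed.

End exhaustion.

Section greedy_decomposition.
Context {R : realType} {n m : nat} {U : set 'rV[R]_n}.
Hypotheses (oU : open U) (m0 : (0 < m)%N).
Implicit Types (V W X Y Z T : varifold m U).
Local Notation vzero := (vzero m U).
Variable P : set (varifold m U).
Hypothesis aP : appropriate P.
Local Notation Q := (P `|` [set vzero]).

(* At stage [n.+1 = 2 ^ i * odd] an indecomposable piece charging the [i]-th set
   is removed if there is one, so that every [i] is treated infinitely often. *)
Lemma exhausting_stages V : P V -> finite_on_compacts U (delta_norm V) ->
  exists (v x : nat -> varifold m U) (N : varifold m U -> nat),
  [/\ v 0%N = V, vcvg v vzero,
      forall j, piece P V (v j) /\ split_sum (v j) (x j) (v j.+1),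
      forall j, piece P V (x j) /\ (x j = vzero \/ indecomposable P (x j)) &
      forall W, W <> vzero -> forall j, (N W <= j)%N -> x j <> W].
Proof.
move=> PV fV.
have [b [k [d [bmono [bsplit ble] kP blower bex]]]] := charged_pieces oU m0 fV.
pose ind W := W <> vzero /\ indecomposable P W.
have step (iW : nat * varifold m U) : exists XR : varifold m U * varifold m U, Q iW.2 ->
    [/\ split_sum iW.2 XR.1 XR.2, Q XR.1 /\ Q XR.2,
        XR.1 = vzero \/ indecomposable P XR.1 &
        (exists Y, [/\ piece P iW.2 Y, ind Y & b iW.1 Y]) -> b iW.1 XR.1].
  case: iW => i W /=.
  have [[Y [[QY [T QT s]] [Y0 iY] bY]]|nY] :=
      pselect (exists Y, [/\ piece P W Y, ind Y & b i Y]).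
    by exists (Y, T) => _; split => //; right.
  exists (vzero, W) => QW; split => //; [|by split => //; right|by left].
  exact/split_sumC/split_sum_vzero.
have [F FP] := choice step.
pose v j := nat_rect (fun=> varifold m U) V (fun j W => (F (logn 2 j.+1, W)).2) j.
pose x j := (F (logn 2 j.+1, v j)).1.
have Qv j : Q (v j).
  by elim: j => [|j IH]; [left|have [_ []] := FP (logn 2 j.+1, v j) IH].
have st j := FP (logn 2 j.+1, v j) (Qv j).
have sv j : split_sum (v j) (x j) (v j.+1) by have [] := st j.
have Qx j : Q (x j) by have [_ []] := st j.
have pv j : piece P V (v j).
  elim: j => [|j IH]; first by apply: piece_refl => //; exact: Qv 0%N.
  exact: (piece_trans oU aP IH (split_sum_pieces (Qx j) (Qv j.+1) (sv j)).2).
have px j : piece P V (x j).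
  exact: (piece_trans oU aP (pv j) (split_sum_pieces (Qx j) (Qv j.+1) (sv j)).1).
have low := piece_lower aP blower.
have sw j : exists2 Z, Q Z & split_sum (v j) (v j.+1) Z.
  by exists (x j) => //; exact: split_sumC.
have [W [QW vW pW]] := chain_limit oU aP Qv sw.
(* The remainders converge on [k i], and consecutive ones differ there by the value of [x j], which
   is at least [d i] if [x j] charges the [i]-th set. *)
have few i : exists M, forall j, (M <= j)%N -> ~ b i (x j).
  have [Kk k0 d0] := kP i.
  have /cvgrPdist_lt/(_ _ (divr_gt0 d0 (ltr0n _ 2)))[M _ HM] := vW _ Kk.
  exists M => j Mj bx; have := low i _ (px j) bx.
  have := HM j Mj; have := HM j.+1 (leqW Mj); rewrite /= ((sv j).1 _ Kk).
  rewrite !ltr_norml => /andP[h1 h2] /andP[h3 h4].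
  move: h1 h2 h3 h4.
  by move: (vfun W _) (vfun (x j) _) (vfun (v j.+1) _) (d i) => p q r s; lra.
(* An indecomposable piece of a nonzero limit is a piece of every remainder. So whenever the index
   of the set that it charges comes up, a piece charging this set is removed, against [few]. *)
have W0 : W = vzero.
  apply: contrapT => W0.
  have pVW : piece P V W by have := pW 0%N.
  have [Y [pY Y0 iY]] := exists_indecomposable oU aP bmono bsplit ble kP blower bex pVW W0.
  have [i bi] := bex _ (piece_vle (piece_trans oU aP pVW pY)) Y0.
  have [M HM] := few i.
  (* A stage treating the index [i]; the odd factor carries it beyond [M]. *)
  pose j := (2 ^ i * (2 * M).+1).-1.
  have jS : j.+1 = (2 ^ i * (2 * M).+1)%N by rewrite prednK// muln_gt0 expn_gt0.
  have jl : logn 2 j.+1 = i.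
    rewrite jS lognM ?expn_gt0// pfactorK// logn_coprime ?addn0//.
    by rewrite prime_coprime// dvdn2 /= oddM.
  apply: (HM j).
    by rewrite -ltnS jS (leq_trans _ (leq_pmull _ _)) ?expn_gt0// ltnS leq_pmull.
  have [_ _ _ /=] := st j; rewrite -/(x j) jl; apply; exists Y; split => //.
  by apply: (piece_trans oU aP _ pY); split => //; exact: pW.
have last X : exists M, X <> vzero -> forall j, (M <= j)%N -> x j <> X.
  have [[j0 xX]|nX] := pselect (exists j, x j = X); last by exists 0%N => _ j _ xX; apply: nX; exists j.
  have [X0|X0] := pselect (X = vzero); first by exists 0%N.
  have [i bi] : exists i, b i X by apply: bex => //; rewrite -xX; exact: piece_vle (px j0).
  by have [M HM] := few i; exists M => _ j /HM nb xjX; apply: nb; rewrite xjX.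
have [N NP] := choice last.
exists v, x, N; split => //; first by rewrite -W0.
by move=> j; split => //; have [] := st j.
Qed.

End greedy_decomposition.

Theorem theorem4p11 (R : realType) (m n : nat) (U : set 'rV[R]_n)
    (P : set (varifold m U)) (V : varifold m U) :
  (0 < m)%N -> (0 < n)%N -> (m <= n)%N -> open U ->
  appropriate P -> P V -> radon U (delta_norm V) ->
  exists (H : set (varifold m U)) (xi : varifold m U -> nat),
    decomposition P V H xi.
Proof.
move=> m0 _ _ oU aP PV rV; have fV := radon_finite rV.
have hB := @bundle_hausdorff R n.
have hT : hausdorff_space 'rV[R]_n := @norm_hausdorff _ _.
have [v [x [N [v0 vvz vP xP xN]]]] := exhausting_stages oU m0 aP PV fV.
pose z := vzero m U.
(* A nonzero [W] is not removed from stage [N W] on, so this counts every stage that removes it. *)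
pose xi W := (\sum_(i < N W) (x i == W))%N.
have fp W : piece P V W -> finite_on_compacts U (delta_norm W).
  move=> pW K cK KU; apply: (le_lt_trans _ (fV K cK KU)); exact: piece_delta_le pW.
(* At stages where nothing is removed [x i] is 0. This value is left out of the family, and both
   functionals summed below vanish on it. *)
exists [set W | W <> z /\ exists i, x i = W], xi; split.
- split.
    apply: (@sub_countable _ _ _ (range x)); last exact: card_image_le.
    by apply: subset_card_le => W [_ [i <-]]; exists i.
  by move=> W [W0 [i xW]]; have [[+ _] _] := xP i; rewrite xW => -[|/W0].
- move=> W [W0 [i xW]]; have iN : (i < N W)%N.
    by rewrite ltnNge; apply/negP => /(xN _ W0 i).
  by rewrite /xi (bigD1 (Ordinal iN))//= xW eqxx.
- move=> W [W0 [i xW]]; have [] := xP i; rewrite xW => -[[PW|//] [T QT [s d]]] [//|iW].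
  split => //; first exact: vle_vsum s.
  by exists T => // k Kk; rewrite s// addrC addKr.
- move=> k Kk; have Kn := Kspace_norm hB Kk; rewrite -[in vfun V k]v0.
  apply: (@sums_of_stages _ _ x z N (fun W => vfun W k) (fun W => vfun W (fun y => `|k y|))
      (fun i => vfun (v i) k) (fun i => vfun (v i) (fun y => `|k y|))) => //.
  + exact: vfun_vzero.
  + by move=> i; have [_ [s _]] := vP i; exact: s.
  + by move=> i; have [_ [s _]] := vP i; exact: s.
  + by move=> i; exact: vfun_norm.
  + by move=> i; exact: vfun_norm.
  + by have := vvz _ Kn; rewrite vfun_vzero.
- move=> f Kf; have Kn := Kspace_norm hT Kf.
  pose I (W : varifold m U) (h : 'rV[R]_n -> R) := Rintegral (delta_norm W) U h.
  suff : sums_to [set W | W <> z /\ exists i, x i = W] (fun W => (xi W)%:R * I W f) (I (v 0%N) f).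
    by rewrite v0.
  apply: (@sums_of_stages _ _ x z N (fun W => I W f) (fun W => I W (fun y => `|f y|))
      (fun i => I (v i) f) (fun i => I (v i) (fun y => `|f y|))) => //.
  + have z0 : delta_norm z = mzero by apply: measure_eq => A; exact: delta_norm_vzero.
    by rewrite /I z0 /Rintegral integral_measure_zero.
  + by move=> i; have [pi [_ s]] := vP i; exact: (delta_norm_Rintegral oU (fp _ pi) s Kf).
  + by move=> i; have [pi [_ s]] := vP i; exact: (delta_norm_Rintegral oU (fp _ pi) s Kn).
  + by move=> i; have [pi _] := xP i; exact: (Kintegral_norm hT oU (fp _ pi) Kf).
  + by move=> i; have [pi _] := vP i; exact: (Kintegral_norm hT oU (fp _ pi) Kf).
  + apply: (delta_norm_Rintegral_vanishes oU fV vvz) => // i.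
    by have [[_ [T _ s]] _] := vP i; exists T.
Qed.
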